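(* Let $k\ge 3$, let $C>0$ be a constant, and let $\delta_{i,j}\in(0,\tfrac14)$ and $\epsilon_{i,j}\in(0,\tfrac14)$ ($i,j\in\{1,\dots,k\}$) be constants. Then there exists $M$ (depending only on $k$, $C$ and these constants) such that the following holds. Let $d$ be a positive integer and let $A=(a_{i,j})_{1\le i,j\le k}$ be a symmetric $k\times k$ matrix of positive integers, all of whose entries are at least $M$, with $\sum_{j=1}^k a_{i,j}=d$ for every $i$. For each $i$ put $B_i=\max\{a_{i,\ell}:\ell\in\{1,\dots,k\}\setminus\{i\}\}$. Suppose that: (i) $C a_{i,i}>B_i$ for each $i\in\{1,\dots,k\}$; (ii) when not all of the intra-cluster degrees $a_{1,1},\dots,a_{k,k}$ are equal: - for all $i,j\in\{1,\dots,k\}$ with $a_{i,i}<a_{j,j}$, $$a_{i,i}\ \ge\ \left(\tfrac12+2\delta_{i,j}\right)a_{j,j};$$ - for all $i,j\in\{1,\dots,k\}$ with $a_{i,i}>a_{j,j}$ and $B_j>a_{i,i}-a_{j,j}$, $$\left(\tfrac12-2\epsilon_{i,j}\right)a_{i,i}\ \ge\ B_j .$$ Then, for the $k$-cluster regular stochastic block model $\mathcal{G}^n_A$, with $A$ fixed and $n\to\infty$ (along those $n$ for which the model is defined), the clusters $\mathcal{C}_1,\dots,\mathcal{C}_k$ are asymptotically almost surely unique. That is, with probability tending to $1$, every partition of the vertex set into sets $D_1,\dots,D_k$, each of size $n$, such that the subgraph induced on $D_i$ is $a_{i,i}$-regular for every $i$ and the bipartite graph between $D_i$ and $D_j$ is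 $a_{i,j}$-regular for every $i\ne j$, satisfies $\{D_1,\dots,D_k\}=\{\mathcal{C}_1,\dots,\mathcal{C}_k\}$.
   Context: Graphs are simple and labeled. $\mathcal{R}^n_a$ denotes the set of all $a$-regular graphs on $n$ labeled vertices. $\mathcal{B}^n_a$ denotes the set of all $a$-regular bipartite graphs on $2n$ labeled vertices with two given parts of $n$ vertices each (each vertex has exactly $a$ neighbours in the opposite part). The $k$-cluster regular stochastic block model $\mathcal{G}^n_A$ is the following random graph. Start with $kn$ labeled vertices and partition them uniformly at random into $k$ clusters $\mathcal{C}_1,\dots,\mathcal{C}_k$, each of size $n$. Then, mutually independently, place on the vertices of $\mathcal{C}_i$ a uniformly random member of $\mathcal{R}^n_{a_{i,i}}$ for each $i$, and place across $\mathcal{C}_i$ and $\mathcal{C}_j$ a uniformly random member of $\mathcal{B}^n_{a_{i,j}}$ for each pair $i\neq j$. The model is defined for those $n$ for which all these sets are nonempty, i.e. $n$ is large enough and $n a_{i,i}$ is even for every $i$. The numbers $a_{i,i}$ are called intra-cluster degrees and the $a_{i,j}$, $i\ne j$, inter-cluster degrees. ''The bipartite graph between $D_i$ and $D_j$ is $a$-regular'' means that each vertex of $D_i$ has exactly $a$ neighbours in $D_j$ and vice versa. A property holds asymptotically almost surely (a.a.s.) if its probability tends to $1$ as $n\to\infty$. *)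

(* Defs.v *)
From HB Require Import structures.
From mathcomp Require Import all_boot all_order all_algebra.
From mathcomp Require Import all_classical all_reals all_analysis.

Set Implicit Arguments.
Unset Strict Implicit.
Unset Printing Implicit Defensive.

Import Order.TTheory GRing.Theory Num.Theory.
Import numFieldNormedType.Exports.

Local Open Scope ring_scope.

(* A simple graph with labelled vertices in T is given by its edge set, a set
   of two-element subsets of T. *)
Definition degree_in (T : finType) (E : {set {set T}}) (S : {set T}) (v : T)
    : nat :=
  #|[set u in S | (u != v) && ([set u; v] \in E)]|.

Definition regular_within (T : finType) (E : {set {set T}}) (S : {set T})
    (a : nat) : bool :=
  [forall v in S, degree_in E S v == a].

Definition regular_between (T : finType) (E : {set {set T}})
    (S1 S2 : {set T}) (a : nat) : bool :=
  [forall v in S1, degree_in E S2 v == a] &&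
  [forall v in S2, degree_in E S1 v == a].

Definition regular_graphs_on (T : finType) (S : {set T}) (a : nat)
    : {set {set {set T}}} :=
  [set E : {set {set T}} |
    [forall e in E, (#|e| == 2%N) && (e \subset S)] && regular_within E S a].

(* S1 and S2 are the two given parts; meant for disjoint S1 and S2. *)
Definition bipartite_regular_graphs_on (T : finType) (S1 S2 : {set T})
    (a : nat) : {set {set {set T}}} :=
  [set E : {set {set T}} |
    [forall e in E, [exists u in S1, [exists v in S2, e == [set u; v]]]]
    && regular_between E S1 S2 a].

Definition regular_graphs (n a : nat) : {set {set {set 'I_n}}} :=
  regular_graphs_on [set: 'I_n] a.

Definition bipartite_regular_graphs (n a : nat)
    : {set {set {set ('I_n + 'I_n)%type}}} :=
  bipartite_regular_graphs_on
    [set x : 'I_n + 'I_n | if x is inl _ then true else false]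
    [set x : 'I_n + 'I_n | if x is inr _ then true else false] a.

Definition model_defined (k : nat) (A : 'M[nat]_k) (n : nat) : bool :=
  [forall i, regular_graphs n (A i i) != finset.set0] &&
  [forall i, [forall j,
    (i != j) ==> (bipartite_regular_graphs n (A i j) != finset.set0)]].

(* An ordered partition (D_1, ..., D_k) of the k * n vertices is encoded by the
   function sending each vertex to the index of its part. *)
Definition labelling (k n : nat) := {ffun 'I_(k * n) -> 'I_k}.

Definition part (k n : nat) (D : labelling k n) (i : 'I_k)
    : {set 'I_(k * n)} :=
  [set v | D v == i].

Definition equipartitions (k n : nat) : {set labelling k n} :=
  [set D : labelling k n | [forall i, #|part D i| == n]].

(* The unordered pairs {i, j}, including i = j: one graph is sampled for each. *)
Definition block_index (k : nat) := {p : 'I_k * 'I_k | (p.1 <= p.2)%N}.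

Definition block_graphs (k n : nat) (A : 'M[nat]_k) (D : labelling k n)
    (i j : 'I_k) : {set {set {set 'I_(k * n)}}} :=
  if i == j then regular_graphs_on (part D i) (A i i)
  else bipartite_regular_graphs_on (part D i) (part D j) (A i j).

Definition uniform (R : realType) (T : finType) (S : {set T}) (x : T) : R :=
  (x \in S)%:R / #|S|%:R.

Definition block_family (k n : nat) :=
  {ffun block_index k -> {set {set 'I_(k * n)}}}.

(* The clusters are uniform; given the clusters, the graphs of the blocks are
   uniform and mutually independent, hence the product. *)
Definition sbm_pmf (R : realType) (k n : nat) (A : 'M[nat]_k)
    (C : labelling k n) (F : block_family k n) : R :=
  uniform R (equipartitions k n) C *
  \prod_(p : block_index k)
    uniform R (block_graphs A C (val p).1 (val p).2) (F p).

Definition sbm_graph (k n : nat) (F : block_family k n)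
    : {set {set 'I_(k * n)}} :=
  (\bigcup_(p : block_index k) F p)%SET.

(* The probability that the clusters C and the graph E of the model satisfy the
   event Ev C E; meaningful when model_defined A n holds. *)
Definition sbm_prob (R : realType) (k n : nat) (A : 'M[nat]_k)
    (Ev : labelling k n -> {set {set 'I_(k * n)}} -> bool) : R :=
  \sum_(C : labelling k n)
    \sum_(F : block_family k n | Ev C (sbm_graph F)) sbm_pmf R A C F.

Definition compatible (k n : nat) (A : 'M[nat]_k) (E : {set {set 'I_(k * n)}})
    (D : labelling k n) : bool :=
  [forall i, regular_within E (part D i) (A i i)] &&
  [forall i, [forall j,
    (i != j) ==> regular_between E (part D i) (part D j) (A i j)]].

Definition clusters_unique (k n : nat) (A : 'M[nat]_k) (C : labelling k n)
    (E : {set {set 'I_(k * n)}}) : bool :=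
  [forall D in equipartitions k n, compatible A E D ==>
    ([set part D i | i : 'I_k] == [set part C i | i : 'I_k])].

(* A property holds a.a.s. along the n for which the model is defined. *)
Definition sbm_aas (R : realType) (k : nat) (A : 'M[nat]_k)
    (Ev : forall n, labelling k n -> {set {set 'I_(k * n)}} -> bool) : Prop :=
  (sbm_prob R A (Ev n) @[n --> within (fun n => model_defined A n) \oo]
     --> (1 : R))%classic.

Definition max_inter_degree (k : nat) (A : 'M[nat]_k) (i : 'I_k) : nat :=
  \max_(l < k | l != i) A i l.

(* Main.v *)
Require Import Defs.
From HB Require Import structures.
From mathcomp Require Import all_boot all_order all_algebra.
From mathcomp Require Import all_classical all_reals all_analysis.
From mathcomp Require Import ring lra zify.
From mathcomp Require Import fintype finset bigop.

Set Implicit Arguments.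
Unset Strict Implicit.
Unset Printing Implicit Defensive.

Import Order.TTheory GRing.Theory Num.Theory.
Import numFieldNormedType.Exports.

Local Open Scope ring_scope.

(** Fix the clusters C. By [blocks_prob], the random graph is then uniform
    among the simple graphs in which every vertex v has exactly A (C v) c
    neighbours in the cluster c. Let b = 2d/n. Two facts about this uniform graph
    replace independence.

    - Resampling ([resample_product]). Let u1, u2 lie in one cluster and let R be
      a subset of one cluster not containing them. Forget, for each vertex of R
      adjacent to exactly one of u1, u2, which of the two it is adjacent to.
      Conditionally on the rest, the part attached to u1 is a uniformly random
      subset of its size. For disjoint pairs this may be done pair by pair, so
      that a product of statistics of conditional mean at most 1 has mean at
      most 1.
    - Switching ([edges_prob]). A given set F of edges, all meeting one small set,
      is present with probability at most b^|F|. Hence nonnegative polynomials in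
      disjoint blocks of edge indicators have means bounded as for independent
      edges of probability b ([edge_polynomial], [edge_mgf]).

    Let D be a partition into parts of size n, with the prescribed degrees, whose
    set of parts differs from that of C. Every vertex u has exactly A (D u) l
    neighbours in part l of D. By [near_or_far] there are two possibilities.

    Far: some part D_l contains at least eta n vertices of a cluster C_m and misses
    at least eta n of them. Choose a cluster C_i other than C_m and pair up a
    linear number of its vertices. Most pairs have no common neighbour in C_m and
    many neighbours in both portions of C_m, so resampling such a pair hits the
    prescribed degree with probability at most 1/Q: it is a point probability of a
    hypergeometric law of large variance ([hypergeometric_point]). The total
    Q^(-n/32) beats the number k^(kn) of labellings once Q is large, and Q grows
    with the least entry of A. That is [far_prob].

    Near: up to a permutation pi of the labels, D agrees with C outside a set S of
    at most k eta n misplaced vertices.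
    - If d|S| is at least a small constant times n, some portion of a cluster C_m
      placed in a wrong part l has order at least n/d. It has linearly many
      neighbours in a suitable cluster C_i. Pairing the vertices of C_i, linearly
      many pairs see a random subset containing at least one vertex of that
      portion but not only such vertices; for these the prescribed degree has
      conditional probability at most 7/9 ([exact_draws_swap]). The bound
      e^(-kappa n) of [mid_prob] beats the number of such D, which is at most
      k^k e^(kappa n/2) when eta is small ([count_near]).
    - If d|S| is smaller, the permutation pi preserves A, since each cluster has
      vertices without neighbour in S. Then no vertex outside S can have exactly
      one neighbour in S ([misplaced_no_unique_nbr]): its degree into the part of
      that neighbour would be wrong by one. So the d|S| edge ends at S are spent
      inside S or in groups of at least two at the outside vertices, which is
      unlikely: the sum over all S of the probabilities is at most 2d/n
      ([small_regime]).

    The failure probability is therefore at most a constant over n, uniformly in C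
    ([not_unique_prob]). *)

(** * Graphs and the exchange of neighbours *)

Section Graphs.
Variable T : finType.
Implicit Types (E : {set {set T}}) (u v x y : T).

Definition adj E u v := (u != v) && ([set u; v] \in E).
Definition nbr E u : {set T} := [set v | adj E u v].
Definition simple E := [forall e in E, #|e| == 2%N].
Definition graph_of (r : rel T) : {set {set T}} :=
  [set e | [exists x, exists y, [&& x != y, r x y & e == [set x; y]]]].

Lemma adjC E u v : adj E u v = adj E v u.
Proof. by rewrite /adj eq_sym finset.setUC. Qed.

Lemma adjxx E u : adj E u u = false.
Proof. by rewrite /adj eqxx. Qed.

Lemma set2_eq x y x' y' : x != y -> [set x; y] = [set x'; y'] ->
  (x = x' /\ y = y') \/ (x = y' /\ y = x').
Proof.
move=> nxy e.
have: x \in [set x'; y'] by rewrite -e set21.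
have: y \in [set x'; y'] by rewrite -e set22.
rewrite !inE => /orP[]/eqP ey /orP[]/eqP ex; subst; move: nxy; rewrite ?eqxx //.
- by right.
- by left.
Qed.

Lemma adj_graph_of (r : rel T) u v : symmetric r ->
  adj (graph_of r) u v = (u != v) && r u v.
Proof.
move=> rs; rewrite /adj; case: (boolP (u != v)) => //= nuv; rewrite inE.
apply/existsP/idP => [[x /existsP[y /and3P[nxy rxy /eqP e]]]|ruv].
  by case: (set2_eq nuv e) => -[-> ->] //; rewrite rs.
by exists u; apply/existsP; exists v; rewrite nuv ruv eqxx.
Qed.

Lemma simple_graph_of (r : rel T) : simple (graph_of r).
Proof.
apply/forallP => e; apply/implyP; rewrite inE.
move=> /existsP[x /existsP[y /and3P[nxy _ /eqP ->]]].
by rewrite cards2 nxy.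
Qed.

Lemma simple_edge E e : simple E -> e \in E ->
  exists x y, [/\ x != y, e = [set x; y] & adj E x y].
Proof.
move=> /forallP /(_ e) /implyP H eE; have /cards2P[x [y [nxy ee]]] := H eE.
by exists x, y; split=> //; rewrite /adj nxy -ee.
Qed.

Lemma graph_ext E E' : simple E -> simple E' ->
  (forall x y, adj E x y = adj E' x y) -> E = E'.
Proof.
move=> sE sE' h; apply/setP => e; apply/idP/idP => eE.
  have [x [y [nxy -> axy]]] := simple_edge sE eE.
  by move: axy; rewrite h => /andP[].
have [x [y [nxy -> axy]]] := simple_edge sE' eE.
by move: axy; rewrite -h => /andP[].
Qed.

Section Reassign.
Variables (E : {set {set T}}) (u1 u2 : T) (R X1 X2 : {set T}).

(** The graph obtained from E by prescribing, inside R, the neighbours of u1 to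
    be X1 and those of u2 to be X2. *)
Definition reassign_rel a b :=
  if b \in R then
    (if a == u1 then b \in X1 else if a == u2 then b \in X2 else adj E a b)
  else if a \in R then
    (if b == u1 then a \in X1 else if b == u2 then a \in X2 else adj E a b)
  else adj E a b.

Definition reassign := graph_of reassign_rel.

Hypotheses (n12 : u1 != u2) (u1R : u1 \notin R) (u2R : u2 \notin R).

Lemma reassign_sym : symmetric reassign_rel.
Proof.
move=> a b; rewrite /reassign_rel.
case: (boolP (b \in R)) => bR; case: (boolP (a \in R)) => aR //.
- have -> : (a == u1) = false by apply: (contraNF _ u1R) => /eqP <-.
  have -> : (a == u2) = false by apply: (contraNF _ u2R) => /eqP <-.
  have -> : (b == u1) = false by apply: (contraNF _ u1R) => /eqP <-.
  have -> : (b == u2) = false by apply: (contraNF _ u2R) => /eqP <-.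
  by rewrite adjC.
- by rewrite (adjC E a b).
- by rewrite (adjC E a b).
- by rewrite adjC.
Qed.

Lemma adj_reassign a b : adj reassign a b =
  if b \in R then
    (if a == u1 then b \in X1 else if a == u2 then b \in X2 else adj E a b)
  else if a \in R then
    (if b == u1 then a \in X1 else if b == u2 then a \in X2 else adj E a b)
  else adj E a b.
Proof.
rewrite adj_graph_of; last exact: reassign_sym.
case: (boolP (a == b)) => //= /eqP <-; rewrite adjxx.
have [aR|//] := boolP (a \in R).
have -> : (a == u1) = false by apply: (contraNF _ u1R) => /eqP <-.
by have -> : (a == u2) = false by apply: (contraNF _ u2R) => /eqP <-.
Qed.

Hypotheses (sX1 : X1 \subset R) (sX2 : X2 \subset R).

Lemma nbr_reassign1 : nbr reassign u1 = (nbr E u1 :\: R) :|: X1.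
Proof.
apply/setP => b; rewrite !inE adj_reassign (negbTE u1R) eqxx.
case: (boolP (b \in R)) => bR //=.
by rewrite (contraNF (subsetP sX1 b) bR) orbF.
Qed.

Lemma nbr_reassign2 : nbr reassign u2 = (nbr E u2 :\: R) :|: X2.
Proof.
apply/setP => b; rewrite !inE adj_reassign (negbTE u2R) eqxx eq_sym (negbTE n12).
case: (boolP (b \in R)) => bR //=.
by rewrite (contraNF (subsetP sX2 b) bR) orbF.
Qed.

Lemma nbr_reassign_out z : z \notin R -> z != u1 -> z != u2 ->
  nbr reassign z = nbr E z.
Proof.
move=> zR z1 z2; apply/setP => b; rewrite !inE adj_reassign (negbTE zR).
by rewrite (negbTE z1) (negbTE z2) if_same.
Qed.

Lemma adj_reassign_in z t : z \in R ->
  adj reassign z t = if t == u1 then z \in X1 else if t == u2 then z \in X2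
                     else adj E z t.
Proof.
move=> zR; rewrite adj_reassign zR.
case: (boolP (t \in R)) => // tR.
have -> : (z == u1) = false by apply: (contraNF _ u1R) => /eqP <-.
have -> : (z == u2) = false by apply: (contraNF _ u2R) => /eqP <-.
have -> : (t == u1) = false by apply: (contraNF _ u1R) => /eqP <-.
by have -> : (t == u2) = false by apply: (contraNF _ u2R) => /eqP <-.
Qed.

End Reassign.

(** The information kept when a pair is resampled: of the edges between R and
    u1, u2, only whether a vertex of R sees at least one of u1, u2, and whether
    it sees both; every other adjacency is kept entirely. *)
Definition pair_key E u1 u2 (R : {set T}) : {ffun T * T -> bool * bool} :=
  [ffun p : T * T =>
    if (p.1 \in R) && (p.2 \in [set u1; u2])
      then (adj E u1 p.1 || adj E u2 p.1, adj E u1 p.1 && adj E u2 p.1)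
    else if (p.2 \in R) && (p.1 \in [set u1; u2])
      then (adj E u1 p.2 || adj E u2 p.2, adj E u1 p.2 && adj E u2 p.2)
    else (adj E p.1 p.2, adj E p.1 p.2)].

Lemma pair_key_adj E E' u1 u2 (R : {set T}) a b :
  pair_key E u1 u2 R = pair_key E' u1 u2 R ->
  ~~ ((a \in R) && (b \in [set u1; u2])) -> ~~ ((b \in R) && (a \in [set u1; u2])) ->
  adj E a b = adj E' a b.
Proof.
move=> /ffunP /(_ (a, b)); rewrite !ffunE /= => h h1 h2; move: h.
rewrite (negbTE h1) (negbTE h2).
by case.
Qed.

Lemma pair_key_sum E E' u1 u2 (R : {set T}) w :
  pair_key E u1 u2 R = pair_key E' u1 u2 R -> w \in R ->
  (adj E u1 w + adj E u2 w = adj E' u1 w + adj E' u2 w)%N.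
Proof.
move=> /ffunP /(_ (w, u1)) h wR; move: h; rewrite !ffunE /= wR set21.
by case: (adj E u1 w); case: (adj E u2 w); case: (adj E' u1 w); case: (adj E' u2 w).
Qed.

Lemma pair_key_nbr E E' u1 u2 (R : {set T}) z :
  pair_key E u1 u2 R = pair_key E' u1 u2 R -> z \notin R -> z != u1 -> z != u2 ->
  nbr E z = nbr E' z.
Proof.
move=> h zR z1 z2; apply/setP => b; rewrite !inE; apply: (pair_key_adj h).
  by rewrite negb_and zR.
by rewrite !inE negb_and negb_or z1 z2 orbT.
Qed.

End Graphs.

(** * Graphs with prescribed degrees into the clusters *)

Section Omega.
Variables (T I : finType) (cl : T -> I) (A : I -> I -> nat).
Implicit Types (E : {set {set T}}).

Definition cluster_of (c : I) : {set T} := [set v | cl v == c].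

Definition regular_graph_set : {set {set {set T}}} :=
  [set E | simple E && [forall v, [forall c, #|nbr E v :&: cluster_of c| == A (cl v) c]]].
Local Notation Omega := regular_graph_set.

Lemma OmegaP E : reflect (simple E /\ forall v c, #|nbr E v :&: cluster_of c| = A (cl v) c)
  (E \in Omega).
Proof.
rewrite inE; apply: (iffP andP) => -[sE h]; split=> //.
  by move=> v c; move/forallP: h => /(_ v) /forallP /(_ c) /eqP.
by apply/forallP => v; apply/forallP => c; rewrite h.
Qed.

(** Degrees are preserved because each vertex of R keeps its number of
    neighbours in the pair u1, u2, which lies in one cluster, while u1 and u2 keep
    their numbers of neighbours in R, which lies in one cluster. *)
Lemma reassign_Omega E u1 u2 (R X1 X2 : {set T}) m : u1 != u2 -> cl u1 = cl u2 ->
  u1 \notin R -> u2 \notin R -> R \subset cluster_of m ->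
  X1 \subset R -> X2 \subset R ->
  #|X1| = #|nbr E u1 :&: R| -> #|X2| = #|nbr E u2 :&: R| ->
  (forall w, w \in R -> (w \in X1) + (w \in X2) = adj E u1 w + adj E u2 w)%N ->
  E \in Omega -> reassign E u1 u2 R X1 X2 \in Omega.
Proof.
move=> n12 c12 u1R u2R sR s1 s2 h1 h2 h3 /OmegaP[sE hE]; apply/OmegaP; split.
  exact: simple_graph_of.
move=> v c.
have gen (N X : {set T}) : X \subset R -> #|X| = #|N :&: R| ->
    #|((N :\: R) :|: X) :&: cluster_of c| = #|N :&: cluster_of c|.
  move=> sX hX; rewrite finset.setIUl cardsU.
  have -> : (N :\: R) :&: cluster_of c :&: (X :&: cluster_of c) = finset.set0.
    apply/eqP; rewrite -subset0; apply/subsetP => z; rewrite !inE.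
    case: (boolP (z \in X)) => zX; last by rewrite andbF.
    by rewrite (subsetP sX).
  rewrite cards0 subn0 -(cardsID R (N :&: cluster_of c)) addnC; congr addn.
    have [mc|mc] := eqVneq m c.
      subst c; rewrite (finset.setIidPl (fintype.subset_trans sX sR)) hX.
      rewrite -finset.setIA (finset.setIC (cluster_of m)) finset.setIA.
      rewrite (finset.setIidPl (fintype.subset_trans (subsetIr _ _) sR)) //.
    have e0 (B : {set T}) : B \subset R -> B :&: cluster_of c = finset.set0.
      move=> sB; apply/eqP; rewrite -subset0; apply/subsetP => z; rewrite !inE => /andP[zB zc].
      have := subsetP sR z (subsetP sB z zB); rewrite inE (eqP zc) => /eqP e.
      by rewrite e eqxx in mc.
    by rewrite e0 // -finset.setIA (finset.setIC (cluster_of c)) finset.setIA e0 ?subsetIr.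
  by apply: eq_card => z; rewrite !inE andbA.
have [->|v1] := eqVneq v u1; first by rewrite nbr_reassign1 // gen // hE.
have [->|v2] := eqVneq v u2; first by rewrite nbr_reassign2 // gen // hE.
have [vR|vR] := boolP (v \in R); last by rewrite nbr_reassign_out // hE.
rewrite -hE.
have cs E' : #|nbr E' v :&: cluster_of c| = (\sum_(t in cluster_of c) adj E' v t)%N.
  rewrite -sum1_card big_mkcond [RHS]big_mkcond; apply: eq_bigr => t _.
  by rewrite !inE; case: (adj E' v t); case: (cl t == c).
rewrite !cs big_mkcond [RHS]big_mkcond /= (bigD1 u1) // [RHS](bigD1 u1) //=.
rewrite (bigD1 u2) 1?eq_sym // [in RHS](bigD1 u2) 1?eq_sym //= !addnA; congr addn.
  rewrite !inE -c12 !adj_reassign_in // eqxx (eq_sym u2 u1) (negbTE n12) eqxx.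
  by case: ifP => // _; rewrite h3 // !(adjC E v).
by apply: eq_bigr => t /andP[t1 t2]; rewrite adj_reassign_in // (negbTE t1) (negbTE t2).
Qed.

End Omega.

(** * Resampling the neighbourhoods of disjoint pairs *)

Section Resample.
Variables (K : realType) (T I : finType) (cl : T -> I) (A : I -> I -> nat).
Local Notation Omega := (regular_graph_set cl A).
Local Notation cluster_of := (cluster_of cl).
Implicit Types (E : {set {set T}}) (X R : {set T}).

Definition switchable E u1 u2 R : {set T} :=
  ((nbr E u1 :\: nbr E u2) :|: (nbr E u2 :\: nbr E u1)) :&: R.

Definition switch_count E u1 u2 R : nat := #|(nbr E u1 :\: nbr E u2) :&: R|.

(** Given the information of [pair_key], the neighbourhoods of u1 and u2 are
    determined by the set X of those switchable vertices that are attached to u1,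
    and X is uniform among the subsets of its size. Hence this is the statement
    that phi has conditional mean at most 1. *)
Definition mean_le1 (phi : {set T} -> {set T} -> K) E u1 u2 R :=
  let W := switchable E u1 u2 R in
  let r := switch_count E u1 u2 R in
  \sum_(X : {set T} | (X \subset W) && (#|X| == r))
     phi ((nbr E u1 :\: W) :|: X) ((nbr E u2 :\: W) :|: (W :\: X))
  <= 'C(#|W|, r)%:R.

Section OnePair.
Variables (u1 u2 : T) (R : {set T}) (m : I).
Hypotheses (n12 : u1 != u2) (c12 : cl u1 = cl u2) (u1R : u1 \notin R)
  (u2R : u2 \notin R) (sR : R \subset cluster_of m).

Section OneClass.
Variable E0 : {set {set T}}.
Hypothesis E0O : E0 \in Omega.
Variables (W : {set T}) (r : nat).
Hypotheses (Wdef : W = switchable E0 u1 u2 R) (rdef : r = switch_count E0 u1 u2 R).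
Let N1 X := (nbr E0 u1 :\: W) :|: X.
Let N2 X := (nbr E0 u2 :\: W) :|: (W :\: X).
Let h X := reassign E0 u1 u2 R (N1 X :&: R) (N2 X :&: R).
Let h' E := nbr E u1 :&: W.
Let inclass E := (E \in Omega) && (pair_key E u1 u2 R == pair_key E0 u1 u2 R).

Let sW : W \subset R. Proof. by rewrite Wdef subsetIr. Qed.

Let WE v : (v \in W) = (v \in R) && (adj E0 u1 v != adj E0 u2 v).
Proof.
rewrite Wdef !inE; case: (v \in R); rewrite ?andbF // andbT.
by case: (adj E0 u1 v); case: (adj E0 u2 v).
Qed.

Let card_N1W : #|nbr E0 u1 :&: W| = r.
Proof.
rewrite rdef; apply: eq_card => v; rewrite [LHS]inE WE !inE; case: (v \in R); rewrite ?andbF ?andbT //=.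
by case: (adj E0 u1 v); case: (adj E0 u2 v).
Qed.

Let card_N2W : #|nbr E0 u2 :&: W| = #|W :\: (nbr E0 u1 :&: W)|.
Proof.
apply: eq_card => v; rewrite [LHS]inE [in RHS]inE [in RHS]inE WE !inE.
case: (v \in R); rewrite ?andbF ?andbT //=.
by case: (adj E0 u1 v); case: (adj E0 u2 v).
Qed.

Let card_D X : X \subset W -> #|X| = r -> #|W :\: X| = #|nbr E0 u2 :&: W|.
Proof.
move=> sX cX; rewrite card_N2W !cardsD (finset.setIidPr sX) cX.
by rewrite (finset.setIidPr (subsetIr _ _)) card_N1W.
Qed.

Let card_NX (N X Y : {set T}) : X \subset W -> Y = N :&: W -> #|X| = #|Y| ->
  #|((N :\: W) :|: X) :&: R| = #|N :&: R|.
Proof.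
move=> sX -> cX.
have eX : ((N :\: W) :|: X) :&: R :&: W = X.
  apply/setP => v; rewrite !in_setI in_setU in_setD; case: (boolP (v \in X)) => vX.
    have vW := subsetP sX v vX; by rewrite orbT vW (subsetP sW).
  by case: (v \in W); rewrite ?andbF.
rewrite -(cardsID W (((N :\: W) :|: X) :&: R)) eX cX -[RHS](cardsID W).
congr addn.
  by rewrite -finset.setIA (finset.setIidPr sW).
apply: eq_card => v; rewrite !(in_setI, in_setU, in_setD).
case: (boolP (v \in W)) => vW //=.
by rewrite (contraNF (subsetP sX v) vW) orbF.
Qed.

Let h_spec X : X \subset W -> #|X| = r ->
  [/\ inclass (h X), h' (h X) = X, nbr (h X) u1 = N1 X & nbr (h X) u2 = N2 X].
Proof.
move=> sX cX.
have e1 : nbr (h X) u1 = N1 X.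
  rewrite nbr_reassign1 ?subsetIr //; apply/setP => v.
  rewrite [LHS]inE !in_setD !in_setI; case: (boolP (v \in R)) => vR; rewrite ?andbT ?andbF //=.
  rewrite !in_setU !in_setD orbF; case: (boolP (v \in W)) => [/(subsetP sW)|vW].
    by rewrite (negbTE vR).
  by rewrite (contraNF (subsetP sX v) vW) orbF.
have e2 : nbr (h X) u2 = N2 X.
  rewrite nbr_reassign2 ?subsetIr //; apply/setP => v.
  rewrite [LHS]inE !in_setD !in_setI; case: (boolP (v \in R)) => vR; rewrite ?andbT ?andbF //=.
  rewrite !in_setU !in_setD orbF; case: (boolP (v \in W)) => [/(subsetP sW)|vW].
    by rewrite (negbTE vR).
  by rewrite (contraNF (subsetP sX v) vW) /= orbF.
have e3 w : w \in R ->
    ((w \in N1 X) + (w \in N2 X) = adj E0 u1 w + adj E0 u2 w)%N.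
  move=> wR; have := WE w; rewrite wR /= !in_setU !in_setD.
  case: (boolP (w \in W)) => wW /esym; last first.
    by rewrite (contraNF (subsetP sX w) wW) !orbF /= !inE.
  move=> hw; rewrite /=; case: (w \in X); move: hw;
  by case: (adj E0 u1 w); case: (adj E0 u2 w).
split=> //; last first.
  rewrite /h' e1; apply/setP => v; rewrite !in_setI in_setU in_setD.
  case: (boolP (v \in W)) => vW /=; first by rewrite andbT.
  by rewrite (contraNF (subsetP sX v) vW) andbF.
apply/andP; split.
  apply: (@reassign_Omega _ _ _ _ _ _ _ _ _ _ m) => //; try exact: subsetIr.
  - by apply: (card_NX sX erefl); rewrite card_N1W.
  - by apply: (card_NX _ erefl); rewrite ?subsetDl // card_D.
  - by move=> w wR; rewrite !in_setI wR !andbT e3.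
have hin w t : w \in R -> adj (h X) t w = adj (h X) w t by rewrite adjC.
apply/eqP/ffunP => -[a b]; rewrite !ffunE /=.
have sm w : w \in R ->
    (adj (h X) u1 w || adj (h X) u2 w, adj (h X) u1 w && adj (h X) u2 w) =
    (adj E0 u1 w || adj E0 u2 w, adj E0 u1 w && adj E0 u2 w).
  move=> wR; have := e3 w wR; rewrite -e1 -e2 !in_set.
  by case: (adj E0 u1 w); case: (adj E0 u2 w); case: (adj _ u1 w); case: (adj _ u2 w).
case: ifP => [/andP[aR _]|c1]; first by rewrite sm.
case: ifP => [/andP[bR _]|c2]; first by rewrite sm.
rewrite adj_reassign // .
move: c1 c2; rewrite !inE.
case: (b \in R); case: (a \in R) => //=.
- by move=> _ /negbT; rewrite negb_or => /andP[/negbTE-> /negbTE->].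
- by move=> _ /negbT; rewrite negb_or => /andP[/negbTE-> /negbTE->].
- by move=> /negbT; rewrite negb_or => /andP[/negbTE-> /negbTE->].
Qed.

Let class_spec E : inclass E ->
  [/\ h' E \subset W, #|h' E| = r & h (h' E) = E].
Proof.
move=> /andP[EO /eqP ek].
have dis1 u v : u \notin R -> v \notin R -> adj E u v = adj E0 u v.
  by move=> uR vR; apply: (pair_key_adj ek); rewrite ?(negbTE uR) ?(negbTE vR).
have sm w : w \in R -> (adj E u1 w + adj E u2 w = adj E0 u1 w + adj E0 u2 w)%N.
  exact: pair_key_sum.
have e1 : nbr E u1 = N1 (h' E).
  apply/setP => v; rewrite in_setU in_setD in_setI WE !inE.
  case: (boolP (v \in R)) => vR /=; last by rewrite andbF orbF dis1.
  have := sm v vR.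
  by case: (adj E u1 v); case: (adj E u2 v); case: (adj E0 u1 v); case: (adj E0 u2 v).
have e2 : nbr E u2 = N2 (h' E).
  apply/setP => v; rewrite in_setU !in_setD in_setI WE !inE.
  case: (boolP (v \in R)) => vR /=; last by rewrite andbF orbF dis1.
  have := sm v vR.
  by case: (adj E u1 v); case: (adj E u2 v); case: (adj E0 u1 v); case: (adj E0 u2 v).
have sh : h' E \subset W by exact: subsetIr.
have ch : #|h' E| = r.
  have /OmegaP[_ hE] := EO; have /OmegaP[_ hE0] := E0O.
  have := hE u1 m; rewrite -hE0 -(cardsID W) -[RHS](cardsID W).
  have -> : nbr E u1 :&: cluster_of m :\: W = nbr E0 u1 :&: cluster_of m :\: W.
    apply/setP => v; rewrite e1 !in_setD !in_setI !in_setU in_setD.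
    case: (boolP (v \in W)) => vW //=.
    by rewrite (contraNF (subsetP sh v) vW) orbF.
  move/addIn; rewrite -!finset.setIA.
  by rewrite (finset.setIidPr (fintype.subset_trans sW sR)) card_N1W.
split=> //.
have /OmegaP[sE _] := EO.
apply: graph_ext => //; first exact: simple_graph_of.
have nE u v : (v \in nbr E u) = adj E u v by rewrite inE.
move=> a b; rewrite adj_reassign //.
have [bR|bR] := boolP (b \in R).
  rewrite !in_setI bR !andbT -e1 -e2 !nE.
  case: eqP => [-> //|/eqP a1]; case: eqP => [-> //|/eqP a2].
  apply/esym/(pair_key_adj ek); rewrite !inE !negb_and !negb_or ?a1 ?a2 ?orbT //.
  by rewrite (memPn u1R _ bR) (memPn u2R _ bR) orbT.
have [aR|aR] := boolP (a \in R).
  rewrite !in_setI aR !andbT -e1 -e2 !nE.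
  case: eqP => [->|/eqP b1]; first by rewrite adjC.
  case: eqP => [->|/eqP b2]; first by rewrite adjC.
  apply/esym/(pair_key_adj ek); rewrite !inE !negb_and !negb_or ?b1 ?b2 ?orbT //.
  by rewrite (negbTE bR).
by rewrite dis1.
Qed.

(** The graphs with the same key as E0 correspond to the subsets X of size r of
    the switchable set W, by attaching X to u1 and the rest of W to u2. *)
Lemma class_sum (phi : {set T} -> {set T} -> K) :
  \sum_(E in Omega | pair_key E u1 u2 R == pair_key E0 u1 u2 R)
     phi (nbr E u1) (nbr E u2) =
  \sum_(X : {set T} | (X \subset W) && (#|X| == r)) phi (N1 X) (N2 X).
Proof.
rewrite (reindex_onto h h') /=; last by move=> E /class_spec[].
apply: eq_big => [X|X].
  apply/andP/andP => [[/class_spec[s c _] /eqP e]|[s /eqP c]].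
    by rewrite -e s c.
  by case: (h_spec s c) => ic e _ _; split; [exact: ic | exact/eqP].
move=> /andP[/class_spec[s c _] /eqP e].
have {}s : X \subset W by rewrite -e.
have {}c : #|X| = r by rewrite -e.
by case: (h_spec s c) => _ _ -> ->.
Qed.

Lemma card_class :
  #|[set E in Omega | pair_key E u1 u2 R == pair_key E0 u1 u2 R]|%:R
    = 'C(#|W|, r)%:R :> K.
Proof.
have := class_sum (fun _ _ => 1).
rewrite -cards_draws -!sum1_card !natr_sum => e.
rewrite [RHS](eq_bigl (fun X : {set T} => (X \subset W) && (#|X| == r))); last first.
  by move=> X; rewrite inE.
by rewrite -e; apply: eq_bigl => E; rewrite inE.
Qed.

End OneClass.

(** Averaging over the classes of equal key, on each of which g is constant. *)
Lemma resample_pair (phi : {set T} -> {set T} -> K) (g : {set {set T}} -> K) :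
  (forall E, 0 <= g E) ->
  (forall E E', pair_key E u1 u2 R = pair_key E' u1 u2 R -> g E = g E') ->
  (forall E, E \in Omega -> mean_le1 phi E u1 u2 R) ->
  \sum_(E in Omega) phi (nbr E u1) (nbr E u2) * g E <= \sum_(E in Omega) g E.
Proof.
move=> g0 gk mphi.
rewrite (partition_big (fun E => pair_key E u1 u2 R) predT) //=.
rewrite [leRHS](partition_big (fun E => pair_key E u1 u2 R) predT) //=.
apply: ler_sum => kappa _.
have [/existsP[E0 /andP[E0O /eqP ek]]|/existsPn none] :=
  boolP [exists E, (E \in Omega) && (pair_key E u1 u2 R == kappa)]; last first.
  by rewrite !big1 // => E H; have := none E; rewrite H.
have gE E : (E \in Omega) && (pair_key E u1 u2 R == kappa) -> g E = g E0.
  by move=> /andP[_ /eqP e]; apply: gk; rewrite e.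
rewrite (eq_bigr (fun E => phi (nbr E u1) (nbr E u2) * g E0)); last first.
  by move=> E /gE ->.
rewrite [leRHS](eq_bigr (fun E => 1 * g E0)); last by move=> E /gE ->; rewrite mul1r.
rewrite -!mulr_suml; apply: ler_wpM2r; first exact: g0.
have -> : \sum_(E in Omega | pair_key E u1 u2 R == kappa) (1 : K) =
  'C(#|switchable E0 u1 u2 R|, switch_count E0 u1 u2 R)%:R.
  rewrite -(card_class _ erefl erefl) // -sum1_card natr_sum ek; apply: eq_bigl => E; by rewrite inE.
by rewrite -ek (class_sum _ erefl erefl) //; exact: mphi.
Qed.

End OnePair.

(** One pair is removed at a time. The factors of the other pairs depend on
    neighbourhoods of vertices outside R and different from the removed pair,
    which are determined by the key of that pair. *)
Lemma resample_product (ps : seq (T * T)) (R : {set T}) (i m : I)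
    (phi : T * T -> {set T} -> {set T} -> K) :
  uniq (unzip1 ps ++ unzip2 ps) ->
  (forall u, u \in unzip1 ps ++ unzip2 ps -> cl u = i /\ u \notin R) ->
  R \subset cluster_of m ->
  (forall p N1 N2, 0 <= phi p N1 N2) ->
  (forall p E, p \in ps -> E \in Omega -> mean_le1 (phi p) E p.1 p.2 R) ->
  \sum_(E in Omega) \prod_(p <- ps) phi p (nbr E p.1) (nbr E p.2) <= #|Omega|%:R.
Proof.
move=> + + sR phi0; elim: ps => [|[u1 u2] ps IH] /= un hu hm.
  rewrite (eq_bigr (fun=> 1)) ?sumr_const // => E _; by rewrite big_nil.
move: un; rewrite /= cat_uniq /= mem_cat inE !negb_or -!andbA.
case/and5P=> u1p1 n12 u1p2 un1 /andP[u2p1 /andP[h1 /andP[u2p2 un2]]].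
have hu' u : u \in unzip1 ps ++ unzip2 ps -> cl u = i /\ u \notin R.
  move=> uu; apply: hu; move: uu; rewrite !mem_cat !inE mem_cat inE.
  by case/orP => ->; rewrite ?orbT.
apply: le_trans (IH _ hu' _); first last.
- by move=> p E pp; apply: hm; rewrite inE pp orbT.
- by rewrite cat_uniq un1 h1 un2.
have [c1 R1] : cl u1 = i /\ u1 \notin R by apply: hu; rewrite inE eqxx.
have [c2 R2] : cl u2 = i /\ u2 \notin R.
  by apply: hu; rewrite inE mem_cat inE eqxx ?orbT.
under eq_bigr do rewrite big_cons /=.
apply: (@resample_pair u1 u2 R m) => //.
- by rewrite c1 c2.
- by move=> E; apply: prodr_ge0 => p _; exact: phi0.
- move=> E E' ek; apply: eq_big_seq => -[a b] pp /=.
  have a1 : a \in unzip1 ps by apply/mapP; exists (a, b).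
  have b1 : b \in unzip2 ps by apply/mapP; exists (a, b).
  have [_ aR] : cl a = i /\ a \notin R by apply: hu'; rewrite mem_cat a1.
  have [_ bR] : cl b = i /\ b \notin R by apply: hu'; rewrite mem_cat b1 orbT.
  rewrite (pair_key_nbr ek aR); last 2 first.
  - by rewrite (memPn u1p1 _ a1).
  - by rewrite (memPn u2p1 _ a1).
  rewrite (pair_key_nbr ek bR) //.
  - by rewrite (memPn u1p2 _ b1).
  - by rewrite (memPn u2p2 _ b1).
- by move=> E EO; apply: (hm (u1, u2)) => //; rewrite inE eqxx.
Qed.

End Resample.

(** * Switching: presence of given edges *)

Section Switching.
Local Open Scope nat_scope.
Variables (T I : finType) (cl : T -> I) (A : I -> I -> nat) (n d : nat).
Local Notation Omega := (regular_graph_set cl A).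
Local Notation cluster_of := (cluster_of cl).
Implicit Types (E F : {set {set T}}) (X R S : {set T}).
Hypotheses (hcard : forall c, #|cluster_of c| = n)
  (hsym : forall i j, A i j = A j i) (hrow : forall i, \sum_c A i c = d).

Lemma card_dep (T1 T2 : finType) (U : {set T1}) (f : T1 -> {set T2}) :
  #|[set p : T1 * T2 | (p.1 \in U) && (p.2 \in f p.1)]| = \sum_(u in U) #|f u|.
Proof.
rewrite -sum1_card.
under [RHS]eq_bigr do rewrite -sum1_card.
rewrite pair_big_dep /=; apply: eq_bigl => p; by rewrite inE.
Qed.

Lemma adj_sum E v S : #|nbr E v :&: S| = \sum_(t in S) adj E v t.
Proof.
rewrite -sum1_card big_mkcond [RHS]big_mkcond; apply: eq_bigr => t _.
by rewrite !inE; case: (adj E v t); case: (t \in S).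
Qed.

Lemma A_le_d i c : (A i c <= d)%N.
Proof. by rewrite -(hrow i) (bigD1 c) //= leq_addr. Qed.

Lemma deg_cluster E v c : E \in Omega -> #|nbr E v :&: cluster_of c| = A (cl v) c.
Proof. by case/OmegaP. Qed.

Section OneEdge.
Variables (S0 : {set T}) (F : {set {set T}}) (x y : T).
Hypotheses (hS0 : (8 * #|S0| <= n)%N) (hn : (8 * d.+1 <= n)%N)
  (hF : forall f, f \in F -> f :&: S0 != finset.set0)
  (nxy : x != y) (xyF : [set x; y] \notin F).

Let i := cl x.
Let m := cl y.
Let a := A i m.

(** The edges uv that can be switched with the edge xy: u is in the cluster of x
    and v in that of y, so that replacing xy, uv by xv, uy preserves all degrees
    into clusters; and u, v avoid S0, so that no edge of F is lost. *)
Definition partner E : {set T * T} :=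
  [set p | [&& (p.1 \in cluster_of i) && (p.2 \in cluster_of m), adj E p.1 p.2,
    p.1 \notin y |: (nbr E y :|: S0) & p.2 \notin x |: (nbr E x :|: S0)]].

Let card_bound E z c : E \in Omega ->
  (#|cluster_of c :&: (z |: (nbr E z :|: S0))| <= 1 + (A (cl z) c + #|S0|))%N.
Proof.
move=> EO; rewrite !finset.setIUr.
apply: leq_trans (leq_card_setU _ _) _; apply: leq_add.
  by rewrite -(cards1 z) subset_leq_card // subsetIr.
apply: leq_trans (leq_card_setU _ _) _; apply: leq_add.
  by rewrite finset.setIC deg_cluster.
by rewrite subset_leq_card // subsetIr.
Qed.

(** Among the n a edges between the two clusters, at most 2 (1 + a + |S0|) a
    are excluded, that is at most half of them. *)
Lemma card_partner E : E \in Omega -> (n * a <= 2 * #|partner E|)%N.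
Proof.
move=> EO.
have tot : (\sum_(u in cluster_of i) \sum_(v in cluster_of m) adj E u v = n * a)%N.
  under eq_bigr => u ui do rewrite -adj_sum deg_cluster //.
  rewrite (eq_bigr (fun=> a)); last by move=> u; rewrite inE => /eqP ->.
  by rewrite sum_nat_const hcard.
have cp : #|partner E| = (\sum_(u in cluster_of i) \sum_(v in cluster_of m)
   [&& adj E u v, u \notin y |: (nbr E y :|: S0) & v \notin x |: (nbr E x :|: S0)])%N.
  rewrite pair_big /= -sum1_card big_mkcond [RHS]big_mkcond; apply: eq_bigr => -[u v] _ /=.
  by rewrite [_ \in partner E]in_set /=; do 2![case: (_ \in cluster_of _)] => //=.
have bu : (\sum_(u in cluster_of i) \sum_(v in cluster_of m)
    (u \in y |: (nbr E y :|: S0)) && adj E u v <= (1 + (a + #|S0|)) * a)%N.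
  rewrite (eq_bigr (fun u => ((u \in y |: (nbr E y :|: S0)) * a)%N)); last first.
    move=> u; rewrite inE => /eqP ui; case: (u \in _); rewrite ?mul0n ?mul1n /=.
      by rewrite -adj_sum deg_cluster // ui.
    by rewrite big1.
  rewrite -big_distrl /= leq_mul2r; apply/orP; right.
  have -> : (\sum_(u in cluster_of i) (u \in y |: (nbr E y :|: S0)) =
     #|cluster_of i :&: (y |: (nbr E y :|: S0))|)%N.
    rewrite -sum1_card big_mkcond [RHS]big_mkcond; apply: eq_bigr => u _.
    by rewrite !in_setI; case: ifP; case: (u \in y |: _).
  by rewrite (leq_trans (card_bound _ _ EO)) // hsym.
have bv : (\sum_(u in cluster_of i) \sum_(v in cluster_of m)
    (v \in x |: (nbr E x :|: S0)) && adj E u v <= (1 + (a + #|S0|)) * a)%N.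
  rewrite exchange_big /=.
  rewrite (eq_bigr (fun v => ((v \in x |: (nbr E x :|: S0)) * a)%N)); last first.
    move=> v; rewrite inE => /eqP vm; case: (v \in _); rewrite ?mul0n ?mul1n /=.
      under eq_bigr do rewrite adjC.
      by rewrite -adj_sum deg_cluster // vm hsym.
    by rewrite big1.
  rewrite -big_distrl /= leq_mul2r; apply/orP; right.
  have -> : (\sum_(u in cluster_of m) (u \in x |: (nbr E x :|: S0)) =
     #|cluster_of m :&: (x |: (nbr E x :|: S0))|)%N.
    rewrite -sum1_card big_mkcond [RHS]big_mkcond; apply: eq_bigr => u _.
    by rewrite !in_setI; case: ifP; case: (u \in x |: _).
  exact: (card_bound _ _ EO).
have le3 : (n * a <= #|partner E| + ((1 + (a + #|S0|)) * a + (1 + (a + #|S0|)) * a))%N.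
  rewrite -tot cp; apply: leq_trans (leq_add (leqnn _) (leq_add bu bv)).
  rewrite -!big_split /=; apply: leq_sum => u _.
  rewrite -!big_split /=; apply: leq_sum => v _.
  by case: (adj E u v); case: (u \in y |: _); case: (v \in x |: _).
have ad : (a <= d)%N by exact: A_le_d.
have : (4 * (1 + (a + #|S0|)) * a <= n * a)%N by rewrite leq_mul2r; apply/orP; right; lia.
lia.
Qed.

Definition swap_edges E (p : T * T) :=
  reassign E x p.1 [set y; p.2] [set p.2] [set y].

Section Valid.
Variables (E : {set {set T}}) (u v : T).
Hypotheses (EO : E \in Omega) (Exy : adj E x y) (pE : (u, v) \in partner E).

Let pf : [/\ cl u = i, cl v = m, adj E u v & [/\ u != y, ~~ adj E y u, u \notin S0,
  v != x & ~~ adj E x v /\ v \notin S0]].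
Proof.
by move: pE; rewrite !inE /= !negb_or => /and4P[/andP[/eqP-> /eqP->] -> /and3P[-> -> ->] /and3P[-> -> ->]].
Qed.

Let dist : [/\ x != u, x \notin [set y; v], u \notin [set y; v] & y != v].
Proof.
have [cu cv auv [uy yu uS vx [xv vS]]] := pf.
rewrite !inE !negb_or nxy uy (eq_sym x v) vx.
have -> : u != v by apply: contraTneq auv => ->; rewrite adjxx.
split=> //; first by apply: contraNneq xv => ->.
by apply: contraNneq yu => ->; rewrite adjC.
Qed.

Lemma swap_edges_back : E = reassign (swap_edges E (u, v)) x u [set y; v] [set y] [set v].
Proof.
have [cu cv auv [uy yu uS vx [xv vS]]] := pf; have [xu xR uR yv] := dist.
apply: graph_ext; [by case/OmegaP: EO|exact: simple_graph_of|move=> b c].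
rewrite adj_reassign // adj_reassign //=.
have aux w : w \in [set y; v] -> (adj E x w = (w \in [set y])) * (adj E u w = (w \in [set v])).
  rewrite !inE => /orP[]/eqP ->; rewrite ?eqxx ?(negbTE yv) ?Exy ?auv //.
    by rewrite adjC (negbTE yu).
  by rewrite eq_sym (negbTE yv) (negbTE xv).
case: (boolP (c \in [set y; v])) => cR.
  case: eqP => [->|_]; first by rewrite aux.
  by case: eqP => [->|_] //; rewrite aux.
case: (boolP (b \in [set y; v])) => bR //.
case: eqP => [->|_]; first by rewrite adjC aux.
by case: eqP => [->|_] //; rewrite adjC aux.
Qed.

Lemma swap_edges_Omega : swap_edges E (u, v) \in Omega.
Proof.
have [cu cv auv [uy yu uS vx [xv vS]]] := pf; have [xu xR uR yv] := dist.
apply: (@reassign_Omega _ _ _ _ _ _ _ _ _ _ m) => //=.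
- by apply/subsetP => w; rewrite !inE => /orP[]/eqP->; rewrite // cv.
- by rewrite sub1set !inE eqxx orbT.
- by rewrite sub1set !inE eqxx.
- rewrite cards1 -(cards1 y); apply: eq_card => w; rewrite !inE.
  case: eqP => [->|_] /=; first by rewrite Exy.
  by case: eqP => [->|_]; rewrite ?andbF // (negbTE xv).
- rewrite cards1 -(cards1 v); apply: eq_card => w; rewrite !inE.
  case: (eqVneq w v) => [->|_] /=; first by rewrite auv orbT.
  by rewrite orbF; case: eqP => [->|_]; rewrite ?andbF // adjC (negbTE yu).
move=> w; rewrite !inE => /orP[]/eqP ->.
  by rewrite eqxx (negbTE yv) Exy adjC (negbTE yu).
by rewrite eqxx eq_sym (negbTE yv) auv (negbTE xv).
Qed.

Lemma swap_edges_nbr :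
  (u \in nbr (swap_edges E (u, v)) y :&: cluster_of i) /\
  (v \in nbr (swap_edges E (u, v)) x :&: cluster_of m).
Proof.
have [cu cv auv [uy yu uS vx [xv vS]]] := pf; have [xu xR uR yv] := dist.
rewrite !inE cu cv !eqxx !andbT !adj_reassign //=.
by rewrite (negbTE uR) !inE !eqxx orbT /= eq_sym (negbTE xu).
Qed.

Lemma swap_edges_sub : F \subset E -> F \subset swap_edges E (u, v).
Proof.
have [cu cv auv [uy yu uS vx [xv vS]]] := pf; have [xu xR uR yv] := dist.
move=> sF; apply/subsetP => f fF.
have /OmegaP[sE _] := EO.
have [b [c [nbc ef abc]]] := simple_edge sE (subsetP sF f fF).
suff : adj (swap_edges E (u, v)) b c by rewrite ef => /andP[].
have xyf : f != [set x; y] by apply: contraNneq xyF => <-.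
have uvf : f != [set u; v].
  apply: contraTneq (hF fF) => ->; rewrite negbK -subset0; apply/subsetP => w.
  by rewrite !inE => /andP[/orP[]/eqP-> h]; rewrite ?h // in uS vS *; move: vS; rewrite h.
have aux z w : w \in [set y; v] -> f = [set z; w] -> adj E z w -> z != x /\ z != u.
  rewrite !inE => /orP[]/eqP -> fe azw; split.
  - by apply: contraNneq xyf => <-; rewrite fe.
  - by apply: contraTneq azw => ->; rewrite adjC.
  - by apply: contraTneq azw => ->.
  - by apply: contraNneq uvf => <-; rewrite fe.
rewrite adj_reassign //=.
case: (boolP (c \in [set y; v])) => cR.
  by have [/negbTE-> /negbTE->] := aux b c cR ef abc.
case: (boolP (b \in [set y; v])) => bR //.
by have [/negbTE-> /negbTE->] := aux c b bR (etrans ef (finset.setUC _ _)) (etrans (adjC _ _ _) abc).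
Qed.

End Valid.

(** Double counting of switchings. A graph that contains xy has at least n a / 2
    of them. The outcome together with uv determines the graph, and in the outcome
    u is one of the a neighbours of y in the cluster of x, and v one of the a
    neighbours of x in the cluster of y. Hence the proportion of graphs
    containing xy is at most a^2 / (n a / 2), which is at most 2d/n. *)
Lemma switch_edge :
  (n * #|[set E in Omega | (F \subset E) && adj E x y]|
    <= 2 * d * #|[set E in Omega | F \subset E]|)%N.
Proof.
set O1 := [set E in Omega | (F \subset E) && adj E x y].
set O2 := [set E in Omega | F \subset E].
pose D := [set q : {set {set T}} * (T * T) | (q.1 \in O1) && (q.2 \in partner q.1)].
pose D' := [set q : {set {set T}} * (T * T) | (q.1 \in O2) &&
   (q.2 \in finset.setX (nbr q.1 y :&: cluster_of i) (nbr q.1 x :&: cluster_of m))].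
have cD : (n * a * #|O1| <= 2 * #|D|)%N.
  rewrite /D card_dep big_distrr /= mulnC -sum_nat_const; apply: leq_sum => E.
  by rewrite inE => /andP[EO _]; exact: card_partner.
have cD' : #|D'| = (#|O2| * (a * a))%N.
  rewrite /D' (card_dep _ (fun E => finset.setX (nbr E y :&: cluster_of i) (nbr E x :&: cluster_of m))).
  rewrite -sum_nat_const; apply: eq_bigr => E; rewrite inE => /andP[EO _].
  by rewrite cardsX !deg_cluster // [A (cl y) _]hsym.
have decO E : E \in O1 -> [/\ E \in Omega, F \subset E & adj E x y].
  by rewrite in_set => /and3P.
have decD q : q \in D ->
    [/\ q.1 \in Omega, F \subset q.1, adj q.1 x y & q.2 \in partner q.1].
  by rewrite in_set => /andP[/decO[]].
have le : (#|D| <= #|D'|)%N.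
  rewrite -(@card_in_imset _ _ (fun q => (swap_edges q.1 q.2, q.2)) (mem D)).
    apply/subset_leq_card/subsetP => _ /imsetP[[E [u v]] ED ->].
    have [/= EO FE Exy pE] := decD _ ED.
    rewrite in_set /= in_set swap_edges_Omega // swap_edges_sub //= in_setX /=.
    by have [-> ->] := swap_edges_nbr pE.
  move=> [E [u v]] [E' [u' v']] /decD[/= EO _ Exy pE] /decD[/= EO' _ Exy' pE'] [e1 e2 e3].
  rewrite -e2 -e3 in pE' e1 *.
  by congr (_, _); rewrite (swap_edges_back EO Exy pE) e1 -swap_edges_back.
have [a0|apos] := posnP a.
  suff -> : O1 = finset.set0 by rewrite cards0 muln0.
  apply/eqP; rewrite -subset0; apply/subsetP => E /decO[EO _ Exy].
  have := deg_cluster x m EO; rewrite -/i -/a a0 => /eqP; rewrite cards_eq0 => /eqP/setP/(_ y).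
  by rewrite !inE Exy eqxx.
have ad : (a <= d)%N by exact: A_le_d.
have h1 : (n * a * #|O1| <= 2 * (#|O2| * (a * a)))%N by lia.
have h2 : (a * (n * #|O1|) <= a * (2 * a * #|O2|))%N by lia.
rewrite leq_pmul2l // in h2; apply: leq_trans h2 _.
by rewrite leq_mul2r leq_mul2l ad !orbT.
Qed.

End OneEdge.

(** The edges of F are added one at a time. *)
Lemma edges_prob_nat (S0 : {set T}) (F : {set {set T}}) :
  (8 * #|S0| <= n)%N -> (8 * d.+1 <= n)%N ->
  (forall f, f \in F -> f :&: S0 != finset.set0) ->
  (n ^ #|F| * #|[set E in Omega | F \subset E]| <= (2 * d) ^ #|F| * #|Omega|)%N.
Proof.
move=> hS0 hn; elim: {F}#|F| {-2}F (erefl #|F|) => [|c IH] F cF hF.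
  rewrite cF !expn0 !mul1n; apply: subset_leq_card; apply/subsetP => E.
  by rewrite inE => /andP[].
have /card_gt0P[f fF] : (0 < #|F|)%N by rewrite cF.
have cF' : #|F :\ f| = c by move: cF; rewrite (cardsD1 f) fF => -[].
have hF' g : g \in F :\ f -> g :&: S0 != finset.set0 by rewrite inE => /andP[_]; exact: hF.
have := IH _ cF' hF'; rewrite cF cF' => IHc.
have [/cards2P[x [y [nxy ef]]]|nf] := boolP (#|f| == 2%N); last first.
  suff -> : [set E in Omega | F \subset E] = finset.set0 by rewrite cards0 muln0.
  apply/eqP; rewrite -subset0; apply/subsetP => E; rewrite inE => /andP[/OmegaP[sE _] sF].
  by move: nf; move/forallP: sE => /(_ f) /implyP ->; rewrite // (subsetP sF).
have xyF : [set x; y] \notin F :\ f by rewrite ef !inE eqxx.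
have := switch_edge hS0 hn hF' nxy xyF.
have -> : [set E in Omega | (F :\ f \subset E) && adj E x y] = [set E in Omega | F \subset E].
  apply/setP => E; rewrite !in_set; congr (_ && _).
  rewrite /adj nxy -ef /= -{2}(finset.setD1K fF) finset.subUset sub1set.
  by rewrite andbC.
move=> st; rewrite !expnS.
apply: leq_trans (_ : (n ^ c * (2 * d * #|[set E in Omega | F :\ f \subset E]|) <= _))%N.
  by rewrite (mulnC n) -mulnA leq_mul2l st orbT.
by rewrite mulnCA -[X in _ <= X]mulnA leq_mul2l IHc orbT.
Qed.

End Switching.

(** * Probabilities, moments and edge counts *)

Section Probability.
Variables (K : realType) (T I : finType) (cl : T -> I) (A : I -> I -> nat).
Local Notation Omega := (regular_graph_set cl A).
Implicit Types (E F : {set {set T}}) (f g : {set {set T}} -> K) (P Q : pred {set {set T}}).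

Definition Ex f : K := (\sum_(E in Omega) f E) / #|Omega|%:R.
Definition Pr P : K := Ex (fun E => (P E)%:R).

Lemma Ex_le f c : 0 <= c -> \sum_(E in Omega) f E <= c * #|Omega|%:R -> Ex f <= c.
Proof.
move=> c0 h; rewrite /Ex; have [e|o0] := posnP #|Omega|.
  by rewrite e mulr0n invr0 mulr0.
by rewrite ler_pdivrMr // ltr0n.
Qed.

Lemma Ex_mono f g : (forall E, E \in Omega -> f E <= g E) -> Ex f <= Ex g.
Proof.
by move=> fg; rewrite /Ex ler_wpM2r ?invr_ge0 ?ler0n //; exact: ler_sum.
Qed.

Lemma Ex_sum (J : finType) (S : pred J) (F : J -> {set {set T}} -> K) :
  Ex (fun E => \sum_(j | S j) F j E) = \sum_(j | S j) Ex (F j).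
Proof. by rewrite /Ex exchange_big /= mulr_suml. Qed.

Lemma ExZ c f : Ex (fun E => c * f E) = c * Ex f.
Proof. by rewrite /Ex -mulr_sumr mulrA. Qed.

Lemma Pr_ge0 P : 0 <= Pr P.
Proof. by rewrite /Pr /Ex divr_ge0 ?ler0n // sumr_ge0. Qed.

Lemma Pr_le P Q : (forall E, E \in Omega -> P E -> Q E) -> Pr P <= Pr Q.
Proof.
move=> PQ; apply: Ex_mono => E EO; have := PQ E EO.
by case: (P E); case: (Q E) => //; rewrite ?lexx // => /(_ isT).
Qed.

Lemma Pr_union (J : finType) (S : pred J) P (Q : J -> pred {set {set T}}) :
  (forall E, E \in Omega -> P E -> exists2 j, S j & Q j E) ->
  Pr P <= \sum_(j | S j) Pr (Q j).
Proof.
move=> PQ; rewrite /Pr -Ex_sum; apply: Ex_mono => E EO.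
have := PQ E EO; case: (P E) => [/(_ isT)[j Sj Qj]|_]; last by rewrite sumr_ge0.
by rewrite (bigD1 j) //= Qj lerDl sumr_ge0.
Qed.

Lemma Pr_or P Q1 Q2 : (forall E, E \in Omega -> P E -> Q1 E || Q2 E) ->
  Pr P <= Pr Q1 + Pr Q2.
Proof.
move=> h; apply: le_trans (_ : \sum_(b : bool) Pr (if b then Q1 else Q2) <= _).
  by apply: Pr_union => E EO /(h _ EO)/orP[]; [exists true|exists false].
by rewrite big_bool.
Qed.

Lemma markov_le P f c t : 0 < t -> (forall E, E \in Omega -> 0 <= f E) ->
  (forall E, E \in Omega -> P E -> t <= f E) -> Ex f <= c -> Pr P <= c / t.
Proof.
move=> t0 f0 Pf fc; rewrite ler_pdivlMr //; apply: le_trans fc.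
rewrite mulrC -ExZ; apply: Ex_mono => E EO; case: (boolP (P E)) => PE.
  by rewrite mulr1 Pf.
by rewrite mulr0 f0.
Qed.

End Probability.

Section EdgeMoments.
Variables (K : realType) (T I : finType) (cl : T -> I) (A : I -> I -> nat) (n d : nat).
Local Notation Omega := (regular_graph_set cl A).
Local Notation cluster_of := (cluster_of cl).
Local Notation Ex := (@Ex K T I cl A).
Implicit Types (E F : {set {set T}}) (S X : {set T}).
Hypotheses (hcard : forall c, #|cluster_of c| = n)
  (hsym : forall i j, A i j = A j i) (hrow : forall i, (\sum_c A i c)%N = d).
Variable S0 : {set T}.
Hypotheses (hS0 : (8 * #|S0| <= n)%N) (hn : (8 * d.+1 <= n)%N).

Definition edge_ratio : K := (2 * d)%:R / n%:R.
Local Notation b := edge_ratio.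

Lemma n_gt0 : (0 < n)%N. Proof. lia. Qed.

Lemma edge_ratio_ge0 : 0 <= b.
Proof. by rewrite divr_ge0 ?ler0n. Qed.

Lemma edges_prob F : (forall f, f \in F -> f :&: S0 != finset.set0) ->
  \sum_(E in Omega) (F \subset E)%:R <= b ^+ #|F| * #|Omega|%:R.
Proof.
move=> hF; have := edges_prob_nat hcard hsym hrow hS0 hn hF.
have -> : \sum_(E in Omega) ((F \subset E)%:R : K) = #|[set E in Omega | F \subset E]|%:R.
  rewrite -sum1_card natr_sum [RHS](eq_bigl (fun E => (E \in Omega) && (F \subset E))).
    rewrite big_mkcondr; apply: eq_bigr => E _; by case: (F \subset E).
  by move=> E; rewrite inE.
rewrite -(ler_nat K) !natrM !natrX => h.
rewrite /b expr_div_n mulrAC ler_pdivlMr ?exprn_gt0 ?ltr0n ?n_gt0 // mulrC.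
by rewrite natrM in h *.
Qed.

(** After expansion of the product, each term has nonnegative coefficient and
    asks for the presence of a union of sets from disjoint blocks, whose size is
    the sum of the sizes; [edges_prob] applies to it. The induction carries the
    set F0 of the edges already asked for. *)
Lemma edge_polynomial (J : eqType) (S : finType) (js : seq J) (c : J -> S -> K)
    (Phi : J -> S -> {set {set T}}) (B : J -> {set {set T}}) :
  uniq js ->
  (forall j s, 0 <= c j s) ->
  (forall j s, j \in js -> c j s != 0 -> Phi j s \subset B j) ->
  (forall i j, i \in js -> j \in js -> i != j -> [disjoint B i & B j]) ->
  (forall j f, j \in js -> f \in B j -> f :&: S0 != finset.set0) ->
  Ex (fun E => \prod_(j <- js) \sum_s c j s * (Phi j s \subset E)%:R)
    <= \prod_(j <- js) \sum_s c j s * b ^+ #|Phi j s|.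
Proof.
move=> un c0 hPhi hdis hB.
suff gen F0 : (forall f, f \in F0 -> f :&: S0 != finset.set0) ->
    (forall j, j \in js -> [disjoint F0 & B j]) ->
    \sum_(E in Omega) (F0 \subset E)%:R *
      \prod_(j <- js) \sum_s c j s * (Phi j s \subset E)%:R
    <= b ^+ #|F0| * (\prod_(j <- js) \sum_s c j s * b ^+ #|Phi j s|) * #|Omega|%:R.
  apply: Ex_le.
    by apply: prodr_ge0 => j _; apply: sumr_ge0 => s _; rewrite mulr_ge0 ?exprn_ge0 ?edge_ratio_ge0.
  have h0 : \sum_(E in Omega) (finset.set0 \subset E)%:R *
      \prod_(j <- js) \sum_s c j s * (Phi j s \subset E)%:R <= _ := gen finset.set0 _ _.
  rewrite cards0 expr0 mul1r in h0.
  rewrite (eq_bigr (fun E => (finset.set0 \subset E)%:R *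
      \prod_(j <- js) \sum_s c j s * (Phi j s \subset E)%:R)); last first.
    by move=> E _; rewrite finset.sub0set mul1r.
  by apply: h0 => [f|j _]; rewrite ?inE // disjoints_subset finset.sub0set.
elim: js F0 un hPhi hdis hB => [|j js IH] F0 un hPhi hdis hB hF0 hd0.
  rewrite (eq_bigr (fun E => (F0 \subset E)%:R)); last first.
    by move=> E _; rewrite big_nil mulr1.
  by rewrite big_nil mulr1; exact: edges_prob.
have := un; rewrite /= => /andP[jjs un'].
have -> : \sum_(E in Omega) (F0 \subset E)%:R *
      \prod_(i <- j :: js) \sum_s c i s * (Phi i s \subset E)%:R =
   \sum_s c j s * \sum_(E in Omega) ((F0 :|: Phi j s) \subset E)%:R *
      \prod_(i <- js) \sum_s c i s * (Phi i s \subset E)%:R.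
  rewrite [RHS](eq_bigr (fun s => \sum_(E in Omega) c j s * (((F0 :|: Phi j s) \subset E)%:R *
      \prod_(i <- js) \sum_s c i s * (Phi i s \subset E)%:R))); last first.
    by move=> s _; rewrite mulr_sumr.
  rewrite [RHS]exchange_big /=; apply: eq_bigr => E _.
  rewrite big_cons mulr_suml mulr_sumr; apply: eq_bigr => s _.
  by rewrite finset.subUset -mulnb natrM !mulrA (mulrC (c j s)).
rewrite big_cons mulr_suml mulr_sumr mulr_suml; apply: ler_sum => s _.
have [->|cn0] := eqVneq (c j s) 0; first by rewrite !(mul0r, mulr0).
have sB := hPhi j s (mem_head _ _) cn0.
have cU : #|F0 :|: Phi j s| = (#|F0| + #|Phi j s|)%N.
  rewrite cardsU (_ : F0 :&: _ = finset.set0) ?cards0 ?subn0 //.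
  apply/eqP; rewrite setI_eq0.
  exact: disjointWr sB (hd0 j (mem_head _ _)).
have -> : b ^+ #|F0| * (c j s * b ^+ #|Phi j s| *
   \prod_(j0 <- js) \sum_s0 c j0 s0 * b ^+ #|Phi j0 s0|) * #|Omega|%:R =
  c j s * (b ^+ #|F0 :|: Phi j s| *
   (\prod_(j0 <- js) \sum_s0 c j0 s0 * b ^+ #|Phi j0 s0|) * #|Omega|%:R).
  by rewrite cU exprD !mulrA (mulrC (c j s)).
apply: ler_wpM2l => //; apply: IH => //.
- by move=> i t ijs; apply: hPhi; rewrite inE ijs orbT.
- by move=> i i' ijs ijs'; apply: hdis; rewrite inE ?ijs ?ijs' orbT.
- by move=> i f ijs; apply: hB; rewrite inE ijs orbT.
- move=> f; rewrite inE => /orP[/hF0//|fP]; apply: (hB j); rewrite ?mem_head //.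
  exact: (subsetP sB).
- move=> i ijs; rewrite -setI_eq0 finset.setIUl finset.setU_eq0 !setI_eq0.
  rewrite hd0 ?inE ?ijs ?orbT //=; apply: disjointWl sB _.
  apply: hdis; rewrite ?mem_head ?inE ?ijs ?orbT //.
  by apply: contraNneq jjs => ->.
Qed.

(** The exponential is the product over the edges of 1 + (e^l - 1) times the
    indicator, a case of [edge_polynomial]. *)
Lemma edge_mgf (B : {set {set T}}) (l : K) : 0 <= l ->
  (forall f, f \in B -> f :&: S0 != finset.set0) ->
  Ex (fun E => expR (l * #|E :&: B|%:R)) <= expR (b * expR l * #|B|%:R).
Proof.
move=> l0 hB.
pose c (e : {set T}) (s : bool) : K := if s then expR l - 1 else 1.
pose Phi (e : {set T}) (s : bool) : {set {set T}} := if s then [set e] else finset.set0.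
have el : 0 <= expR l - 1 by rewrite subr_ge0 -expR0 ler_expR.
have := @edge_polynomial _ bool (enum B) c Phi (fun e => [set e]) (enum_uniq _).
move=> /(_ _ _ _ _) h.
apply: le_trans (_ : Ex (fun E => \prod_(e <- enum B) \sum_s c e s * (Phi e s \subset E)%:R) <= _).
  apply: Ex_mono => E _; rewrite le_eqVlt; apply/orP; left; apply/eqP.
  rewrite -sum1_card natr_sum mulr_sumr expR_sum big_enum /=.
  rewrite (eq_bigl (fun e => (e \in B) && (e \in E))); last by move=> e; rewrite inE andbC.
  rewrite big_mkcondr; apply: eq_bigr => e _; rewrite big_bool /= finset.sub0set sub1set mulr1.
  by case: (e \in E); rewrite ?mulr1 ?mulr0 ?add0r // subrK.
apply: le_trans (h _ _ _ _) _.
- by move=> e [] /=.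
- by move=> e [] _ _; rewrite /= ?finset.sub0set.
- by move=> e e' _ _ ne; rewrite disjoints1 inE.
- by move=> e f; rewrite mem_enum inE => eB /eqP ->; exact: hB.
rewrite big_enum /= -sum1_card natr_sum mulr_sumr expR_sum; apply: ler_prod => e _.
rewrite big_bool /= cards0 cards1 expr0 !mulr1 expr1.
apply/andP; split; first by rewrite addr_ge0 // mulr_ge0 // edge_ratio_ge0.
apply: le_trans (expR_ge1Dx _); rewrite addrC lerD2l mulrC ler_wpM2l ?edge_ratio_ge0 //.
by rewrite gerBl.
Qed.

End EdgeMoments.

(** * Binomial estimates *)

Section Binomials.
Local Open Scope nat_scope.

Lemma bin_central_rec m : m.+1 * 'C(m.+1.*2, m.+1) = 2 * (m.*2.+1 * 'C(m.*2, m)).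
Proof.
have h1 := mul_bin_diag m.+1.*2 m.
have h2 := mul_bin_left m.*2.+1 m.
have h3 := mul_bin_diag m.*2.+1 m.
have e : 'C(m.*2.+1, m.+1) = 'C(m.*2.+1, m).
  by rewrite -[RHS]bin_sub; [congr 'C(_, _); lia|lia].
rewrite doubleS /= in h1 h3 *.
rewrite -h1; move: h3 e; move: ('C(m.*2.+1, m.+1)) ('C(m.*2.+1, m)) ('C(m.*2, m)).
move=> a b c h3 e; subst b; rewrite h3; lia.
Qed.

(** The squares avoid square roots: this is the bound 4^m / sqrt(2m+1). *)
Lemma bin_central_le m : 'C(m.*2, m) ^ 2 * m.*2.+1 <= 16 ^ m.
Proof.
elim: m => [//|m IH].
have r := bin_central_rec m; rewrite (expnS 16) -(@leq_pmul2l (m.+1 ^ 2)) ?expn_gt0 //.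
rewrite mulnA -expnMn r doubleS.
apply: leq_trans (_ : 4 * (m.*2.+1 * m.*2.+3) * ('C(m.*2, m) ^ 2 * m.*2.+1) <= _).
  by rewrite eq_leq //; ring.
rewrite [leqRHS]mulnA; apply: leq_mul; last exact: IH.
rewrite -!muln2; nia.
Qed.

Lemma bin_central_ge m : 0 < m -> 16 ^ m <= 'C(m.*2, m) ^ 2 * (4 * m).
Proof.
case: m => // m _; elim: m => [//|m IH].
have r := bin_central_rec m.+1; rewrite (expnS 16) -(@leq_pmul2l (m.+2 ^ 2)) ?expn_gt0 //.
rewrite [in leqRHS]mulnA -expnMn r doubleS.
apply: leq_trans (_ : m.+2 ^ 2 * (16 * ('C(m.+1.*2, m.+1) ^ 2 * (4 * m.+1))) <= _).
  by rewrite !leq_mul2l IH !orbT.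
have -> : m.+2 ^ 2 * (16 * ('C(m.+1.*2, m.+1) ^ 2 * (4 * m.+1))) =
  'C(m.+1.*2, m.+1) ^ 2 * (m.+2 ^ 2 * 64 * m.+1) by ring.
have -> : (2 * ((m.+1).*2.+1 * 'C((m.+1).*2, m.+1))) ^ 2 * (4 * m.+2) =
  'C(m.+1.*2, m.+1) ^ 2 * (16 * ((m.+1).*2.+1) ^ 2 * m.+2) by ring.
rewrite leq_mul2l; apply/orP; right; rewrite -!muln2; nia.
Qed.

Lemma bin_le_half n j : 'C(n, j) <= 'C(n, n./2).
Proof.
have up i : i.*2.+1 <= n -> 'C(n, i) <= 'C(n, i.+1).
  move=> h; rewrite -(@leq_pmul2l i.+1) // mul_bin_left leq_mul2r.
  by apply/orP; right; lia.
have lo i : i <= n./2 -> 'C(n, i) <= 'C(n, n./2).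
  move=> h; rewrite -(subKn h); elim: (n./2 - i) => [|c IH]; first by rewrite subn0.
  apply: leq_trans IH; have [hc|hc] := leqP n./2 c; last first.
    by rewrite -(subnSK hc); apply: up; lia.
  by rewrite (_ : n./2 - c.+1 = n./2 - c) //; lia.
have [h|h] := leqP j n./2; first exact: lo.
have [h'|h'] := leqP j n; last by rewrite bin_small.
by rewrite -bin_sub //; apply: lo; lia.
Qed.

Lemma bin_sq_le n j : 'C(n, j) ^ 2 * n.+1 <= 4 ^ n.
Proof.
apply: leq_trans (_ : 'C(n, n./2) ^ 2 * n.+1 <= _).
  by rewrite leq_mul2r leq_sqr bin_le_half orbT.
have := odd_double_half n; move: (n./2) => m; case: (odd n) => /= <-; last first.
  by rewrite add0n (leq_trans (bin_central_le m)) // -muln2 mulnC expnM.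
rewrite add1n -(@leq_pmul2l 4) //.
have e : 2 * 'C(m.*2.+1, m) = 'C(m.+1.*2, m.+1).
  rewrite doubleS binS mul2n -addnn; congr (_ + _).
  by rewrite -bin_sub; [congr 'C(_, _); lia|lia].
apply: leq_trans (_ : 'C(m.+1.*2, m.+1) ^ 2 * m.+1.*2.+1 <= _).
  rewrite -e expnMn -mulnA leq_mul2l /= leq_mul2l; apply/orP; right; lia.
apply: leq_trans (bin_central_le _) _.
by rewrite -expnS (_ : 16 = 4 ^ 2) // -expnM mulnC leq_exp2l //; lia.
Qed.

(** With t marked elements out of 2r and r of them drawn, each value j of the
    number of marked draws has probability at most 1/Q once both t and 2r - t are
    at least K1. Indeed the two factors of the numerator are at most
    2^t / sqrt(t+1) and 2^(2r-t) / sqrt(2r-t+1), and the denominator is at least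
    4^r / (2 sqrt r). *)
Lemma hypergeometric_point (r t j K1 Q : nat) : t <= r.*2 -> K1 <= t -> K1 <= r.*2 - t ->
  4 * Q ^ 2 <= K1.+1 -> Q * ('C(t, j) * 'C(r.*2 - t, r - j)) <= 'C(r.*2, r).
Proof.
move=> tr h1 h2 hQ.
have [r0|r0] := posnP r.
  subst r; have [->|Q0] := posnP Q; first by rewrite mul0n.
  have : 0 < Q ^ 2 by rewrite expn_gt0 Q0.
  move: (Q ^ 2) hQ; rewrite -muln2 in tr h2; lia.
have ha := bin_sq_le t j; have hb := bin_sq_le (r.*2 - t) (r - j).
have hc := bin_central_ge r0.
have hab : ('C(t, j) * 'C(r.*2 - t, r - j)) ^ 2 * (t.+1 * (r.*2 - t).+1) <= 16 ^ r.
  have -> : 16 ^ r = 4 ^ t * 4 ^ (r.*2 - t).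
    by rewrite -expnD (_ : 16 = 4 ^ 2) // -expnM; congr (_ ^ _); lia.
  rewrite expnMn mulnACA; exact: leq_mul.
move: hc hab; move: ('C(t, j) * 'C(r.*2 - t, r - j)) ('C(r.*2, r)) => x c hc hab.
have hx : x ^ 2 * (t.+1 * (r.*2 - t).+1) <= c ^ 2 * (4 * r) := leq_trans hab hc.
rewrite -leq_sqr expnMn.
rewrite -(@leq_pmul2r (4 * r)) ?muln_gt0 //; apply: leq_trans hx.
rewrite mulnAC [leqLHS]mulnC leq_mul2l; apply/orP; right.
have : Q ^ 2 * (4 * r) <= K1.+1 * r by rewrite mulnA [Q ^ 2 * 4]mulnC leq_mul2r hQ orbT.
move=> h; apply: leq_trans h _; nia.
Qed.

(** A fixed set of i elements lies in a random k-subset of m elements, with 2k at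
    most m, with probability at most 2^(-i). *)
Lemma bin_sub_pow m k i : k.*2 <= m -> i <= k -> 'C(m - i, k - i) * 2 ^ i <= 'C(m, k).
Proof.
move=> km; elim: i => [|i IH] ik; first by rewrite !subn0 muln1.
apply: leq_trans (IH (ltnW ik)); rewrite expnS mulnA leq_mul2r; apply/orP; right.
rewrite -(@leq_pmul2l (m - i)); last by lia.
have -> : m - i.+1 = (m - i).-1 by lia.
rewrite mulnA mul_bin_diag.
have -> : (k - i.+1).+1 = k - i by lia.
by rewrite mulnAC leq_mul2r; apply/orP; right; lia.
Qed.

End Binomials.

(** * Random subsets of given size *)

Section Subsets.
Local Open Scope nat_scope.
Variable T : finType.
Implicit Types (W S X Y : {set T}).

Lemma card_draws_meet W S r j :
  #|[set X : {set T} | [&& X \subset W, #|X| == r & #|X :&: S| == j]]|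
  <= 'C(#|W :&: S|, j) * 'C(#|W :\: S|, r - j).
Proof.
rewrite -2!cards_draws -cardsX.
rewrite -(@card_in_imset _ _ (fun X => (X :&: S, X :\: S)) (mem [set X : {set T} | _])).
  apply/subset_leq_card/subsetP => _ /imsetP[X XP ->]; move: XP; rewrite inE => /and3P[sX /eqP cX /eqP cS].
  rewrite !inE /= finset.setSI ?setSD // cS eqxx /=.
  by rewrite -cX -cS -(cardsID S X) addKn.
move=> X Y _ _ [e1 e2]; by rewrite -(finset.setID X S) e1 e2 finset.setID.
Qed.

Lemma card_draws_contain W S r :
  #|[set X : {set T} | [&& X \subset W, #|X| == r & S \subset X]]|
  <= 'C(#|W :\: S|, r - #|S|).
Proof.
rewrite -cards_draws; set D := [set X : {set T} | [&& _, _ & S \subset X]].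
rewrite -(@card_in_imset _ _ (fun X => X :\: S) (mem D)).
  apply/subset_leq_card/subsetP => _ /imsetP[X XP ->]; move: XP; rewrite /D !in_set => /and3P[sX /eqP cX sS].
  by rewrite setSD //= cardsD (finset.setIidPr sS) cX.
move=> X Y; rewrite /D !in_set => /and3P[_ _ sX] /and3P[_ _ sY] e.
by rewrite -(finset.setID X S) -(finset.setID Y S) e (finset.setIidPr sX) (finset.setIidPr sY).
Qed.

Lemma sum_subsets (K : comPzRingType) S (y : K) :
  (\sum_(X : {set T} | X \subset S) y ^+ #|X| = (1 + y) ^+ #|S|)%R.
Proof.
have := @bigA_distr K 0%R 1%R *%R +%R T (fun i : T => if i \in S then y else 0)%R (fun=> 1%R).
rewrite (bigID (mem S)) /= [X in (_ * X)%R]big1 ?mulr1; last first.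
  by move=> i /negbTE ->; rewrite add0r.
rewrite (eq_bigr (fun=> 1 + y)%R); last by move=> i ->; rewrite addrC.
rewrite prodr_const => ->; rewrite big_mkcond; apply: eq_bigr => J _.
rewrite -big_mkcond /=; case: ifPn => [sJ|/subsetPn[x xJ xS]].
  rewrite -prodr_const; apply: eq_bigr => i iJ; by rewrite (subsetP sJ).
by rewrite (bigD1 x) //= (negbTE xS) mul0r.
Qed.

End Subsets.

Section DrawCounts.
Local Open Scope nat_scope.
Variable T : finType.
Implicit Types (W S X Y : {set T}).

(** The probability that a random r-subset of w elements contains one given
    element and avoids another is r (w - r) / (w (w - 1)); here it is at least
    2/9. *)
Lemma bin_pred2_ge w r : 1 < w -> 0 < r -> r <= w ->
  2 * (w * w.-1) <= 9 * (r * (w - r)) -> 2 * 'C(w, r) <= 9 * 'C(w.-2, r.-1).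
Proof.
case: w => [|[|w]] //= _; case: r => // r _ rw hw /=.
have e1 := mul_bin_diag w.+2 r; have e2 := mul_bin_down w.+1 r; rewrite /= in e1 e2.
rewrite -(@leq_pmul2l (w.+2 * w.+1)) //.
have e3 : w.+2 * w.+1 * 'C(w, r) = r.+1 * (w.+1 - r) * 'C(w.+2, r.+1).
  rewrite -mulnA e2 mulnCA e1; ring.
have -> : w.+2 * w.+1 * (9 * 'C(w, r)) = 9 * (r.+1 * (w.+1 - r)) * 'C(w.+2, r.+1).
  by rewrite -[RHS]mulnA -e3; ring.
rewrite subSS in hw.
by rewrite mulnA leq_mul2r [_ * 2]mulnC hw orbT.
Qed.

(** Exchanging a marked x in X with an unmarked y outside X changes the number of
    marked elements, so at most one of X and its exchange has exactly j of them.
    As the sets containing x but not y have proportion at least 2/9, those with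
    the right number have proportion at most 7/9. *)
Lemma exact_draws_swap W S r j x y :
  x \in W :&: S -> y \in W :\: S -> 0 < r ->
  2 * (#|W| * #|W|.-1) <= 9 * (r * (#|W| - r)) ->
  9 * #|[set X : {set T} | [&& X \subset W, #|X| == r & #|X :&: S| == j]]|
    <= 7 * 'C(#|W|, r).
Proof.
move=> xWS yWS r0 hw.
have [xW xS] := finset.setIP xWS; have [yW yS] := finset.setDP yWS.
have nxy : x != y by apply: contraNneq yS => <-.
set B := [set X : {set T} | _].
pose D := [set X : {set T} | [&& X \subset W, #|X| == r, x \in X & y \notin X]].
pose D' := [set X : {set T} | [&& X \subset W, #|X| == r, x \notin X & y \in X]].
pose Al := [set X : {set T} | (X \subset W) && (#|X| == r)].
have inB X : (X \in B) = [&& X \subset W, #|X| == r & #|X :&: S| == j] by rewrite in_set.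
have inD X : (X \in D) = [&& X \subset W, #|X| == r, x \in X & y \notin X] by rewrite in_set.
have inD' X : (X \in D') = [&& X \subset W, #|X| == r, x \notin X & y \in X] by rewrite in_set.
have inAl X : (X \in Al) = (X \subset W) && (#|X| == r) by rewrite in_set.
pose sw (X : {set T}) := y |: (X :\ x).
have yD X : X \in D -> y \notin X :\ x.
  by rewrite inD !inE => /and4P[_ _ _ /negbTE->]; rewrite andbF.
have swD X : X \in D -> sw X \in D'.
  move=> XD; have := yD X XD => yX; move: XD; rewrite inD inD' => /and4P[sX /eqP cX xX ynX].
  rewrite setU11 /= andbT; apply/and3P; split.
  - rewrite finset.subUset sub1set yW /=; exact: fintype.subset_trans (subsetDl _ _) sX.
  - by rewrite cardsU1 yX -cX (cardsD1 x X) xX.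
  - by rewrite !inE negb_or nxy eqxx.
have sw_inj : {in D &, injective sw}.
  move=> X Y XD YD e.
  have back Z : Z \in D -> Z = x |: (sw Z :\ y).
    move=> ZD; rewrite /sw setU1K ?yD // finset.setD1K //.
    by move: ZD; rewrite inD => /and4P[].
  by rewrite (back X XD) (back Y YD) e.
have swB X : X \in D -> X \in B -> sw X \notin B.
  move=> XD; have := yD X XD => yX; move: XD; rewrite inD !inB => /and4P[sX /eqP cX xX ynX].
  case/and3P=> _ _ /eqP cS; apply/negP => /and3P[_ _].
  have -> : (y |: X :\ x) :&: S = (X :&: S) :\ x.
    apply/setP => z; rewrite !inE; case: (eqVneq z y) => [->|_] /=; last by rewrite andbA.
    by rewrite (negbTE yS) !andbF.
  have : #|X :&: S| = (#|(X :&: S) :\ x|).+1 by rewrite (cardsD1 x) inE xX xS.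
  by rewrite cS => ->; rewrite eqn_leq ltnn andbF.
have cB : #|B :&: D| + #|B :&: D'| <= #|D'|.
  rewrite -(cardsID B D') [D' :&: B]finset.setIC addnC leq_add2l.
  rewrite -(@card_in_imset _ _ sw (mem (B :&: D))); last first.
    by move=> X Y /finset.setIP[_ XD] /finset.setIP[_ YD]; exact: sw_inj.
  apply/subset_leq_card/subsetP => _ /imsetP[X /finset.setIP[XB XD] ->].
  by rewrite in_setD swB // swD.
have DD : [disjoint D & D'].
  rewrite -setI_eq0 -subset0; apply/subsetP => X; rewrite in_setI inD inD'.
  by move=> /andP[/and4P[_ _ -> _] /and4P[]].
have sDA : D \subset Al by apply/subsetP => X; rewrite inD inAl => /and4P[-> ->].
have sDA' : D' \subset Al by apply/subsetP => X; rewrite inD' inAl => /and4P[-> ->].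
have sBA : B \subset Al by apply/subsetP => X; rewrite inB inAl => /and3P[-> ->].
have cD : 'C(#|W|.-2, r.-1) <= #|D|.
  have e : #|W :\: [set x; y]| = #|W|.-2.
    rewrite cardsD (finset.setIidPr _) ?cards2 ?nxy ?subn2 //.
    by rewrite finset.subUset !sub1set xW.
  rewrite -e -cards_draws.
  rewrite -(@card_in_imset _ _ (fun Z : {set T} => x |: Z) (mem [set Z : {set T} | (Z \subset W :\: [set x; y]) && (#|Z| == r.-1)])).
    apply/subset_leq_card/subsetP => _ /imsetP[Z ZP ->]; move: ZP.
    rewrite in_set inD => /andP[sZ /eqP cZ].
    have xZ : x \notin Z by apply/negP => /(subsetP sZ); rewrite !inE eqxx.
    have yZ : y \notin Z by apply/negP => /(subsetP sZ); rewrite !inE eqxx orbT.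
    rewrite setU11 in_setU1 negb_or yZ andbT (eq_sym y) nxy andbT cardsU1 xZ cZ.
    rewrite finset.subUset sub1set xW (fintype.subset_trans sZ (subsetDl _ _)) /=.
    by rewrite andbT add1n prednK.
  move=> X Y; rewrite !in_set => /andP[sX _] /andP[sY _] e'.
  have xX : x \notin X by apply/negP => /(subsetP sX); rewrite !inE eqxx.
  have xY : x \notin Y by apply/negP => /(subsetP sY); rewrite !inE eqxx.
  by rewrite -(setU1K xX) e' setU1K.
have cDD' : #|D| <= #|D'|.
  rewrite -(card_in_imset sw_inj); apply/subset_leq_card/subsetP => _ /imsetP[X XD ->].
  exact: swD.
have cA : #|Al| = 'C(#|W|, r) by rewrite -cards_draws.
have main : #|B| + #|D| <= 'C(#|W|, r).
  rewrite -cA -(cardsID (D :|: D') B) -(cardsID (D :|: D') Al).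
  rewrite (finset.setIidPr (_ : D :|: D' \subset Al)); last by rewrite finset.subUset sDA.
  have D0 : D :&: D' = finset.set0 by apply/eqP; rewrite setI_eq0.
  rewrite cardsU D0 cards0 subn0.
  have h1 : #|B :\: (D :|: D')| <= #|Al :\: (D :|: D')| by rewrite subset_leq_card // setSD.
  have h2 : #|B :&: (D :|: D')| <= #|B :&: D| + #|B :&: D'|.
    by rewrite finset.setIUr leq_card_setU.
  by clear -h1 h2 cB cDD'; lia.
have hb : 2 * 'C(#|W|, r) <= 9 * 'C(#|W|.-2, r.-1).
  have w2 : 2 <= #|W|.
    have <- : #|[set x; y]| = 2 by rewrite cards2 nxy.
    by apply: subset_leq_card; rewrite finset.subUset !sub1set xW.
  have rw : r <= #|W|.
    rewrite leqNgt; apply/negP => h; move: hw w2.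
    have e0 : #|W| - r = 0 by apply/eqP; rewrite subn_eq0 ltnW.
    by rewrite e0 !muln0; case: #|W| => [|[|w]].
  exact: bin_pred2_ge.
by clear -main hb cD; lia.
Qed.

(** Negative correlation: 3^N, for N the number of marked elements drawn, is the
    sum of 2^|Y| over the sets Y of marked elements drawn, and Y is drawn with
    probability at most 2^(-|Y|). *)
Lemma sum_draws_3pow W S r : #|W| = r.*2 ->
  \sum_(X : {set T} | (X \subset W) && (#|X| == r)) 3 ^ #|X :&: S|
    <= 2 ^ #|W :&: S| * 'C(r.*2, r).
Proof.
move=> cW.
have e3 X : 3 ^ #|X :&: S| = \sum_(Y : {set T} | Y \subset X :&: S) 2 ^ #|Y|.
  have := sum_subsets (X :&: S) (2%:R : int)%R.
  rewrite (_ : (1 + 2%:R : int)%R = 3%:R%R) //.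
  rewrite -natrX => /esym e; apply/eqP; rewrite -(eqr_nat int) e natr_sum; apply/eqP.
  by apply: eq_bigr => Y _; rewrite natrX.
under eq_bigr do rewrite e3.
rewrite (exchange_big_dep (fun Y : {set T} => Y \subset W :&: S)) /=; last first.
  move=> X Y /andP[sX _] sY; apply: fintype.subset_trans sY _; exact: finset.setSI.
have -> : 2 ^ #|W :&: S| * 'C(r.*2, r) = \sum_(Y : {set T} | Y \subset W :&: S) 'C(r.*2, r).
  rewrite sum_nat_const -card_powerset; congr (_ * _); apply: eq_card => Y.
  by rewrite powersetE.
apply: leq_sum => Y sY; rewrite sum_nat_const.
have [hY|hY] := leqP #|Y| r; last first.
  rewrite (_ : #|_| = 0) ?mul0n //; apply: eq_card0 => X; apply/negbTE.
  rewrite unfold_in; apply/negP => /andP[/andP[_ /eqP cX] /subset_leq_card].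
  by move=> h; have := leq_trans h (subset_leq_card (subsetIl _ _)); lia.
have sYW : Y \subset W := fintype.subset_trans sY (subsetIl _ _).
apply: leq_trans (_ : 'C(r.*2 - #|Y|, r - #|Y|) * 2 ^ #|Y| <= _); last first.
  by apply: bin_sub_pow.
rewrite leq_mul2r; apply/orP; right.
apply: leq_trans (_ : #|[set X : {set T} | [&& X \subset W, #|X| == r & Y \subset X]]| <= _).
  apply: subset_leq_card; apply/subsetP => X; rewrite unfold_in => /andP[/andP[h1 h2] h3].
  by rewrite in_set h1 h2 (fintype.subset_trans h3 (subsetIl _ _)).
apply: leq_trans (card_draws_contain _ _ _) _.
by rewrite cardsD (finset.setIidPr sYW) cW.
Qed.

End DrawCounts.

(** * Statistics of a pair with conditional mean at most 1 *)

Section MeanBounds.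
Variables (K : realType) (T I : finType).
Implicit Types (E : {set {set T}}) (R S : {set T}).

Section After.
Variables (N1 N2 R : {set T}).
Let W := ((N1 :\: N2) :|: (N2 :\: N1)) :&: R.
Variable X : {set T}.
Hypothesis sX : X \subset W.
Let M1 := (N1 :\: W) :|: X.
Let M2 := (N2 :\: W) :|: (W :\: X).

Lemma after_diff1 : (M1 :\: M2) :&: R = X.
Proof.
apply/setP => v; have := subsetP sX v; rewrite /M1 /M2 /W !inE.
by case: (v \in X); case: (v \in R); case: (v \in N1); case: (v \in N2) => //= /(_ isT).
Qed.

Lemma after_symdiff : ((M1 :\: M2) :|: (M2 :\: M1)) :&: R = W.
Proof.
apply/setP => v; have := subsetP sX v; rewrite /M1 /M2 /W !inE.
by case: (v \in X); case: (v \in R); case: (v \in N1); case: (v \in N2) => //= /(_ isT).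
Qed.

Lemma after_meet1 S : #|M1 :&: S| = (#|(N1 :\: W) :&: S| + #|X :&: S|)%N.
Proof.
have e0 : ((N1 :\: W) :&: S) :&: (X :&: S) = finset.set0.
  apply/setP => v; have := subsetP sX v; rewrite /W !inE.
  by case: (v \in X); case: (v \in R); case: (v \in N1); case: (v \in N2);
    case: (v \in S) => //= /(_ isT).
by rewrite finset.setIUl cardsU e0 cards0 subn0.
Qed.

End After.

(** The weight q is a bet that u1 has exactly c neighbours in S; it is placed only
    if the switchable set and the number r of its vertices attached to u1 are
    good, two data that the resampling preserves. *)
Definition exact_weight (good : {set T} -> nat -> bool) (q : K) R S (c : nat)
    (N1 N2 : {set T}) : K :=
  if good (((N1 :\: N2) :|: (N2 :\: N1)) :&: R) #|(N1 :\: N2) :&: R|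
  then q * (#|N1 :&: S| == c)%:R else 1.

Lemma mean_exact (good : {set T} -> nat -> bool) (q : K) R S c E u1 u2 :
  (forall W r j, good W r ->
     q * #|[set X : {set T} | [&& X \subset W, #|X| == r & #|X :&: S| == j]]|%:R
       <= 'C(#|W|, r)%:R) ->
  mean_le1 (exact_weight good q R S c) E u1 u2 R.
Proof.
move=> hq; rewrite /mean_le1; set W := switchable _ _ _ _; set r := switch_count _ _ _ _.
set N1 := nbr E u1; set N2 := nbr E u2.
have draws : 'C(#|W|, r)%:R = \sum_(X : {set T} | (X \subset W) && (#|X| == r)) (1 : K).
  rewrite -cards_draws -sum1_card natr_sum; apply: eq_bigl => X; by rewrite inE.
rewrite (eq_bigr (fun X => if good W r then q * (#|(N1 :\: W) :&: S| + #|X :&: S| == c)%N%:R else 1)).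
  case: (boolP (good W r)) => gW; last by rewrite draws.
  have [hc|hc] := leqP #|(N1 :\: W) :&: S| c; last first.
    rewrite big1 ?ler0n // => X _; rewrite (_ : (_ == c) = false) ?mulr0 //; apply/eqP; lia.
  apply: le_trans (hq W r (c - #|(N1 :\: W) :&: S|)%N gW).
  rewrite -mulr_sumr; set D := [set X : {set T} | _]; rewrite -(sum1_card (mem D)) natr_sum.
  rewrite [X in _ <= _ * X](eq_bigl (fun X : {set T} => ((X \subset W) && (#|X| == r)) && (#|X :&: S| == c - #|(N1 :\: W) :&: S|)%N)).
    rewrite le_eqVlt; apply/orP; left; apply/eqP; congr (_ * _).
    rewrite [RHS]big_mkcondr /=; apply: eq_bigr => X _.
    have -> : (#|X :&: S| == c - #|(N1 :\: W) :&: S|)%N = (#|(N1 :\: W) :&: S| + #|X :&: S| == c)%N.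
      by apply/eqP/eqP; lia.
    by case: (_ == c).
  by move=> X; rewrite in_set andbA.
move=> X /andP[sX /eqP cX]; rewrite /exact_weight after_symdiff // after_diff1 // cX.
by rewrite after_meet1.
Qed.

(** With N the number of neighbours of u1, but not of u2, in R and S, and t the
    number of switchable vertices in S, this is 3^N / 2^t, which detects an
    excess of u1 over u2. *)
Definition tail_weight R S (N1 N2 : {set T}) : K :=
  3 ^+ #|(N1 :\: N2) :&: (R :&: S)| / 2 ^+ #|((N1 :\: N2) :|: (N2 :\: N1)) :&: (R :&: S)|.

Lemma mean_tail R S E u1 u2 :
  #|(nbr E u1 :\: nbr E u2) :&: R| = #|(nbr E u2 :\: nbr E u1) :&: R| ->
  mean_le1 (tail_weight R S) E u1 u2 R.
Proof.
move=> hr; rewrite /mean_le1; set W := switchable _ _ _ _; set r := switch_count _ _ _ _.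
have cW : #|W| = r.*2.
  have e0 : ((nbr E u1 :\: nbr E u2) :&: R) :&: ((nbr E u2 :\: nbr E u1) :&: R) = finset.set0.
    apply/setP => v; rewrite !inE.
    by case: (adj E u1 v); case: (adj E u2 v); rewrite ?andbF.
  by rewrite /W /switchable finset.setIUl cardsU e0 cards0 subn0 -hr addnn.
rewrite (eq_bigr (fun X => (3 ^ #|X :&: S|)%N%:R / 2 ^+ #|W :&: S|)); last first.
  move=> X /andP[sX /eqP cX]; rewrite /tail_weight !finset.setIA after_diff1 //.
  by rewrite after_symdiff // natrX.
rewrite -mulr_suml -natr_sum ler_pdivrMr ?exprn_gt0 ?ltr0n //.
rewrite -natrX -natrM ler_nat mulnC cW; exact: sum_draws_3pow.
Qed.

End MeanBounds.

(** * Families of disjoint pairs *)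

Lemma sum_option (V : nmodType) (T : finType) (F : option T -> V) :
  \sum_o F o = F None + \sum_w F (Some w).
Proof.
rewrite (bigD1 None) //=; congr (_ + _).
rewrite (reindex_omap Some id); last by case.
by apply: eq_bigl => w; rewrite eqxx.
Qed.

Section Pairs.
Variable T : eqType.

Definition entries (ps : seq (T * T)) := unzip1 ps ++ unzip2 ps.

Lemma entries1 (ps : seq (T * T)) p : p \in ps -> p.1 \in entries ps.
Proof. by move=> h; rewrite mem_cat; apply/orP; left; apply/mapP; exists p. Qed.

Lemma entries2 (ps : seq (T * T)) p : p \in ps -> p.2 \in entries ps.
Proof. by move=> h; rewrite mem_cat; apply/orP; right; apply/mapP; exists p. Qed.

Lemma uniq_entries_pairs (ps : seq (T * T)) : uniq (entries ps) -> uniq ps.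
Proof. by rewrite cat_uniq => /and3P[/map_uniq]. Qed.

Lemma uniq_map_inj (T1 T2 : eqType) (f : T1 -> T2) s : uniq (map f s) -> {in s &, injective f}.
Proof.
elim: s => [|x s IH] //= /andP[xs us] p q.
rewrite !inE => /predU1P[->|ps] /predU1P[->|qs] // e.
- by rewrite e map_f in xs.
- by rewrite -e map_f in xs.
- exact: IH.
Qed.

Lemma entries_inj (ps : seq (T * T)) p q : uniq (entries ps) -> p \in ps -> q \in ps ->
  p != q -> [/\ p.1 != q.1, p.1 != q.2, p.2 != q.1 & p.2 != q.2].
Proof.
rewrite cat_uniq => /and3P[u1 /hasPn h u2] pp qp npq.
have m1 r : r \in ps -> r.1 \in unzip1 ps by move=> ?; apply/mapP; exists r.
have m2 r : r \in ps -> r.2 \in unzip2 ps by move=> ?; apply/mapP; exists r.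
split; apply: contraNneq npq => e.
- by apply/eqP/(uniq_map_inj u1).
- by have := h _ (m2 q qp); rewrite -e /= m1.
- by have := h _ (m2 p pp); rewrite e /= m1.
- by apply/eqP/(uniq_map_inj u2).
Qed.

Lemma size_entries (ps : seq (T * T)) : size (entries ps) = (2 * size ps)%N.
Proof. by rewrite size_cat !size_map mul2n addnn. Qed.

End Pairs.

(** Turns a lower bound on the number of indices satisfying P into a lower bound
    on a product, for use with Markov's inequality. *)
Lemma prod_ge_count (K : realType) (J : eqType) (js : seq J) (f : J -> K) (P : pred J) (z : K) :
  1 <= z -> (forall j, j \in js -> 1 <= f j) -> (forall j, j \in js -> P j -> z <= f j) ->
  z ^+ count P js <= \prod_(j <- js) f j.
Proof.
move=> z1; elim: js => [|j js IH] h1 h2; first by rewrite big_nil.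
rewrite big_cons /= exprD; have z0 : 0 <= z by apply: le_trans z1.
apply: ler_pM; rewrite ?exprn_ge0 //.
  case: (boolP (P j)) => Pj; first by rewrite expr1 h2 ?mem_head.
  by rewrite expr0 h1 ?mem_head.
by apply: IH => i ij; [apply: h1|apply: h2]; rewrite inE ij orbT.
Qed.

Section PairEvents.
Variables (K : realType) (T I : finType) (cl : T -> I) (A : I -> I -> nat) (n d : nat).
Local Notation cluster_of := (cluster_of cl).
Local Notation Ex := (@Ex K T I cl A).
Local Notation Pr := (@Pr K T I cl A).
Implicit Types (E F : {set {set T}}) (S X R : {set T}).
Hypotheses (hcard : forall c, #|cluster_of c| = n)
  (hsym : forall i j, A i j = A j i) (hrow : forall i, (\sum_c A i c)%N = d).
Hypothesis (hn : (8 * d.+1 <= n)%N).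
Local Notation b := (edge_ratio K n d).

Definition common_nbr R E (p : T * T) : bool := [exists w in R, adj E p.1 w && adj E p.2 w].

(** A pair has a common neighbour w in R with probability of order d^2/n, and the
    corresponding sets of two edges lie in disjoint blocks for disjoint pairs.
    The moment of e^(lN), for N the number of pairs with a common neighbour, is
    bounded by replacing the factor e^l of such a pair by the polynomial
    1 + sum over w of e^l times the indicator of the two edges at w; then
    [edge_polynomial] gives exp (4 d^2 e^l). *)
Lemma common_nbr_tail (ps : seq (T * T)) R m (l : K) (g : nat) :
  uniq (entries ps) -> (8 * (2 * size ps) <= n)%N ->
  R \subset cluster_of m -> (forall u, u \in entries ps -> u \notin R) -> 0 <= l ->
  Pr (fun E => (g <= count (common_nbr R E) ps)%N)
    <= expR (4 * d%:R ^+ 2 * expR l - l * g%:R).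
Proof.
move=> un sps sR eR l0.
pose z := expR l; have z1 : 1 <= z by rewrite -expR0 ler_expR.
have z0 : 0 <= z := le_trans ler01 z1.
pose c (p : T * T) (o : option T) : K :=
  if o is Some w then (if w \in R then z else 0) else 1.
pose Phi (p : T * T) (o : option T) : {set {set T}} :=
  if o is Some w then [set [set p.1; w]; [set p.2; w]] else finset.set0.
pose B (p : T * T) : {set {set T}} :=
  [set e | [exists w in R, (e == [set p.1; w]) || (e == [set p.2; w])]].
pose S0 : {set T} := [set u in entries ps].
have cS0 : (8 * #|S0| <= n)%N.
  apply: leq_trans sps; rewrite leq_mul2l /= -size_entries cardsE; exact: card_size.
have n0 : (0 < n)%N by lia.
have := @edge_polynomial K T I cl A n d hcard hsym hrow S0 cS0 hn _ (option T)
  ps c Phi B (uniq_entries_pairs un).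
have set2_mem (x y u w : T) : [set x; y] = [set u; w] -> (x == u) || (x == w).
  by move=> e; have := set21 x y; rewrite e !inE.
move=> /(_ _ _ _ _) h.
have {h} hE : Ex (fun E => \prod_(p <- ps) \sum_o c p o * (Phi p o \subset E)%:R)
    <= \prod_(p <- ps) \sum_o c p o * b ^+ #|Phi p o|.
  apply: h.
  - by move=> p [w|] //=; case: ifP.
  - move=> p [w|] pp /=; last by rewrite finset.sub0set.
    case: ifP => wR; last by rewrite eqxx.
    move=> _; apply/subsetP => e; rewrite !inE => h; apply/existsP; exists w.
    by rewrite wR.
  - move=> p q pp qp npq; rewrite -setI_eq0 -subset0; apply/subsetP => e.
    rewrite !inE => /andP[/existsP[w /andP[wR h1]] /existsP[w' /andP[wR' h2]]].
    have [h11 h12 h21 h22] := entries_inj un pp qp npq.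
    have o1 := eR _ (entries1 pp); have o2 := eR _ (entries2 pp).
    have nw x : x \notin R -> x != w' by move=> xR; apply: contraNneq xR => ->.
    move: h1 h2 => /orP[]/eqP-> /orP[]/eqP/set2_mem/orP[]; 
      rewrite ?(negbTE h11) ?(negbTE h12) ?(negbTE h21) ?(negbTE h22) //.
    + by rewrite (negbTE (nw _ o1)).
    + by rewrite (negbTE (nw _ o1)).
    + by rewrite (negbTE (nw _ o2)).
    + by rewrite (negbTE (nw _ o2)).
  - move=> p f pp; rewrite inE => /existsP[w /andP[wR h]]; apply/set0Pn.
    case/orP: h => /eqP ->; [exists p.1|exists p.2]; rewrite !inE eqxx /=.
      exact: entries1.
    exact: entries2.
have hb : \prod_(p <- ps) \sum_o c p o * b ^+ #|Phi p o| <= expR (4 * d%:R ^+ 2 * z).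
  apply: le_trans (_ : \prod_(p <- ps) expR (z * (4 * d%:R ^+ 2 / n%:R)) <= _).
    rewrite !big_seq; apply: ler_prod => p pp; apply/andP; split.
      apply: sumr_ge0 => o _; rewrite mulr_ge0 ?exprn_ge0 ?edge_ratio_ge0 //.
      by case: o => [w|] //=; case: ifP.
    apply: le_trans (expR_ge1Dx _).
    rewrite sum_option /= cards0 expr0 mulr1 lerD2l.
    rewrite (eq_bigr (fun w => if w \in R then z * b ^+ 2 else 0)); last first.
      move=> w _; case: ifP => wR; last by rewrite mul0r.
      rewrite cards2 (_ : [set p.1; w] != [set p.2; w]) //.
      apply/eqP => /set2_mem/orP[]; last first.
        by move=> /eqP e; have := eR _ (entries1 pp); rewrite e wR.
      move: un; rewrite cat_uniq => /and3P[_ /hasPn hh _] /eqP e.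
      have /hh : p.2 \in unzip2 ps by apply/mapP; exists p.
      by rewrite -e => /negP; apply; apply/mapP; exists p.
    rewrite -big_mkcond /= sumr_const.
    apply: le_trans (_ : z * b ^+ 2 *+ n <= _).
      rewrite -[leLHS]mulr_natr -[leRHS]mulr_natr ler_wpM2l //.
        by rewrite mulr_ge0 ?exprn_ge0 ?edge_ratio_ge0.
      by rewrite ler_nat -(hcard m) subset_leq_card.
    rewrite -mulr_natr -mulrA ler_wpM2l // le_eqVlt; apply/orP; left; apply/eqP.
    have n0' : n%:R != 0 :> K by rewrite pnatr_eq0 -lt0n.
    by rewrite /b natrM; field.
  rewrite -expR_sum big_const_seq count_predT iter_addr_0 -[_ *+ size ps]mulr_natl.
  rewrite ler_expR.
  have n0' : 0 < n%:R :> K by rewrite ltr0n.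
  rewrite mulrCA [leRHS]mulrC; apply: ler_wpM2l => //.
  rewrite mulrA ler_pdivrMr // mulrC; apply: ler_wpM2l; first by rewrite mulr_ge0 ?exprn_ge0.
  by rewrite ler_nat; lia.
have hP := markov_le (P := fun E => (g <= count (common_nbr R E) ps)%N) (t := z ^+ g) _ _ _ (le_trans hE hb).
apply: le_trans (hP _ _ _) _.
- by rewrite exprn_gt0 // expR_gt0.
- move=> E EO; apply: prodr_ge0 => p _; apply: sumr_ge0 => o _.
  by rewrite mulr_ge0 //; case: o => [w|] //=; case: ifP.
- move=> E EO hg; apply: le_trans (_ : z ^+ count (common_nbr R E) ps <= _).
    by rewrite ler_weXn2l.
  apply: prod_ge_count => // p pp; rewrite sum_option /= finset.sub0set mulr1.
    by rewrite lerDl sumr_ge0 // => w _; rewrite mulr_ge0 //; case: ifP.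
  move=> /existsP[w /and3P[wR a1 a2]].
  rewrite (bigD1 w) //= wR finset.subUset !sub1set.
  move/andP: a1 => [_ ->]; move/andP: a2 => [_ ->]; rewrite mulr1.
  rewrite addrCA lerDl addr_ge0 // sumr_ge0 // => w' _.
  by rewrite mulr_ge0 //; case: ifP.
by rewrite expRD expRN expRM_natr.
Qed.

End PairEvents.

(** * Vertices with few neighbours in a large set *)

Lemma sum_blocks (T : Type) (f : T -> nat) (s : seq T) (h nb : nat) : (size s <= nb * h)%N ->
  (\sum_(v <- s) f v = \sum_(j < nb) \sum_(v <- take h (drop (j * h) s)) f v)%N.
Proof.
elim: nb s => [|nb IH] s hs.
  by rewrite big_ord0; case: s hs => // _; rewrite big_nil.
rewrite big_ord_recl mul0n drop0 -{1}(cat_take_drop h s) big_cat /=; congr addn.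
rewrite IH; last by rewrite size_drop; lia.
by apply: eq_bigr => j _; rewrite drop_drop /bump /= add1n mulSn addnC.
Qed.

Lemma pigeonhole_sum (nb c : nat) (x : 'I_nb -> nat) : (0 < nb)%N ->
  (nb * c <= \sum_j x j)%N -> exists j, (c <= x j)%N.
Proof.
move=> nb0 h; apply/existsP; apply: contraT => /existsPn hx.
have : (\sum_(j < nb) (x j).+1 <= \sum_(j < nb) c)%N.
  by apply: leq_sum => j _; rewrite ltnNge.
rewrite sum_nat_const card_ord; under eq_bigr do rewrite -add1n.
rewrite big_split /= sum_nat_const card_ord muln1 => h'.
by have := leq_trans h' h; rewrite -[leqRHS]add0n leq_add2r leqNgt nb0.
Qed.

Section FewNeighbours.
Variables (K : realType) (T I : finType) (cl : T -> I) (A : I -> I -> nat) (n : nat).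
Local Notation cluster_of := (cluster_of cl).
Local Notation Ex := (@Ex K T I cl A).
Local Notation Pr := (@Pr K T I cl A).
Implicit Types (E F : {set {set T}}) (S X R : {set T}).
Hypothesis (hcard : forall c, #|cluster_of c| = n).

(** Let x and y be the numbers of vertices of S in N1 only, resp. in N2 only. Then
    3^x / 2^(x+y) = (3/2)^x / 2^y, where x is at least the difference of the sizes
    of N1 and N2 inside S, y is at most the size of N2 inside S, and 2 is at most
    (3/2)^2. *)
Lemma tail_weight_ge R S N1 N2 : S \subset R ->
  (3 / 2) ^+ #|N1 :&: S| <= tail_weight K R S N1 N2 * (3 / 2) ^+ (3 * #|N2 :&: S|).
Proof.
move=> sSR; rewrite /tail_weight (finset.setIidPr sSR).
set x := #|(N1 :\: N2) :&: S|; set y := #|(N2 :\: N1) :&: S|.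
have -> : #|((N1 :\: N2) :|: (N2 :\: N1)) :&: S| = (x + y)%N.
  have e0 : ((N1 :\: N2) :&: S) :&: ((N2 :\: N1) :&: S) = finset.set0.
    apply/setP => v; rewrite !inE.
    by case: (v \in N1); case: (v \in N2); rewrite ?andbF.
  by rewrite finset.setIUl cardsU e0 cards0 subn0.
have hx : (#|N1 :&: S| <= x + #|N2 :&: S|)%N.
  rewrite -leq_subLR -(cardsID N2 (N1 :&: S)) leq_subLR addnC.
  apply: leq_add; rewrite subset_leq_card //; apply/subsetP => v; rewrite !inE.
    by case: (v \in N1); case: (v \in N2); case: (v \in S).
  by case: (v \in N1); case: (v \in N2); case: (v \in S).
have hy : (y <= #|N2 :&: S|)%N.
  by rewrite subset_leq_card //; apply/subsetP => v; rewrite !inE => /andP[/andP[_ ->] ->].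
have g1 : 1 <= 3 / 2 :> K by lra.
apply: le_trans (_ : (3 / 2) ^+ (x + #|N2 :&: S|) <= _); first by rewrite ler_weXn2l.
rewrite exprD [2 ^+ _]exprD invfM mulrA -expr_div_n -!mulrA.
apply: ler_wpM2l; first by apply: exprn_ge0; lra.
rewrite ler_pdivlMl ?exprn_gt0 //.
apply: le_trans (_ : (3 / 2) ^+ (2 * y + #|N2 :&: S|) <= _); last by rewrite ler_weXn2l //; lia.
rewrite exprD; apply: ler_wpM2r; first by apply: exprn_ge0; lra.
have g0 : 0 <= 3 / 2 :> K by lra.
by rewrite exprM; apply: lerXn2r; rewrite ?nnegrE ?exprn_ge0 //; rewrite expr2; lra.
Qed.

(** Suppose that every vertex of T0 has at most K1 neighbours in S. Then S receives
    at most K1 |T0| edges from T0, so the rest of the cluster m receives all but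
    K1 |T0| of the A i m |T0| edges. Cut that rest into nb blocks of at most |S| vertices:
    one of them receives at least G + 3 K1 |T0| edges. Pairing its vertices with
    vertices of S, the product of the tail weights is at least (3/2)^G, whereas
    its mean is at most 1. *)
Lemma few_neighbours i m S (T0 : {set T}) (K1 nb G : nat) : i != m -> (0 < n)%N ->
  S \subset cluster_of m -> (0 < #|S|)%N -> (n <= nb * #|S|)%N -> T0 \subset cluster_of i ->
  (nb * (G + 3 * (K1 * #|T0|)) + K1 * #|T0| <= A i m * #|T0|)%N ->
  Pr (fun E => [forall u in T0, #|nbr E u :&: S| <= K1]%N) <= nb%:R * (2 / 3) ^+ G.
Proof.
move=> nim n0 sS S0 hnb sT hG.
pose B := cluster_of m :\: S; pose h := #|S|.
pose vs (j : 'I_nb) := take h (drop (j * h) (enum B)).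
pose ps j := zip (vs j) (take (size (vs j)) (enum S)).
have svs j : (size (vs j) <= size (enum S))%N by rewrite -cardE size_take_min geq_minl.
have sz j : size (take (size (vs j)) (enum S)) = size (vs j) by rewrite size_takel.
have u1 j : unzip1 (ps j) = vs j by rewrite unzip1_zip // sz.
have u2 j : unzip2 (ps j) = take (size (vs j)) (enum S) by rewrite unzip2_zip // sz.
have vsB j v : v \in vs j -> v \in B by move=> /mem_take/mem_drop; rewrite mem_enum.
have tS j v : v \in take (size (vs j)) (enum S) -> v \in S.
  by move=> /mem_take; rewrite mem_enum.
have nb0 : (0 < nb)%N by case: nb hnb {hG vs ps svs sz u1 u2 vsB tS} => //; rewrite mul0n; lia.
pose f E j := \prod_(p <- ps j) tail_weight K (cluster_of i) T0 (nbr E p.1) (nbr E p.2).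
have clus v c : v \in cluster_of c -> cl v = c by rewrite inE => /eqP.
have Bm v : v \in B -> v \in cluster_of m by rewrite inE => /andP[].
have Ef j : Ex (f^~ j) <= 1.
  apply: Ex_le => //; rewrite mul1r.
  apply: (@resample_product K T I cl A (ps j) (cluster_of i) m i
    (fun p => tail_weight K (cluster_of i) T0)).
  - rewrite u1 u2 cat_uniq take_uniq ?drop_uniq ?enum_uniq //= take_uniq ?enum_uniq // andbT.
    apply/hasPn => v /tS vS; apply/negP => /vsB; by rewrite inE vS.
  - move=> u; rewrite u1 u2 mem_cat => hu.
    have um : u \in cluster_of m.
      case/orP: hu => [/vsB/Bm//|/tS uS]; exact: (subsetP sS).
    split; first exact: clus.
    by rewrite inE (clus _ _ um) eq_sym.
  - by [].
  - by move=> _ N1 N2; rewrite divr_ge0 ?exprn_ge0.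
  - move=> [v s] E pp EO; apply: mean_tail => /=.
    have vm : cl v = m.
      by apply/clus/Bm/(vsB j); rewrite -u1; apply/mapP; exists (v, s).
    have sm : cl s = m.
      by apply/clus/(subsetP sS)/(tS j); rewrite -u2; apply/mapP; exists (v, s).
    rewrite !setIDAC !cardsD.
    have e1 : #|nbr E v :&: cluster_of i| = #|nbr E s :&: cluster_of i|.
      by case/OmegaP: EO => _ hE; rewrite !hE vm sm.
    rewrite e1; congr (_ - _)%N; apply: eq_card => w; rewrite !inE.
    by case: (adj E v w); case: (adj E s w); case: (cl w == i).
have main j : Pr (fun E => (G + 3 * (K1 * #|T0|) <= \sum_(v <- vs j) #|nbr E v :&: T0|)%N &&
    [forall u in T0, #|nbr E u :&: S| <= K1]%N) <= (2 / 3) ^+ G.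
  have -> : (2 / 3) ^+ G = 1 / (3 / 2) ^+ G :> K.
    by rewrite div1r -exprVn invf_div.
  apply: (markov_le _ _ _ (Ef j)).
  - by rewrite exprn_gt0 //; lra.
  - by move=> E EO; apply: prodr_ge0 => p _; rewrite divr_ge0 ?exprn_ge0.
  move=> E EO /andP[h1 /forallP h2].
  have e1 : (\sum_(p <- ps j) #|nbr E p.1 :&: T0| = \sum_(v <- vs j) #|nbr E v :&: T0|)%N.
    by rewrite -u1 big_map.
  have e2 : (\sum_(p <- ps j) #|nbr E p.2 :&: T0| <= K1 * #|T0|)%N.
    have -> : (\sum_(p <- ps j) #|nbr E p.2 :&: T0| =
      \sum_(v <- take (size (vs j)) (enum S)) #|nbr E v :&: T0|)%N by rewrite -u2 big_map.
    apply: leq_trans (_ : \sum_(v <- enum S) #|nbr E v :&: T0| <= _)%N.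
      by rewrite -{2}(cat_take_drop (size (vs j)) (enum S)) big_cat leq_addr.
    rewrite big_enum /=; under eq_bigr do rewrite adj_sum.
    rewrite exchange_big /= mulnC -sum_nat_const; apply: leq_sum => u uT.
    have := h2 u; rewrite uT /= adj_sum.
    by under eq_bigr do rewrite adjC.
  have g1 : 1 <= 3 / 2 :> K by lra.
  have prodge : (3 / 2) ^+ (\sum_(p <- ps j) #|nbr E p.1 :&: T0|) <=
     f E j * (3 / 2) ^+ (3 * \sum_(p <- ps j) #|nbr E p.2 :&: T0|) :> K.
    rewrite big_distrr /= -!prodrXr /f -big_split /= ; apply: ler_prod => p _.
    by rewrite exprn_ge0 ?tail_weight_ge //; lra.
  rewrite e1 in prodge.
  have g0 : 0 < (3 / 2) ^+ (3 * (K1 * #|T0|)) :> K by rewrite exprn_gt0 //; lra.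
  rewrite -(ler_pM2r g0) -exprD.
  apply: le_trans (_ : (3 / 2) ^+ (\sum_(v <- vs j) #|nbr E v :&: T0|) <= _).
    by rewrite ler_weXn2l.
  apply: le_trans prodge _; apply: ler_wpM2l.
    by apply: prodr_ge0 => p _; rewrite divr_ge0 ?exprn_ge0.
  by rewrite ler_weXn2l // leq_mul2l e2 orbT.
apply: le_trans (_ : \sum_(j < nb) (2 / 3) ^+ G <= _); last first.
  by rewrite sumr_const card_ord -[leLHS]mulr_natl.
apply: le_trans (ler_sum _ (fun j _ => main j)).
apply: Pr_union => E EO hE.
have [|j hj] := @pigeonhole_sum nb (G + 3 * (K1 * #|T0|))
    (fun j => \sum_(v <- vs j) #|nbr E v :&: T0|)%N nb0; last by exists j; rewrite ?hj.
rewrite -sum_blocks; last first.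
  by rewrite -cardE; apply: leq_trans hnb; rewrite -(hcard m) subset_leq_card // subsetDl.
rewrite big_enum /=; under eq_bigr do rewrite adj_sum; rewrite exchange_big /=.
rewrite -(leq_add2r (K1 * #|T0|)); apply: leq_trans hG _.
have -> : (A i m * #|T0| = \sum_(u in T0) A i m)%N by rewrite sum_nat_const mulnC.
have -> : (K1 * #|T0| = \sum_(u in T0) K1)%N by rewrite sum_nat_const mulnC.
rewrite -big_split /=; apply: leq_sum => u uT.
under eq_bigr do rewrite adjC; rewrite -adj_sum.
have ui := clus _ _ (subsetP sT u uT).
have /OmegaP[_ hE'] := EO; have := hE' u m; rewrite ui => <-.
rewrite -(cardsID S (nbr E u :&: cluster_of m)) addnC; apply: leq_add.
  by rewrite -setIDA.
move: hE => /forallP/(_ u); rewrite uT /=; apply: leq_trans.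
by rewrite subset_leq_card // finset.setSI // subsetIl.
Qed.

End FewNeighbours.

Lemma exists_pairing (T : finType) (X : {set T}) (q : nat) : (2 * q <= #|X|)%N ->
  exists ps : seq (T * T), [/\ size ps = q, uniq (entries ps) &
    entries ps = take (2 * q) (enum X)].
Proof.
move=> hq; pose s := enum X.
have ss : size s = #|X| by rewrite -cardE.
have s1 : size (take q s) = q by rewrite size_takel // ss; lia.
have s2 : size (take q (drop q s)) = q by rewrite size_takel // size_drop ss; lia.
have e : entries (zip (take q s) (take q (drop q s))) = take (2 * q) s.
  by rewrite /entries unzip1_zip ?unzip2_zip ?s1 ?s2 // -takeD mul2n addnn.
exists (zip (take q s) (take q (drop q s))); split=> //.
  by rewrite size_zip s1 s2 minnn.
by rewrite e take_uniq // enum_uniq.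
Qed.

Lemma count_entries (T : finType) (ps : seq (T * T)) (P : pred T) : uniq (entries ps) ->
  (count (fun p => P p.1 || P p.2) ps <= #|[set u in entries ps | P u]|)%N.
Proof.
move=> un; have -> : #|[set u in entries ps | P u]| = count P (entries ps).
  rewrite -size_filter -(card_uniqP (filter_uniq P un)); apply: eq_card => u.
  by rewrite inE mem_filter andbC.
rewrite /entries count_cat !count_map; elim: ps {un} => //= p ps IH.
by case: (P p.1); case: (P p.2) => /=; lia.
Qed.

(** * Edge densities between small sets *)

Section FixedPartition.
Variables (K : realType) (T I : finType) (cl : T -> I) (A : I -> I -> nat) (n d : nat).
Local Notation cluster_of := (cluster_of cl).
Local Notation Ex := (@Ex K T I cl A).
Local Notation Pr := (@Pr K T I cl A).
Implicit Types (E F : {set {set T}}) (S X Y R : {set T}).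
Hypotheses (hcard : forall c, #|cluster_of c| = n)
  (hsym : forall i j, A i j = A j i) (hrow : forall i, (\sum_c A i c)%N = d).
Hypothesis (hn : (8 * d.+1 <= n)%N).
Local Notation b := (edge_ratio K n d).

(** The factor 1/2 is due to edges inside the intersection of X and Y, which the
    degree sum counts twice. *)
Lemma dense_pair X Y (l : K) (t : nat) : (8 * #|X| <= n)%N -> 0 <= l ->
  Pr (fun E => t <= \sum_(x in X) #|nbr E x :&: Y|)%N
    <= expR (b * expR l * (#|X| * #|Y|)%:R - l * (t%:R / 2)).
Proof.
move=> sX l0.
pose B : {set {set T}} := [set [set p.1; p.2] | p in finset.setX X Y].
have cB : (#|B| <= #|X| * #|Y|)%N by rewrite -cardsX leq_imset_card.
have hB f : f \in B -> f :&: X != finset.set0.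
  move=> /imsetP[[x y] /finset.setXP[/= xX yY] ->]; apply/set0Pn; exists x.
  by rewrite !inE eqxx xX.
have half E : (\sum_(x in X) #|nbr E x :&: Y| <= 2 * #|E :&: B|)%N.
  rewrite -card_dep; set D := [set p | _].
  rewrite mulnC -sum_nat_const.
  rewrite -sum1_card (partition_big (fun p : T * T => [set p.1; p.2]) (mem (E :&: B))) /=.
    apply: leq_sum => e /finset.setIP[eE /imsetP[[x y] /finset.setXP[/= xX yY] exy]].
    rewrite sum1_card; apply: leq_trans (_ : #|[set (x, y); (y, x)]| <= _)%N; last first.
      by rewrite cards2; case: (_ != _).
    apply: subset_leq_card; apply/subsetP => -[u v]; rewrite unfold_in /=.
    rewrite in_set /= !inE => /andP[/andP[uX /andP[auv vY]] /eqP].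
    have nuv : u != v by case/andP: auv.
    by rewrite exy => /(set2_eq nuv)[[-> ->]|[-> ->]]; rewrite eqxx ?orbT.
  move=> [u v]; rewrite !in_set /= => /andP[uX /andP[auv vY]].
  move/andP: auv => [_ ->] /=; apply/imsetP; exists (u, v) => //.
  by rewrite finset.in_setX uX.
rewrite expRD expRN; apply: (markov_le (f := fun E => expR (l * #|E :&: B|%:R))).
- exact: expR_gt0.
- by move=> E _; rewrite expR_ge0.
- move=> E _ ht; rewrite ler_expR ler_wpM2l // ler_pdivrMr // -natrM ler_nat mulnC.
  exact: leq_trans ht (half E).
apply: le_trans (edge_mgf (K := K) hcard hsym hrow sX hn l0 hB) _.
rewrite ler_expR ler_wpM2l ?ler_nat // mulr_ge0 ?expR_ge0 //.
by rewrite divr_ge0.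
Qed.

(** Union bound over the subset of X formed by the exceptional vertices. *)
Lemma many_dense X Y (l : K) (g a : nat) : (8 * #|X| <= n)%N -> 0 <= l ->
  b * expR l * #|Y|%:R <= l * (a%:R / 4) ->
  Pr (fun E => g <= #|[set u in X | a < 2 * #|nbr E u :&: Y|]|)%N
    <= 2 ^+ #|X| * expR (- (g%:R * (l * (a%:R / 4) - b * expR l * #|Y|%:R))).
Proof.
move=> sX l0 hY.
rewrite -natrX -card_powerset mulr_natl -sumr_const.
pose Q (X' : {set T}) E := (g <= #|X'|)%N && [forall u in X', a < 2 * #|nbr E u :&: Y|]%N.
apply: le_trans (_ : \sum_(X' in powerset X) Pr (Q X') <= _).
  apply: Pr_union => E EO hg; exists [set u in X | (a < 2 * #|nbr E u :&: Y|)%N].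
    by rewrite finset.powersetE; apply/subsetP => u; rewrite inE => /andP[].
  by rewrite /Q hg; apply/forallP => u; apply/implyP; rewrite inE => /andP[].
apply: ler_sum => X'; rewrite finset.powersetE => sX'.
have [hg|hg] := leqP g #|X'|; last first.
  rewrite [leLHS](_ : _ = 0) ?expR_ge0 //; rewrite /Pr /Ex big1 ?mul0r // => E _.
  by rewrite /Q leqNgt hg.
apply: le_trans (_ : Pr (fun E => uphalf (#|X'| * a) <= \sum_(x in X') #|nbr E x :&: Y|)%N <= _).
  apply: Pr_le => E EO /andP[_ /forallP h].
  rewrite leq_uphalf_double -muln2 [leqRHS]mulnC big_distrr /= -sum_nat_const.
  by apply: leq_sum => u uX; have := h u; rewrite uX /= => /ltnW.
have sX8 : (8 * #|X'| <= n)%N by apply: leq_trans sX; rewrite leq_mul2l subset_leq_card.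
apply: le_trans (dense_pair _ _ sX8 l0) _; rewrite ler_expR.
have hu : (#|X'| * a)%:R / 2 <= (uphalf (#|X'| * a))%:R :> K.
  rewrite ler_pdivrMr // -natrM ler_nat; lia.
have h1 : l * (#|X'|%:R * (a%:R / 4)) <= l * ((uphalf (#|X'| * a))%:R / 2).
  rewrite ler_wpM2l //; move: hu; rewrite natrM; lra.
have h2 : g%:R * (l * (a%:R / 4) - b * expR l * #|Y|%:R) <=
   #|X'|%:R * (l * (a%:R / 4) - b * expR l * #|Y|%:R) by rewrite ler_wpM2r ?subr_ge0 // ler_nat.
have h3 : b * expR l * (#|X'| * #|Y|)%:R = #|X'|%:R * (b * expR l * #|Y|%:R).
  by rewrite natrM mulrCA.
rewrite h3; move: h1 h2; rewrite mulrBr (mulrCA l); lra.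
Qed.

(** If S has few neighbours in cluster i, then all of its A i m |S| edges to that
    cluster end in one of the few small sets X, which [dense_pair] makes
    unlikely. *)
Lemma small_nbhd i m S (l : K) (g : nat) : (8 * #|S| <= n)%N -> S \subset cluster_of m -> 0 <= l ->
  Pr (fun E => #|[set u in cluster_of i | nbr E u :&: S != finset.set0]| <= g)%N
    <= #|[set X : {set T} | (X \subset cluster_of i) && (#|X| <= g)%N]|%:R *
       expR (#|S|%:R * (b * expR l * g%:R - l * ((A i m)%:R / 2))).
Proof.
move=> sS Sm l0; rewrite mulr_natl -sumr_const.
pose Q (X : {set T}) E := (A i m * #|S| <= \sum_(x in S) #|nbr E x :&: X|)%N.
apply: le_trans (_ : \sum_(X in [set X : {set T} | (X \subset cluster_of i) && (#|X| <= g)%N]) Pr (Q X) <= _).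
  apply: Pr_union => E EO hg.
  exists [set u in cluster_of i | nbr E u :&: S != finset.set0].
    by rewrite inE hg andbT; apply/subsetP => u; rewrite inE => /andP[].
  rewrite /Q mulnC -sum_nat_const; apply: leq_sum => x xS.
  have xm : cl x = m by have := subsetP Sm x xS; rewrite inE => /eqP.
  case/OmegaP: (EO) => _ /(_ x i); rewrite xm hsym => <-.
  apply: subset_leq_card; apply/subsetP => u; rewrite !inE => /andP[axu cu].
  rewrite axu cu /=; apply/set0Pn; exists x; by rewrite !inE adjC axu.
apply: ler_sum => X; rewrite inE => /andP[_ hX].
apply: le_trans (dense_pair _ _ sS l0) _; rewrite ler_expR.
rewrite !natrM mulrBr lerB //; last by rewrite le_eqVlt; apply/orP; left; apply/eqP; ring.
rewrite mulrCA ler_wpM2l // ler_wpM2l ?ler_nat // mulr_ge0 ?expR_ge0 //.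
by rewrite divr_ge0.
Qed.

End FixedPartition.

(** * Exact degrees into a set that splits a cluster *)

Section ExactDegrees.
Variables (K : realType) (T I : finType) (cl : T -> I) (A : I -> I -> nat) (n : nat).
Local Notation Omega := (regular_graph_set cl A).
Local Notation cluster_of := (cluster_of cl).
Local Notation Ex := (@Ex K T I cl A).
Local Notation Pr := (@Pr K T I cl A).
Implicit Types (E F : {set {set T}}) (S X Y R : {set T}).
Hypotheses (hcard : forall c, #|cluster_of c| = n) (hsym : forall i j, A i j = A j i).

Definition exact_degrees i S (c : T -> nat) E := [forall u in cluster_of i, #|nbr E u :&: S| == c u].

(** The bet of each pair pays the factor q when it is good, and on the event that
    all degrees are exact it is always won; so the product of the weights is at
    least q^N while its mean is at most 1. *)
Lemma exact_product (ps : seq (T * T)) R i m S (c : T -> nat)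
    (good : {set T} -> nat -> bool) (q : K) (goodp : {set {set T}} -> pred (T * T)) (N : nat) :
  uniq (entries ps) -> (forall u, u \in entries ps -> u \in cluster_of i /\ u \notin R) ->
  R \subset cluster_of m -> 1 <= q ->
  (forall W r j, good W r ->
     q * #|[set X : {set T} | [&& X \subset W, #|X| == r & #|X :&: S| == j]]|%:R
       <= 'C(#|W|, r)%:R) ->
  (forall E p, E \in Omega -> p \in ps -> goodp E p ->
     good (switchable E p.1 p.2 R) (switch_count E p.1 p.2 R)) ->
  Pr (fun E => exact_degrees i S c E && (N <= count (goodp E) ps)%N) <= (q ^+ N)^-1.
Proof.
move=> un ei sR q1 hgood hgp; have q0 : 0 <= q := le_trans ler01 q1.
pose phi (p : T * T) := exact_weight good q R S (c p.1).
have clE u : u \in cluster_of i -> cl u = i by rewrite inE => /eqP.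
have hE : Ex (fun E => \prod_(p <- ps) phi p (nbr E p.1) (nbr E p.2)) <= 1.
  apply: Ex_le => //; rewrite mul1r; apply: (@resample_product K T I cl A ps R i m phi un) => //.
  - by move=> u /ei[/clE].
  - by move=> p N1 N2; rewrite /phi /exact_weight; case: ifP => // _; rewrite mulr_ge0.
  - by move=> p E pp EO; apply: mean_exact.
rewrite -div1r; apply: (markov_le _ _ _ hE).
- by rewrite exprn_gt0 // (lt_le_trans ltr01).
- move=> E EO; apply: prodr_ge0 => p _; rewrite /phi /exact_weight.
  by case: ifP => // _; rewrite mulr_ge0.
move=> E EO /andP[/forallP hex hN].
have hu p : p \in ps -> #|nbr E p.1 :&: S| == c p.1.
  by move=> pp; have := hex p.1; rewrite (ei _ (entries1 pp)).1.
apply: le_trans (_ : q ^+ count (goodp E) ps <= _); first by rewrite ler_weXn2l.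
apply: prod_ge_count => // p pp.
  by rewrite /phi /exact_weight; case: ifP => // _; rewrite hu // mulr1.
by move=> gp; rewrite /phi /exact_weight (hgp E p EO pp gp) hu // mulr1.
Qed.

(** Without common neighbour, the whole union of the two neighbourhoods can be
    resampled. *)
Lemma switch_disjoint E u1 u2 R : ~~ common_nbr R E (u1, u2) ->
  [/\ switch_count E u1 u2 R = #|nbr E u1 :&: R|,
      #|switchable E u1 u2 R| = (#|nbr E u1 :&: R| + #|nbr E u2 :&: R|)%N &
      switchable E u1 u2 R = (nbr E u1 :|: nbr E u2) :&: R].
Proof.
move=> /existsPn h.
have e v : (v \in R) && adj E u1 v && adj E u2 v = false.
  by apply/negbTE; have := h v; rewrite andbA.
have es : switchable E u1 u2 R = (nbr E u1 :|: nbr E u2) :&: R.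
  apply/setP => v; rewrite !inE; have := e v.
  by case: (v \in R); case: (adj E u1 v); case: (adj E u2 v).
split=> //.
  apply: eq_card => v; rewrite !inE; have := e v.
  by case: (v \in R); case: (adj E u1 v); case: (adj E u2 v).
have e0 : (nbr E u1 :&: R) :&: (nbr E u2 :&: R) = finset.set0.
  apply/setP => v; rewrite !inE; have := e v.
  by case: (v \in R); case: (adj E u1 v); case: (adj E u2 v).
by rewrite es finset.setIUl cardsU e0 cards0 subn0.
Qed.

(** Each of the three exceptional events spoils at most g pairs. The remaining
    pairs have disjoint neighbourhoods in cluster m, with at least K1 vertices in
    S and at least K1 outside S, so that [hypergeometric_point] bounds the
    probability of the exact degree by 1/Q. *)
Lemma far_block i m S (c : T -> nat) (ps : seq (T * T)) (K1 Q g : nat) :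
  i != m -> uniq (entries ps) -> (forall u, u \in entries ps -> u \in cluster_of i) ->
  (0 < Q)%N -> (4 * Q ^ 2 <= K1.+1)%N ->
  Pr (exact_degrees i S c) <=
    Pr (fun E => g <= count (common_nbr (cluster_of m) E) ps)%N +
    Pr (fun E => g <= #|[set u in cluster_of i | #|nbr E u :&: (cluster_of m :&: S)| < K1]|)%N +
    Pr (fun E => g <= #|[set u in cluster_of i | #|nbr E u :&: (cluster_of m :\: S)| < K1]|)%N +
    (Q%:R ^+ (size ps - 3 * g))^-1.
Proof.
move=> nim un ei Q0 hQ.
pose lowA E (u : T) := (#|nbr E u :&: (cluster_of m :&: S)| < K1)%N.
pose lowB E (u : T) := (#|nbr E u :&: (cluster_of m :\: S)| < K1)%N.
pose goodp E (p : T * T) := [&& ~~ common_nbr (cluster_of m) E p, ~~ lowA E p.1 & ~~ lowB E p.1].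
pose good (W : {set T}) (r : nat) := [&& #|W| == r.*2, K1 <= #|W :&: S| & K1 <= #|W :\: S|]%N.
have hP := @exact_product ps (cluster_of m) i m S c good Q%:R goodp (size ps - 3 * g) un.
have {hP} hP : Pr (fun E => exact_degrees i S c E && (size ps - 3 * g <= count (goodp E) ps)%N) <= (Q%:R ^+ (size ps - 3 * g))^-1.
  apply: hP => //.
  - move=> u /ei ui; split=> //; move: ui; rewrite !inE => /eqP ->.
    by [].
  - by rewrite ler1n.
  - move=> W r j /and3P[/eqP cW h1 h2].
    rewrite -natrM ler_nat; apply: leq_trans (_ : Q * ('C(#|W :&: S|, j) * 'C(#|W :\: S|, r - j)) <= _)%N.
      by rewrite leq_mul2l card_draws_meet orbT.
    have eD : #|W :\: S| = (r.*2 - #|W :&: S|)%N by rewrite -cW cardsD.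
    rewrite eD cW; apply: (@hypergeometric_point r _ j K1 Q) => //.
      by rewrite -cW subset_leq_card // subsetIl.
    by rewrite -eD.
  - move=> E [u1 u2] EO pp /and3P[nc /= nA nB].
    have [e1 e2 e3] := switch_disjoint nc; rewrite /good e1 e2 e3.
    have clE u : u \in cluster_of i -> cl u = i by rewrite inE => /eqP.
    have [c1 c2] := (clE _ (ei _ (entries1 pp)), clE _ (ei _ (entries2 pp))).
    case/OmegaP: EO => _ hE; rewrite !hE c1 c2 addnn eqxx /=.
    rewrite -!leqNgt in nA nB; apply/andP; split.
      apply: leq_trans nA _; apply/subset_leq_card/subsetP => v.
      by rewrite !inE => /andP[-> /andP[-> ->]].
    apply: leq_trans nB _; apply/subset_leq_card/subsetP => v.
    by rewrite !inE => /andP[-> /andP[-> ->]].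
apply: le_trans (lerD (lexx _) hP).
apply: le_trans (@Pr_or K T I cl A _ (fun E => [|| (g <= count (common_nbr (cluster_of m) E) ps)%N,
   (g <= #|[set u in cluster_of i | lowA E u]|)%N | (g <= #|[set u in cluster_of i | lowB E u]|)%N])
  (fun E => exact_degrees i S c E && (size ps - 3 * g <= count (goodp E) ps)%N) _) _.
  move=> E EO ->; rewrite -implyNb !negb_or -!ltnNge; apply/implyP => /and3P[h1 h2 h3] /=.
  have hc (P : pred T) : (count (fun p : T * T => P p.1) ps <= #|[set u in cluster_of i | P u]|)%N.
    apply: leq_trans (_ : count (fun p => P p.1 || P p.2) ps <= _)%N.
      by apply: sub_count => p /= ->.
    apply: leq_trans (count_entries _ un) _; apply/subset_leq_card/subsetP => u.
    by rewrite !inE => /andP[/ei ui ->]; rewrite inE in ui; rewrite ui.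
  have := count_predC (goodp E) ps.
  have : (count (predC (goodp E)) ps <= count (common_nbr (cluster_of m) E) ps +
     (count (fun p => lowA E p.1) ps + count (fun p => lowB E p.1) ps))%N.
    elim: (ps) => //= p qs IH; move: IH; rewrite /goodp.
    by case: (common_nbr _ E p); case: (lowA E p.1); case: (lowB E p.1) => /=; lia.
  have := hc (lowA E); have := hc (lowB E); lia.
rewrite lerD2r -addrA.
apply: le_trans (@Pr_or K T I cl A _ (fun E => (g <= count (common_nbr (cluster_of m) E) ps)%N)
  (fun E => (g <= #|[set u in cluster_of i | lowA E u]|)%N || (g <= #|[set u in cluster_of i | lowB E u]|)%N) _) _.
  by [].
rewrite lerD2l; exact: Pr_or.
Qed.

(** The resampled region R omits the vertices of the pairs themselves, because
    the clusters i and m may coincide. A pair that touches the part S' of S in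
    cluster m is bet on unless it has a common neighbour in R, or one of its
    vertices has more than a/2 neighbours among the vertices of the pairs, where
    a = A i m, or its first vertex has at least a/2 neighbours in S'.
    By counting edges, the last case occurs at most 2 |S'| times. In a pair that
    is bet on, both vertices have between a/2 and a neighbours in R, the
    switchable set contains a vertex of S and one outside S, and the exact degree
    has probability at most 7/9 by [exact_draws_swap]. *)
Lemma mid_block i m S (c : T -> nat) (ps : seq (T * T)) (g0 g3 g4 : nat) :
  uniq (entries ps) -> (forall u, u \in entries ps -> u \in cluster_of i) ->
  [disjoint cluster_of m :&: S & [set u in entries ps]] -> (0 < A i m)%N ->
  Pr (fun E => exact_degrees i S c E &&
       (g0 <= count (fun p => (nbr E p.1 :&: (cluster_of m :&: S) != finset.set0) ||
                              (nbr E p.2 :&: (cluster_of m :&: S) != finset.set0)) ps)%N) <=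
    Pr (fun E => g3 <= count (common_nbr (cluster_of m :\: [set u in entries ps]) E) ps)%N +
    Pr (fun E => g4 <= #|[set u in [set u in entries ps] |
          A i m < 2 * #|nbr E u :&: [set u in entries ps]|]|)%N +
    ((9 / 7) ^+ (g0 - (g3 + g4 + 2 * #|cluster_of m :&: S|)))^-1.
Proof.
move=> un ei dis a0.
set L := [set u in entries ps]; set S' := cluster_of m :&: S; set R := cluster_of m :\: L.
set a := A i m.
pose heavyL E (u : T) := (a < 2 * #|nbr E u :&: L|)%N.
pose heavyS E (u : T) := (a <= 2 * #|nbr E u :&: S'|)%N.
pose tch E (p : T * T) := (nbr E p.1 :&: S' != finset.set0) || (nbr E p.2 :&: S' != finset.set0).
pose goodp E (p : T * T) := [&& tch E p, ~~ common_nbr R E p,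
   ~~ (heavyL E p.1 || heavyL E p.2) & ~~ heavyS E p.1].
pose good (W : {set T}) (r : nat) := [&& W :&: S != finset.set0, W :\: S != finset.set0, (0 < r)%N &
   (2 * (#|W| * #|W|.-1) <= 9 * (r * (#|W| - r)))%N].
have clE u : u \in cluster_of i -> cl u = i by rewrite inE => /eqP.
set N := (g0 - _)%N.
have hP : Pr (fun E => exact_degrees i S c E && (N <= count (goodp E) ps)%N) <= ((9 / 7) ^+ N)^-1.
  apply: (@exact_product ps R i m S c good) => //.
  - move=> u ue; split; first exact: ei.
    by rewrite !inE ue.
  - by apply/subsetP => v; rewrite in_setD => /andP[].
  - by lra.
  - move=> W r j /and4P[/set0Pn[x xW] /set0Pn[y yW] r0 hw].
    have := exact_draws_swap j xW yW r0 hw.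
    rewrite -(ler_nat K) !natrM => h.
    have <- : 7^-1 * (7 * 'C(#|W|, r)%:R) = 'C(#|W|, r)%:R :> K by rewrite mulKf.
    by rewrite [9 / 7]mulrC -mulrA ler_wpM2l.
  - move=> E [u1 u2] EO pp /and4P[ht nc]; rewrite negb_or -!leqNgt /= => /andP[n1 n2].
    rewrite -ltnNge => nS.
    have [e1 e2 e3] := switch_disjoint nc.
    have [c1 c2] := (clE _ (ei _ (entries1 pp)), clE _ (ei _ (entries2 pp))).
    case/OmegaP: EO => _ hE.
    have deg u : cl u = i -> (2 * #|nbr E u :&: L| <= a)%N ->
        (a <= 2 * #|nbr E u :&: R|)%N /\ (#|nbr E u :&: R| <= a)%N.
      move=> cu hu; have := hE u m; rewrite cu -/a -(cardsID L) => e.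
      have e' : nbr E u :&: cluster_of m :\: L = nbr E u :&: R by rewrite /R -setIDA.
      have : (#|nbr E u :&: cluster_of m :&: L| <= #|nbr E u :&: L|)%N.
        by rewrite subset_leq_card // finset.setSI // subsetIl.
      by rewrite e' in e; lia.
    have [d1 d1'] := deg u1 c1 n1; have [d2 d2'] := deg u2 c2 n2.
    rewrite /good e1 e2 addKn; apply/and4P; split.
    + have {ht} : exists2 x, (x \in nbr E u1 :|: nbr E u2) & x \in S'.
        by case/orP: ht => /set0Pn[x /finset.setIP[xN xS]]; exists x => //; rewrite in_setU xN ?orbT.
      case=> x xN xS; apply/set0Pn; exists x; rewrite e3 in_setI in_setI xN /=.
      have := disjointFr dis xS; rewrite -/L => xL.
      by move: xS; rewrite in_setI => /andP[xm ->]; rewrite in_setD xL xm.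
    + have lt : (#|nbr E u1 :&: R :&: S| < #|nbr E u1 :&: R|)%N.
        have : (#|nbr E u1 :&: R :&: S| <= #|nbr E u1 :&: S'|)%N.
          apply/subset_leq_card/subsetP => v; rewrite !inE.
          by move=> /andP[/andP[-> /andP[_ ->]] ->].
        lia.
      have : (0 < #|(nbr E u1 :&: R) :\: S|)%N by rewrite cardsD subn_gt0.
      case/card_gt0P => y; rewrite in_setD in_setI => /and3P[yS yN yR].
      by apply/set0Pn; exists y; rewrite e3 in_setD in_setI in_setU yN yR yS.
    + lia.
    + move: d1 d1' d2 d2'; move: (#|nbr E u1 :&: R|) (#|nbr E u2 :&: R|) => x y d1 d1' d2 d2'.
      have hx : (x <= 2 * y)%N by lia.
      have hy : (y <= 2 * x)%N by lia.
      (* The inequality is (2x - y)(2y - x) >= 0. *)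
      have : (2 * ((x + y) * (x + y)) <= 9 * (x * y))%N by clear -hx hy; nia.
      apply: leq_trans; rewrite !leq_mul2l; apply/orP; right; apply/orP; right; lia.
apply: le_trans (lerD (lexx _) hP).
apply: le_trans (@Pr_or K T I cl A _ (fun E => (g3 <= count (common_nbr R E) ps)%N || 
   (g4 <= #|[set u in L | heavyL E u]|)%N)
  (fun E => exact_degrees i S c E && (N <= count (goodp E) ps)%N) _) _.
  move=> E EO /andP[-> hg0]; rewrite -implyNb !negb_or -!ltnNge; apply/implyP => /andP[h3 h4] /=.
  have hcL := count_entries (heavyL E) un.
  have eL : [set u in entries ps | heavyL E u] = [set u in L | heavyL E u].
    by apply/setP => u; rewrite !inE.
  rewrite eL in hcL.
  have hcS : (count (fun p => heavyS E p.1) ps <= 2 * #|S'|)%N.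
    apply: leq_trans (_ : count (fun p => heavyS E p.1 || heavyS E p.2) ps <= _)%N.
      by apply: sub_count => p /= ->.
    apply: leq_trans (count_entries _ un) _.
    apply: leq_trans (_ : #|[set u in cluster_of i | heavyS E u]| <= _)%N.
      apply/subset_leq_card/subsetP => u.
      by rewrite !inE => /andP[/ei ui ->]; rewrite inE in ui; rewrite ui.
    rewrite -(leq_pmul2r a0) -sum_nat_const.
    apply: leq_trans (_ : \sum_(u in cluster_of i) 2 * #|nbr E u :&: S'| <= _)%N.
      apply: leq_trans (_ : \sum_(u in [set u in cluster_of i | heavyS E u]) 2 * #|nbr E u :&: S'| <= _)%N.
        by apply: leq_sum => u; rewrite inE => /andP[].
      rewrite [leqRHS](bigID (heavyS E)) /=; apply: leq_trans (leq_addr _ _).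
      by rewrite eq_leq //; apply: eq_bigl => u; rewrite inE.
    rewrite -big_distrr /= -mulnA leq_mul2l /=.
    under eq_bigr do rewrite adj_sum; rewrite exchange_big /= -sum_nat_const eq_leq //.
    apply: eq_bigr => x xS; under eq_bigr do rewrite adjC; rewrite -adj_sum.
    case/OmegaP: EO => _ ->; rewrite hsym; congr (A _ _).
    by move: xS; rewrite /S' !inE => /andP[/eqP].
  have : (count (tch E) ps <= count (goodp E) ps + (count (common_nbr R E) ps +
     (count (fun p => heavyL E p.1 || heavyL E p.2) ps + count (fun p => heavyS E p.1) ps)))%N.
    clear; elim: (ps) => //= p qs IH; move: IH; rewrite /goodp.
    by case: (tch E p); case: (common_nbr R E p); case: (heavyL E p.1 || heavyL E p.2);
      case: (heavyS E p.1) => /=; lia.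
  have hg0' : (g0 <= count (tch E) ps)%N by [].
  clear -hg0' h3 h4 hcL hcS; rewrite /N; lia.
rewrite lerD2r; exact: Pr_or.
Qed.

End ExactDegrees.

(** * Small sets without unique neighbours *)

Lemma ffact_bounds N m : (m <= N)%N -> ((N - m) ^ m <= N ^_ m <= N ^ m)%N.
Proof.
have e c : (c ^ m = \prod_(i < m) c)%N by rewrite prod_nat_const card_ord.
move=> h; rewrite ffact_prod !e.
by apply/andP; split; apply: leq_prod => i _; have := ltn_ord i; lia.
Qed.

(** The usual bound (e N / s)^s with 4 in place of e: s^s is at most the falling
    factorial (2s)(2s-1)...(s+1), which is s! times a central binomial
    coefficient. *)
Lemma bin_self_exp_le N s : ('C(N, s) * s ^ s <= (4 * N) ^ s)%N.
Proof.
have [sN|sN] := leqP s N; last by rewrite bin_small.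
have h1 : (s ^ s <= 4 ^ s * s`!)%N.
  have /andP[h _] := @ffact_bounds s.*2 s ltac:(lia).
  rewrite (_ : s.*2 - s = s)%N in h; last by lia.
  apply: leq_trans h _; rewrite -bin_ffact leq_mul2r; apply/orP; right.
  rewrite -(@leq_exp2r _ _ 2) //.
  apply: leq_trans (_ : 'C(s.*2, s) ^ 2 * s.*2.+1 <= _)%N; first by rewrite leq_pmulr.
  by apply: leq_trans (bin_central_le s) _; rewrite -expnM mulnC expnM.
apply: leq_trans (_ : 'C(N, s) * (4 ^ s * s`!) <= _)%N; first by rewrite leq_mul2l h1 orbT.
rewrite mulnCA bin_ffact expnMn leq_mul2l; apply/orP; right.
by have /andP[] := ffact_bounds sN.
Qed.

Lemma one_plus_pow_le (K : realFieldType) (y : K) (s : nat) : 0 <= y -> s%:R * y <= 1 ->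
  (1 + y) ^+ s <= 1 + s%:R * y + (s%:R * y) ^+ 2.
Proof.
move=> y0; elim: s => [|s IH] h; first by rewrite expr0 !mul0r expr0n /= !addr0.
have h' : s%:R * y <= 1 by apply: le_trans h; rewrite ler_wpM2r // ler_nat.
have {}IH := IH h'.
rewrite exprSr; apply: le_trans (ler_wpM2r (_ : 0 <= 1 + y) IH) _; first by lra.
move: h; rewrite -natr1; have s0 : 0 <= s%:R :> K by rewrite ler0n.
set t := s%:R in s0 IH h' * => h.
have h2 : t * y * (t * y * y) <= t * y * y by rewrite ler_piMl ?mulr_ge0.
nra.
Qed.

Section SmallSets.
Variables (K : realType) (T I : finType) (cl : T -> I) (A : I -> I -> nat) (n d : nat).
Local Notation Omega := (regular_graph_set cl A).
Local Notation cluster_of := (cluster_of cl).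
Local Notation Ex := (@Ex K T I cl A).
Local Notation Pr := (@Pr K T I cl A).
Implicit Types (E F : {set {set T}}) (S X Y R : {set T}).
Hypotheses (hcard : forall c, #|cluster_of c| = n)
  (hsym : forall i j, A i j = A j i) (hrow : forall i, (\sum_c A i c)%N = d).
Hypothesis (hn : (8 * d.+1 <= n)%N).
Local Notation b := (edge_ratio K n d).

Definition no_unique_nbr S E := [forall w, (w \notin S) ==> (#|nbr E w :&: S| != 1%N)].

Lemma card_vertices : #|T| = (#|I| * n)%N.
Proof.
rewrite -sum1_card (partition_big cl predT) //= -sum_nat_const; apply: eq_bigr => c _.
by rewrite -(hcard c) -sum1_card; apply: eq_bigl => v; rewrite inE.
Qed.

Lemma total_degree E v : E \in Omega -> #|nbr E v| = d.
Proof.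
case/OmegaP=> _ hE; rewrite -(hrow (cl v)) -sum1_card (partition_big cl predT) //=.
apply: eq_bigr => c _; rewrite -hE -sum1_card; apply: eq_bigl => u.
by rewrite !inE.
Qed.

(** An edge inside S is counted at its endpoint of larger rank, so that the blocks
    of edges attached to the different vertices are disjoint. *)
Definition below S (w : T) : {set T} := [set u in S | (enum_rank u < enum_rank w)%N].

Lemma sum_nbr_below E S :
  (\sum_(w in S) #|nbr E w :&: S| = \sum_(w in S) 2 * #|nbr E w :&: below S w|)%N.
Proof.
have e1 w : (#|nbr E w :&: S| = \sum_(u in S) (adj E w u && (enum_rank u < enum_rank w)) +
    \sum_(u in S) (adj E w u && (enum_rank w < enum_rank u)))%N.
  rewrite adj_sum -big_split /=; apply: eq_bigr => u _.
  have [->|nuw] := eqVneq u w; first by rewrite adjxx.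
  case: (adj E w u) => //=; have : (enum_rank u != enum_rank w :> nat).
    by apply: contraNneq nuw => /ord_inj/enum_rank_inj ->.
  by case: ltngtP.
under eq_bigr do rewrite e1; rewrite big_split /=.
rewrite [X in (_ + X)%N]exchange_big /=.
have -> : (\sum_(j in S) \sum_(i in S) (adj E i j && (enum_rank i < enum_rank j)) =
  \sum_(i in S) \sum_(u in S) (adj E i u && (enum_rank u < enum_rank i)))%N.
  by apply: eq_bigr => w _; apply: eq_bigr => u _; rewrite adjC.
rewrite addnn -mul2n big_distrr /=; apply: eq_bigr => w _; congr (_ * _)%N.
rewrite -(sum1_card (mem (nbr E w :&: below S w))) big_mkcond [RHS]big_mkcond; apply: eq_bigr => u _.
by rewrite !inE; case: (u \in S); rewrite ?andbF //=; case: (adj E w u); case: (_ < _)%N.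
Qed.

(** Write the d|S| edge ends at S as the sum, over the vertices w outside S, of
    the degree of w into S, plus twice the sum, over w in S, of the number of
    neighbours of w below it. On the event, x^(d|S|) is thus a product over w of
    terms, each bounded by a polynomial in the edges attached to w, in which for w
    outside S the monomials of degree 1 are missing. In mean, such a factor is at
    most 1 + (|S| x b)^2, without linear term, and this gain makes the event
    unlikely. *)
Lemma no_unique_nbr_prob S (x : K) : (8 * #|S| <= n)%N -> 0 < x ->
  #|S|%:R * (x * b) <= 1 ->
  Pr (no_unique_nbr S) <=
    expR (#|T|%:R * (#|S|%:R * (x * b)) ^+ 2 + #|S|%:R * (#|S|%:R * (x ^+ 2 * b))) / x ^+ (d * #|S|).
Proof.
move=> sS x0 hx; have x0' := ltW x0; have b0 : 0 <= b by rewrite divr_ge0.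
(* For w in S each edge carries two ends at S, hence the weight x^2. *)
pose c (w : T) (X : {set T}) : K :=
  if w \in S then (if X \subset below S w then (x ^+ 2) ^+ #|X| else 0)
  else (if (X \subset S) && (#|X| != 1%N) then x ^+ #|X| else 0).
pose Phi (w : T) (X : {set T}) : {set {set T}} := [set [set u; w] | u in X].
pose B (w : T) : {set {set T}} := [set [set u; w] | u in if w \in S then below S w else S].
have cPhi w X : w \notin X -> #|Phi w X| = #|X|.
  move=> wX; apply: card_in_imset => u v uX vX e.
  have : u \in [set v; w] by rewrite -e set21.
  by rewrite !inE => /orP[/eqP//|/eqP h]; rewrite -h uX in wX.
have below_w S' w : w \notin below S' w by rewrite inE ltnn andbF.
have sbelow w : below S w \subset S by apply/subsetP => u; rewrite inE => /andP[].
have c0 w X : 0 <= c w X by rewrite /c; do 2?case: ifP => _; rewrite ?exprn_ge0.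
have hE : Ex (fun E => \prod_(w <- enum T) \sum_X c w X * (Phi w X \subset E)%:R)
    <= \prod_(w <- enum T) \sum_X c w X * b ^+ #|Phi w X|.
  apply: (@edge_polynomial K T I cl A n d hcard hsym hrow S sS hn _ _ (enum T) c Phi B (enum_uniq _) c0).
  - move=> w X _; rewrite /c /Phi /B; case: ifP => wS; case: ifP => sX; rewrite ?eqxx // => _.
      exact: imsetS.
    by apply: imsetS; case/andP: sX.
  - have key (w w' : T) : w != w' -> (enum_rank w < enum_rank w')%N -> [disjoint B w & B w'].
      move=> nw lt; rewrite -setI_eq0 -subset0; apply/subsetP => e.
      rewrite in_setI => /andP[/imsetP[u uw ->] /imsetP[u' uw' e2]].
      have uS : u \in S by move: uw; case: ifP => // _; rewrite inE => /andP[].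
      have : w' \in [set u; w] by rewrite e2 set22.
      rewrite !inE (eq_sym w' w) (negbTE nw) orbF => /eqP e3; subst u.
      move: uw; case: ifP => wS; first by rewrite inE => /andP[_]; rewrite ltnNge ltnW.
      have : w \in [set u'; w'] by rewrite -e2 set22.
      rewrite !inE (negbTE nw) orbF => /eqP e3; subst u'.
      by move: uw'; rewrite uS inE wS.
    move=> w w' _ _ nw; have : enum_rank w != enum_rank w' :> nat.
      by apply: contraNneq nw => /ord_inj/enum_rank_inj ->.
    rewrite neq_ltn => /orP[]; first exact: key.
    by rewrite disjoint_sym; apply: key; rewrite eq_sym.
  - move=> w f _ /imsetP[u uw ->]; apply/set0Pn; exists u; rewrite !inE eqxx /=.
    by move: uw; case: ifP => // _; rewrite inE => /andP[].
set s := #|S| in hx *.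
have hb : \prod_(w <- enum T) \sum_X c w X * b ^+ #|Phi w X| <=
    expR (#|T|%:R * (s%:R * (x * b)) ^+ 2 + s%:R * (s%:R * (x ^+ 2 * b))).
  rewrite big_enum /=.
  apply: le_trans (_ : \prod_(w : T) expR ((s%:R * (x * b)) ^+ 2 + (w \in S)%:R * (s%:R * (x ^+ 2 * b))) <= _).
    apply: ler_prod => w _; apply/andP; split.
      by apply: sumr_ge0 => X _; rewrite mulr_ge0 ?exprn_ge0.
    have sq0 : 0 <= (s%:R * (x * b)) ^+ 2 by rewrite sqr_ge0.
    case: (boolP (w \in S)) => wS.
      rewrite mul1r; apply: le_trans (_ : expR (s%:R * (x ^+ 2 * b)) <= _); last first.
        by rewrite ler_expR lerDr.
      apply: le_trans (_ : (1 + x ^+ 2 * b) ^+ #|below S w| <= _).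
        rewrite -sum_subsets [leRHS]big_mkcond /=; apply: ler_sum => X _.
        rewrite /c wS; case: ifP => sX; last by rewrite mul0r.
        rewrite cPhi ?exprMn //; apply: contraNN (below_w S w); exact: (subsetP sX).
      have y0 : 0 <= x ^+ 2 * b by rewrite mulr_ge0 ?exprn_ge0.
      apply: le_trans (_ : (1 + x ^+ 2 * b) ^+ s <= _).
        by rewrite ler_weXn2l ?lerDl // subset_leq_card.
      rewrite expRM_natl; apply: lerXn2r; rewrite ?nnegrE ?expR_ge0 ?addr_ge0 //.
      exact: expR_ge1Dx.
    rewrite mul0r addr0; apply: le_trans (expR_ge1Dx _).
    have hsub := sum_subsets S (x * b).
    rewrite (bigID (fun X : {set T} => #|X| == 1%N)) /= in hsub.
    have e1 : \sum_(X : {set T} | (X \subset S) && (#|X| == 1%N)) (x * b) ^+ #|X| = s%:R * (x * b).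
      rewrite (eq_bigr (fun=> x * b)); last by move=> X /andP[_ /eqP ->]; rewrite expr1.
      rewrite sumr_const mulr_natl; congr (_ *+ _).
      rewrite -(bin1 s) /s -cards_draws; apply: eq_card => X.
      by rewrite in_set.
    rewrite e1 in hsub; have := one_plus_pow_le (mulr_ge0 x0' b0) hx; rewrite -hsub -addrA -/s.
    rewrite (addrCA 1) lerD2l; apply: le_trans.
    rewrite [leRHS]big_mkcond /=; apply: ler_sum => X _; rewrite /c (negbTE wS).
    case: ifP => // [/andP[sX _]|_]; last by rewrite mul0r.
    by rewrite cPhi ?exprMn //; apply: contraNN wS; exact: (subsetP sX).
  rewrite -expR_sum ler_expR big_split /= sumr_const -[_ *+ #|T|]mulr_natl lerD2l.
  rewrite -mulr_suml -natr_sum; apply: ler_wpM2r; first by rewrite !mulr_ge0 ?exprn_ge0.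
  by rewrite ler_nat /s -sum1_card [leqRHS]big_mkcond leq_sum // => w _; case: (w \in S).
apply: (markov_le _ _ _ (le_trans hE hb)).
- by rewrite exprn_gt0.
- by move=> E EO; apply: prodr_ge0 => w _; apply: sumr_ge0 => X _; rewrite mulr_ge0.
move=> E EO /forallP hw.
have -> : (d * s = \sum_(w : T) if w \in S then 2 * #|nbr E w :&: below S w| else #|nbr E w :&: S|)%N.
  have -> : (\sum_(w : T) (if w \in S then 2 * #|nbr E w :&: below S w| else #|nbr E w :&: S|) =
      \sum_(w : T) #|nbr E w :&: S|)%N.
    rewrite [LHS](bigID (mem S)) [RHS](bigID (mem S)) /=; congr addn.
      by rewrite sum_nbr_below; apply: eq_bigr => w ->.
    by apply: eq_bigr => w /negbTE ->.
  under eq_bigr do rewrite adj_sum; rewrite exchange_big /= mulnC -sum_nat_const.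
  apply: eq_bigr => u _; under eq_bigr do rewrite adjC; rewrite -(total_degree u EO).
  rewrite -sum1_card big_mkcond; apply: eq_bigr => w _; by rewrite inE; case: (adj E u w).
rewrite -prodrXr big_enum /=; apply: ler_prod => w _; rewrite exprn_ge0 //=.
have one X : X \subset nbr E w -> (Phi w X \subset E).
  move=> sX; apply/subsetP => _ /imsetP[u uX ->]; have := subsetP sX u uX.
  by rewrite inE adjC => /andP[].
case: ifP => wS.
  rewrite (bigD1 (nbr E w :&: below S w)) //= one ?subsetIl // mulr1.
  rewrite {1}/c wS subsetIr -exprM lerDl.
  by apply: sumr_ge0 => X _; rewrite mulr_ge0.
rewrite (bigD1 (nbr E w :&: S)) //= one ?subsetIl // mulr1.
have := hw w; rewrite wS /= => hw'; rewrite {1}/c wS subsetIr hw' lerDl.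
by apply: sumr_ge0 => X _; rewrite mulr_ge0.
Qed.

End SmallSets.

Section SmallRegime.
Variables (K : realType) (T I : finType) (cl : T -> I) (A : I -> I -> nat) (n d : nat).
Local Notation cluster_of := (cluster_of cl).
Local Notation Pr := (@Pr K T I cl A).
Implicit Types (E F : {set {set T}}) (S X Y R : {set T}).
Hypotheses (hcard : forall c, #|cluster_of c| = n)
  (hsym : forall i j, A i j = A j i) (hrow : forall i, (\sum_c A i c)%N = d).
Hypotheses (hn : (8 * d.+1 <= n)%N) (d8 : (8 <= d)%N) (I0 : (0 < #|I|)%N).
Local Notation b := (edge_ratio K n d).
Let k : K := #|I|%:R.

(** The parameter of [no_unique_nbr_prob] is x = (n/(ds))^(1/2). With rho = ds/n
    this gives the bound e^(4kds + 2s) rho^(ds/2). The number of sets of size s is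
    at most (4kd/rho)^s. As d is at least 8, rho^(d/2) contains rho^2 and a
    further power which, rho being at most e^(-40k), is at most e^(-10kd); so the
    product is at most rho^s. *)
Lemma small_term S : (0 < #|S|)%N -> (d * #|S|)%:R <= expR (- (40 * k)) * n%:R ->
  'C(#|T|, #|S|)%:R * Pr (no_unique_nbr S) <= d%:R / n%:R * (1 / 2) ^+ #|S|.-1.
Proof.
set s := #|S| => s0 hs.
have k1 : 1 <= k by rewrite ler1n.
have n0 : (0 < n)%N by lia.
have nK : 0 < n%:R :> K by rewrite ltr0n.
have sK : 1 <= s%:R :> K by rewrite ler1n.
have dK : 8 <= d%:R :> K by rewrite ler_nat.
pose rho : K := (d * s)%:R / n%:R.
have rho0 : 0 < rho by rewrite divr_gt0 // ltr0n muln_gt0 s0 andbT; lia.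
have rho1 : rho <= expR (- (40 * k)) by rewrite ler_pdivrMr.
pose sg := Num.sqrt rho.
have sg0 : 0 < sg by rewrite sqrtr_gt0.
have sg2 : sg ^+ 2 = rho by rewrite sqr_sqrtr // ltW.
have sg1 : sg <= expR (- (20 * k)).
  have : sg ^+ 2 <= expR (- (20 * k)) ^+ 2.
    by rewrite sg2 -expRM_natl; apply: (le_trans rho1); rewrite ler_expR; lra.
  by rewrite ler_pXn2r // nnegrE ?expR_ge0 // ltW.
have e40 : expR (- (40 * k)) <= 1 / 4.
  rewrite expRN div1r lef_pV2 ?posrE ?expR_gt0 //.
  by apply: le_trans (expR_ge1Dx _); lra.
have e20 : expR (- (20 * k)) <= 1 / 2.
  rewrite expRN div1r lef_pV2 ?posrE ?expR_gt0 //.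
  by apply: le_trans (expR_ge1Dx _); lra.
have s8 : (8 * s <= n)%N.
  rewrite -(ler_nat K); apply: le_trans (_ : (d * s)%:R <= _).
    by rewrite ler_nat leq_mul2r d8 orbT.
  by apply: (le_trans hs); rewrite ler_piMl //; lra.
have bE : b = 2 * d%:R / n%:R by rewrite /b natrM.
have nn0 : n%:R != 0 :> K by rewrite gt_eqF.
have sgn0 : sg != 0 by rewrite gt_eqF.
have sb : s%:R * b = 2 * rho by rewrite bE /rho natrM; field.
have h1 : s%:R * (sg^-1 * b) = 2 * sg by rewrite mulrCA sb -sg2; field.
have h2 : s%:R * ((sg^-1) ^+ 2 * b) = 2.
  by rewrite mulrCA sb -sg2; field.
have NP := @no_unique_nbr_prob K T I cl A n d hcard hsym hrow hn S sg^-1 s8.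
rewrite -/s h1 h2 in NP.
have {}NP : Pr (no_unique_nbr S) <= expR (4 * k * d%:R * s%:R + 2 * s%:R) * sg ^+ (d * s).
  apply: le_trans (NP _ _) _; rewrite ?invr_gt0 //; first by lra.
  rewrite exprVn invrK le_eqVlt; apply/orP; left; apply/eqP; congr (expR _ * _).
  rewrite (card_vertices hcard) exprMn sg2 natrM -/k /rho natrM; congr (_ + _); last by ring.
  by field.
have sgd : sg ^+ d <= rho ^+ 2 * expR (- (10 * k * d%:R)).
  have d4 : (4 <= d)%N := leq_trans (isT : (4 <= 8)%N) d8.
  rewrite -[X in sg ^+ X](subnKC d4) exprD (_ : 4 = (2 * 2))%N // exprM sg2.
  apply: ler_wpM2l; first by rewrite exprn_ge0 ?ltW.
  apply: le_trans (_ : expR (- (20 * k)) ^+ (d - 4) <= _).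
    by rewrite lerXn2r // nnegrE ?expR_ge0 // ltW.
  rewrite -expRM_natl ler_expR natrB //.
  have h8 := mulr_ge0 (le_trans ler01 k1) (_ : 0 <= d%:R - 8 :> K).
  rewrite subr_ge0 in h8; have {}h8 := h8 dK; lra.
have bracket : 4 * k * d%:R / rho * (expR (4 * k * d%:R + 2) * sg ^+ d) <= rho.
  have kd : 8 <= k * d%:R by have := ler_pM ler01 (ler0n K 8) k1 dK; rewrite mul1r.
  apply: le_trans (_ : 4 * k * d%:R / rho * (expR (4 * k * d%:R + 2) * (rho ^+ 2 * expR (- (10 * k * d%:R)))) <= _).
    rewrite ler_wpM2l ?ler_wpM2l ?expR_ge0 //.
    by rewrite !mulr_ge0 ?invr_ge0 ?(ltW rho0) //; lra.
  have -> : 4 * k * d%:R / rho * (expR (4 * k * d%:R + 2) * (rho ^+ 2 * expR (- (10 * k * d%:R)))) =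
    rho * (4 * k * d%:R * expR (2 - 6 * (k * d%:R))).
    have -> : expR (2 - 6 * (k * d%:R)) = expR (4 * k * d%:R + 2) * expR (- (10 * k * d%:R)).
      by rewrite -expRD; congr expR; ring.
    by field; rewrite gt_eqF.
  rewrite ler_piMr ?(ltW rho0) //.
  apply: le_trans (_ : expR (4 * k * d%:R) * expR (2 - 6 * (k * d%:R)) <= _).
    rewrite ler_wpM2r ?expR_ge0 //; apply: le_trans (expR_ge1Dx _); lra.
  by rewrite -expRD expR_le1; lra.
have Cb : 'C(#|T|, s)%:R <= (4 * k * d%:R / rho) ^+ s :> K.
  have := bin_self_exp_le #|T| s; rewrite -(ler_nat K) natrM !natrX natrM.
  rewrite (card_vertices hcard) -ler_pdivlMr ?exprn_gt0 ?ltr0n // => h.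
  apply: le_trans h _; rewrite -expr_div_n natrM le_eqVlt; apply/orP; left; apply/eqP.
  congr (_ ^+ _); rewrite /rho natrM -/k.
  have sn0 : s%:R != 0 :> K by rewrite pnatr_eq0 -lt0n.
  have dn0 : d%:R != 0 :> K by rewrite pnatr_eq0 -lt0n (leq_trans _ d8).
  by field; rewrite ?sn0 ?dn0 ?nn0.
apply: le_trans (_ : rho ^+ s <= _).
  apply: le_trans (_ : (4 * k * d%:R / rho) ^+ s * (expR (4 * k * d%:R + 2) * sg ^+ d) ^+ s <= _); last first.
    rewrite -exprMn; apply: lerXn2r; rewrite ?nnegrE ?(ltW rho0) //.
    by rewrite !mulr_ge0 ?invr_ge0 ?expR_ge0 ?exprn_ge0 ?(ltW rho0) ?(ltW sg0) //; lra.
  apply: ler_pM => //; first exact: Pr_ge0.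
  apply: le_trans NP _; rewrite exprMn -exprM -expRM_natl le_eqVlt.
  by apply/orP; left; apply/eqP; congr (expR _ * _); ring.
have rhoE : rho = d%:R / n%:R * s%:R by rewrite /rho natrM mulrAC.
have -> : rho ^+ s = d%:R / n%:R * (s%:R * rho ^+ s.-1).
  by rewrite -{1}(prednK s0) exprS {1}rhoE mulrA.
apply: ler_wpM2l; first by rewrite divr_ge0.
have -> : 1 / 2 = 2 * (1 / 4) :> K by field.
rewrite [leRHS]exprMn; apply: ler_pM; rewrite ?exprn_ge0 ?(ltW rho0) //.
  by rewrite -natrX ler_nat -{1}(prednK s0) ltn_expl.
by rewrite lerXn2r ?nnegrE ?(ltW rho0) ?(le_trans rho1) //; lra.
Qed.

Lemma sum_pow_half (N : nat) : \sum_(s < N) (1 / 2) ^+ s <= 2 :> K.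
Proof.
have -> : \sum_(s < N) (1 / 2) ^+ s = 2 - 2 * (1 / 2) ^+ N :> K.
  elim: N => [|N IH]; first by rewrite big_ord0 expr0; ring.
  by rewrite big_ord_recr /= IH exprS; field.
by rewrite gerBl mulr_ge0 // exprn_ge0.
Qed.

(** The bound of [small_term] covers all sets of one size together, and is summed
    over the sizes as a geometric series. *)
Lemma small_regime :
  Pr (fun E => [exists S : {set T}, [&& S != finset.set0,
        (d * #|S|)%:R <= expR (- (40 * k)) * n%:R & no_unique_nbr S E]])
    <= 2 * d%:R / n%:R.
Proof.
pose ok s := (0 < s)%N && ((d * s)%:R <= expR (- (40 * k)) * n%:R).
apply: le_trans (_ : \sum_(S : {set T} | ok #|S|) Pr (no_unique_nbr S) <= _).
  apply: Pr_union => E EO /existsP[S /and3P[S0 hS hE]]; exists S => //.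
  by rewrite /ok card_gt0 S0.
rewrite (partition_big (fun S : {set T} => inord #|S| : 'I_#|T|.+1) (fun s => ok s)) /=; last first.
  by move=> S; rewrite inordK // ltnS max_card.
apply: le_trans (_ : \sum_(s < #|T|.+1 | ok s) d%:R / n%:R * (1 / 2) ^+ s.-1 <= _).
  apply: ler_sum => s hs; rewrite -(@ler_pM2l _ 'C(#|T|, s)%:R); last first.
    by rewrite ltr0n bin_gt0 -ltnS.
  have cond S : (ok #|S| && (inord #|S| == s :> 'I_#|T|.+1)) = (#|S| == s).
    apply/andP/idP => [[_ /eqP <-]|/eqP e].
      by rewrite inordK // ltnS max_card.
    by rewrite e hs inord_val.
  rewrite (eq_bigl _ _ cond) mulr_sumr.
  have -> : 'C(#|T|, s)%:R * (d%:R / n%:R * (1 / 2) ^+ s.-1) =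
     \sum_(S : {set T} | #|S| == s) d%:R / n%:R * (1 / 2) ^+ s.-1 :> K.
    by rewrite sumr_const -[RHS]mulr_natl -card_draws cardsE.
  apply: ler_sum => S /eqP e; rewrite -e; case/andP: hs => h1 h2.
  by apply: small_term; rewrite e.
rewrite -mulr_sumr -(mulrA 2) [leRHS]mulrC; apply: ler_wpM2l; first by rewrite divr_ge0.
apply: le_trans (sum_pow_half #|T|).
rewrite big_mkcond big_ord_recl /= /ok /= add0r; apply: ler_sum => s _.
rewrite /bump /= add1n add0n; by case: ifP => // _; rewrite exprn_ge0.
Qed.

End SmallRegime.

(** * Partitions that split a cluster in large portions *)

Lemma exists_nat_ge (K : realType) (x : K) : exists N : nat, x <= N%:R.
Proof.
exists (Num.bound `|x|); apply/ltW/(le_lt_trans (ler_norm x)).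
by apply: archi_boundP.
Qed.

Lemma half_third_pow (K : realType) (J : nat) : (2 / 3) ^+ J <= (1 + J%:R / 2)^-1 :> K.
Proof.
have -> : 2 / 3 = (3 / 2)^-1 :> K by rewrite invf_div.
have p1 : 0 < 1 + J%:R / 2 :> K by rewrite ltr_wpDr // mulr_ge0.
have p2 : 0 < (3 / 2) ^+ J :> K by rewrite exprn_gt0 //; lra.
rewrite exprVn lef_pV2 ?posrE // {p1 p2}.
elim: J => [|J IH]; first by rewrite expr0 mul0r addr0.
rewrite exprS -natr1; have J0 : 0 <= J%:R :> K by [].
apply: le_trans (_ : 3 / 2 * (1 + J%:R / 2) <= _); first by lra.
by rewrite ler_wpM2l //; lra.
Qed.

Section FarRegime.
Variables (K : realType).

(** Union bound over the subset of cluster i formed by the vertices with few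
    neighbours in S. *)
Lemma few_union (T I : finType) (cl : T -> I) (A : I -> I -> nat) (n : nat)
    (hcard : forall c, #|cluster_of cl c| = n)
    (i m : I) (S : {set T}) (K1 nb G g : nat) :
  i != m -> (0 < n)%N -> S \subset cluster_of cl m -> (0 < #|S|)%N -> (n <= nb * #|S|)%N ->
  (forall t, g <= t -> nb * (G + 3 * (K1 * t)) + K1 * t <= A i m * t)%N ->
  Pr K cl A (fun E => g <= #|[set u in cluster_of cl i | #|nbr E u :&: S| < K1]|)%N
    <= 2 ^+ n * (nb%:R * (2 / 3) ^+ G).
Proof.
move=> nim n0 sS S0 hnb hG.
rewrite -natrX -(hcard i) -card_powerset mulr_natl -sumr_const.
pose Q (X : {set T}) E := (g <= #|X|)%N && [forall u in X, #|nbr E u :&: S| <= K1]%N.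
apply: le_trans (_ : \sum_(X in powerset (cluster_of cl i)) Pr K cl A (Q X) <= _).
  apply: Pr_union => E EO hg.
  exists [set u in cluster_of cl i | (#|nbr E u :&: S| < K1)%N].
    by rewrite finset.powersetE; apply/subsetP => u; rewrite inE => /andP[].
  rewrite /Q hg; apply/forallP => u; apply/implyP; rewrite inE => /andP[_]; exact: ltnW.
apply: ler_sum => X; rewrite finset.powersetE => sX.
have [hg|hg] := leqP g #|X|; last first.
  rewrite /Pr /Ex big1 ?mul0r; last by move=> E _; rewrite /Q leqNgt hg.
  by rewrite mulr_ge0 // exprn_ge0.
have fn := @few_neighbours K T I cl A n hcard i m S X K1 nb G nim n0 sS S0 hnb sX (hG _ hg).
apply: le_trans fn.
by apply: Pr_le => E EO /andP[].
Qed.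

(** The function c is the prescribed degree into S. The rate B is arbitrary: the
    lower bound M on A i m makes the number K1 of neighbours that typical
    vertices have in both portions of cluster m, hence the gain Q per pair, as
    large as desired. *)
Lemma far_prob (eta B : K) : 0 < eta -> 0 <= B -> exists M : nat, forall d : nat, exists n0 : nat,
  forall (T I : finType) (cl : T -> I) (A : I -> I -> nat) (n : nat),
  (forall c, #|cluster_of cl c| = n) -> (forall i j, A i j = A j i) ->
  (forall i, (\sum_c A i c)%N = d) -> (n0 <= n)%N ->
  forall (i m : I) (S : {set T}) (c : T -> nat), i != m -> (M <= A i m)%N ->
  eta * n%:R <= #|cluster_of cl m :&: S|%:R -> eta * n%:R <= #|cluster_of cl m :\: S|%:R ->
  Pr K cl A (exact_degrees cl i S c) <= expR (- (B * n%:R)).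
Proof.
move=> eta0 B0.
(* Q^(-n/32) <= e^(-(B+2)n); there will be n/32 good pairs at least. *)
have [Q hQ] := exists_nat_ge (expR (32 * (B + 2))).
have Q0 : (0 < Q)%N.
  by rewrite -(ltr0n K); apply: lt_le_trans hQ; exact: expR_gt0.
pose K1 := (4 * Q ^ 2)%N.
(* J is such that (2/3)^J <= e^(-(B+4)). *)
have [J hJ] := exists_nat_ge (2 * expR (B + 4)).
have [nb hnb] := exists_nat_ge (eta^-1).
(* e^(-l g) <= e^(-(B+3)n) when g >= n/256. *)
pose l : K := 256 * (B + 3).
exists (nb * (256 * J + 3 * K1) + K1)%N => d.
have [N1 hN1] := exists_nat_ge (4 * d%:R ^+ 2 * expR l).
exists (256 + 8 * d.+1 + nb + N1)%N => T I cl A n hcard hsym hrow hn i m S c nim hM hS1 hS2.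
have n256 : (256 <= n)%N by clear -hn; lia.
have hn8 : (8 * d.+1 <= n)%N by clear -hn; lia.
have hnnb : (nb <= n)%N by clear -hn; lia.
have hnN1 : (N1 <= n)%N by clear -hn; lia.
have n0 : (0 < n)%N by apply: leq_trans n256.
(* About n/16 pairs are used, and each of the three kinds of exceptions may
   spoil g of them. *)
pose g := (n %/ 128)%N; pose p0 := (n %/ 16)%N.
have g256 : (n <= 256 * g)%N by rewrite /g; clear -n256; lia.
have p32 : (n <= 32 * (p0 - 3 * g))%N by rewrite /g /p0; clear -n256; lia.
have p16 : (8 * (2 * p0) <= n)%N by rewrite /p0; clear -n256; lia.
have p2 : (2 * p0 <= #|cluster_of cl i|)%N by rewrite hcard; clear -p16; lia.
have [ps [sps un eps]] := exists_pairing p2.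
have ei u : u \in entries ps -> u \in cluster_of cl i.
  by rewrite eps => /mem_take; rewrite mem_enum.
have clE u v : u \in cluster_of cl v -> cl u = v by rewrite inE => /eqP.
have nK : 0 < n%:R :> K by rewrite ltr0n.
have few (S' : {set T}) : S' \subset cluster_of cl m -> eta * n%:R <= #|S'|%:R ->
  Pr K cl A (fun E => g <= #|[set u in cluster_of cl i | #|nbr E u :&: S'| < K1]|)%N
    <= expR (- ((B + 2) * n%:R)).
  move=> sS' hS'; have S'0 : (0 < #|S'|)%N.
    by rewrite -(ltr0n K); apply: lt_le_trans hS'; rewrite mulr_gt0.
  have hnbS : (n <= nb * #|S'|)%N.
    rewrite -(ler_nat K) natrM; apply: le_trans (_ : nb%:R * (eta * n%:R) <= _).
      rewrite mulrA ler_peMl ?(ltW nK) //.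
      by rewrite -ler_pdivrMr // div1r.
    by rewrite ler_wpM2l.
  have hG t : (g <= t)%N -> (nb * (J * n + 3 * (K1 * t)) + K1 * t <= A i m * t)%N.
    move=> gt; have nt : (n <= 256 * t)%N by apply: leq_trans g256 _; rewrite leq_mul2l.
    apply: leq_trans (_ : (nb * (256 * J + 3 * K1) + K1) * t <= _)%N; last by rewrite leq_mul2r hM orbT.
    rewrite mulnDl leq_add2r -mulnA leq_mul2l; apply/orP; right.
    by rewrite mulnDl !mulnA leq_add2r (mulnC 256) -mulnA leq_mul2l nt orbT.
  apply: le_trans (few_union hcard nim n0 sS' S'0 hnbS hG) _.
  apply: le_trans (_ : expR n%:R * (expR n%:R * expR (- (B + 4)) ^+ n) <= _).
    have e2 : 2 <= expR 1 :> K by apply: le_trans (expR_ge1Dx _); lra.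
    apply: ler_pM; rewrite ?exprn_ge0 ?mulr_ge0 ?exprn_ge0 //.
      rewrite -[n%:R]mulr1 expRM_natl; apply: lerXn2r; rewrite ?nnegrE ?expR_ge0 //.
    apply: ler_pM; rewrite ?exprn_ge0 //.
      apply: le_trans (_ : n%:R <= _); first by rewrite ler_nat.
      by apply: le_trans (expR_ge1Dx _); rewrite lerDr.
    rewrite exprM; apply: lerXn2r; rewrite ?nnegrE ?expR_ge0 ?exprn_ge0 //.
    apply: le_trans (half_third_pow K J) _.
    have p1 : 0 < 1 + J%:R / 2 :> K by rewrite ltr_wpDr // mulr_ge0.
    rewrite expRN lef_pV2 ?posrE ?expR_gt0 //.
    by move: hJ; lra.
  rewrite -expRM_natl -!expRD ler_expR; lra.
have hcom : Pr K cl A (fun E => g <= count (common_nbr (cluster_of cl m) E) ps)%N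
    <= expR (- ((B + 2) * n%:R)).
  have l0 : 0 <= l by rewrite /l; lra.
  have h := @common_nbr_tail K T I cl A n d hcard hsym hrow hn8 ps (cluster_of cl m) m l g un.
  apply: le_trans (h _ _ _ _) _ => //; first by rewrite sps.
    by move=> u /ei/clE ui; rewrite inE ui.
  rewrite ler_expR.
  have hh : 4 * d%:R ^+ 2 * expR l <= n%:R by apply: le_trans hN1 _; rewrite ler_nat.
  have hg : n%:R <= 256 * g%:R :> K by rewrite -natrM ler_nat.
  have : (B + 3) * n%:R <= (B + 3) * (256 * g%:R) by rewrite ler_wpM2l // addr_ge0.
  rewrite /l; lra.
have fb := @far_block K T I cl A i m S c ps K1 Q g nim un ei Q0 (leqnSn K1).
apply: (le_trans fb).
rewrite sps.
have hQn : (Q%:R ^+ (p0 - 3 * g))^-1 <= expR (- ((B + 2) * n%:R)).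
  rewrite expRN lef_pV2 ?posrE ?expR_gt0 ?exprn_gt0 ?ltr0n //.
  apply: le_trans (_ : expR (32 * (B + 2)) ^+ (p0 - 3 * g) <= _); last first.
    by rewrite lerXn2r ?nnegrE ?expR_ge0.
  rewrite -expRM_natl ler_expR; have hp : n%:R <= 32 * (p0 - 3 * g)%N%:R :> K by rewrite -natrM ler_nat.
  have : (B + 2) * n%:R <= (B + 2) * (32 * (p0 - 3 * g)%N%:R) by rewrite ler_wpM2l // addr_ge0.
  lra.
have h1 := few (cluster_of cl m :&: S) (subsetIl _ _) hS1.
have h2 := few (cluster_of cl m :\: S) (subsetDl _ _) hS2.
apply: le_trans (_ : 4 * expR (- ((B + 2) * n%:R)) <= _); first by move: hcom h1 h2 hQn; lra.
have -> : - (B * n%:R) = 2 * n%:R + - ((B + 2) * n%:R) by ring.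
rewrite expRD ler_wpM2r ?expR_ge0 //; apply: le_trans (expR_ge1Dx _).
have : 256 <= n%:R :> K by rewrite ler_nat.
lra.
Qed.

End FarRegime.

(** * Partitions that split off a small portion of a cluster *)

Lemma card_entries_le (T : finType) (ps : seq (T * T)) (P : pred T) :
  (#|[set u in entries ps | P u]| <= 2 * count (fun p => P p.1 || P p.2) ps)%N.
Proof.
apply: leq_trans (_ : count P (entries ps) <= _)%N.
  rewrite -size_filter; apply: leq_trans (card_size _); apply: subset_leq_card.
  by apply/subsetP => u; rewrite !inE mem_filter andbC.
rewrite /entries count_cat !count_map; elim: ps => //= p ps IH.
by move: IH; case: (P p.1); case: (P p.2) => /=; lia.
Qed.

Lemma uniq_entries_sub (T : eqType) (ps qs : seq (T * T)) : subseq qs ps ->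
  uniq (entries ps) -> uniq (entries qs).
Proof. by move=> sq; apply: subseq_uniq; apply: cat_subseq; apply: map_subseq. Qed.

Lemma mem_entries_sub (T : eqType) (ps qs : seq (T * T)) : subseq qs ps ->
  {subset entries qs <= entries ps}.
Proof. by move=> sq; apply: mem_subseq; apply: cat_subseq; apply: map_subseq. Qed.

(** Exponential weighting: a set of size at most g contributes at least e^(-lg) to
    the sum of e^(-l|X|) over all subsets X, which is (1 + e^(-l))^|C|. *)
Lemma card_small_subsets (K : realType) (T : finType) (C : {set T}) (g : nat) (l : K) : 0 <= l ->
  #|[set X : {set T} | (X \subset C) && (#|X| <= g)%N]|%:R
    <= expR (l * g%:R + #|C|%:R * expR (- l)).
Proof.
move=> l0; rewrite expRD -ler_pdivrMl ?expR_gt0 // -expRN.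
apply: le_trans (_ : (1 + expR (- l)) ^+ #|C| <= _); last first.
  by rewrite expRM_natl lerXn2r ?nnegrE ?expR_ge0 ?addr_ge0 ?expR_ge0 ?expR_ge1Dx.
rewrite -sum_subsets -sum1_card natr_sum.
rewrite (eq_bigl (fun X : {set T} => (X \subset C) && (#|X| <= g)%N)); last by move=> X; rewrite inE.
rewrite big_mkcondr /= mulr_sumr; apply: ler_sum => X _.
case: ifP => hg; last by rewrite mulr0 exprn_ge0 ?expR_ge0.
by rewrite mulr1 -expRM_natl ler_expR mulrN lerN2 mulrC ler_wpM2l // ler_nat.
Qed.

Section MidRegime.
Variable (K : realType).

(** The rate kap must be fixed before d is, although the portion S' of S in the
    cluster m may have only order n/d vertices. This is possible since S' has
    at least order n edges, which reach a linear number of vertices of cluster i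
    ([small_nbhd]). These vertices are paired, and the pairs are cut into q groups
    in order that the vertices of one group absorb few edges of each other; one
    of the groups contains a linear number of pairs touching S', and [mid_block]
    applies to it. *)
Lemma mid_prob (k : nat) (lam : K) : (0 < k)%N -> 0 < lam ->
  exists kap eta : K, [/\ 0 < kap, 0 < eta &
  exists M : nat, forall d : nat, (M <= d)%N -> exists n0 : nat,
  forall (T I : finType) (cl : T -> I) (A : I -> I -> nat) (n : nat),
  (forall c, #|cluster_of cl c| = n) -> (forall i j, A i j = A j i) ->
  (forall i, (\sum_c A i c)%N = d) -> (n0 <= n)%N ->
  forall (i m : I) (S : {set T}) (c : T -> nat), (d <= k * A i m)%N ->
  lam * n%:R <= (d * #|cluster_of cl m :&: S|)%:R ->
  #|cluster_of cl m :&: S|%:R <= eta * n%:R ->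
  Pr K cl A (exact_degrees cl i S c) <= expR (- (kap * n%:R))].
Proof.
move=> k0 lam0.
have kK : 1 <= k%:R :> K by rewrite ler1n.
(* l is the exponent for [small_nbhd], chosen so that |S'| l d / (2k) exceeds
   2 d |S'| by at least 2n. *)
pose l : K := 4 * k%:R + 4 * k%:R / lam.
have l4 : 4 * k%:R <= l by rewrite lerDl divr_ge0 ?(ltW lam0) // mulr_ge0.
have l0 : 0 <= l by apply: le_trans l4; rewrite mulr_ge0.
have hl : lam * (l / (2 * k%:R)) = 2 * lam + 2.
  by rewrite /l; field; rewrite ?gt_eqF //=; lra.
have [q1 hq1] := exists_nat_ge (expR l).
have [E1 hE1] := exists_nat_ge (expR 1 : K).
have q10 : (0 < q1)%N by rewrite -(ltr0n K); apply: lt_le_trans hq1; exact: expR_gt0.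
have E10 : (0 < E1)%N by rewrite -(ltr0n K); apply: lt_le_trans hE1; exact: expR_gt0.
(* S' reaches more than n/q1 vertices of cluster i. A group has 2h vertices,
   about n/q, so that e b times their number is at most d/(8k). The n/q1 vertices
   fill at least n/q2 pairs of one group. *)
pose q := (32 * k * E1)%N; pose q2 := (8 * q * q1)%N.
have q0 : (32 <= q)%N by rewrite /q; clear -k0 E10; nia.
have qn0 : (0 < q)%N by apply: leq_trans q0.
have q20 : (0 < q2)%N by rewrite /q2 muln_gt0 q10 muln_gt0 qn0.
have q2K : 0 < q2%:R :> K by rewrite ltr0n.
have qK : 0 < q%:R :> K by rewrite ltr0n.
exists (1 / (18 * q2%:R)), (1 / (16 * q2%:R)); split; rewrite ?divr_gt0 ?mulr_gt0 //.
exists (256 * k * q2)%N => d hd.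
pose l3 : K := (32 * q2)%:R.
have [N1 hN1] := exists_nat_ge (4 * d%:R ^+ 2 * expR l3).
exists (8 * d.+1 + 16 * q2 * q1 * q + 54 * q2 * q + N1)%N.
move=> T I cl A n hcard hsym hrow hn i m S c ha hS1 hS2.
have hn8 : (8 * d.+1 <= n)%N by clear -hn; lia.
have hnq : (16 * q2 * q1 * q <= n)%N by clear -hn; lia.
have hnq' : (54 * q2 * q <= n)%N by clear -hn; lia.
have hnN1 : (N1 <= n)%N by clear -hn; lia.
have n0 : (0 < n)%N by clear -hn8; lia.
set S' := cluster_of cl m :&: S in hS1 hS2 *.
pose a := A i m.
have a0 : (0 < a)%N.
  rewrite lt0n; apply: contraTneq ha => e; rewrite -/a e muln0 -ltnNge.
  by apply: leq_trans hd; rewrite muln_gt0 q20 muln_gt0 k0.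
have nK : 0 < n%:R :> K by rewrite ltr0n.
have S16 : (16 * q2 * #|S'| <= n)%N.
  rewrite -(ler_nat K) natrM natrM mulrC -ler_pdivlMr ?mulr_gt0 // mulrC.
  by move: hS2; rewrite mul1r.
have S8 : (8 * #|S'| <= n)%N by clear -S16 q20; nia.
have sS' : S' \subset cluster_of cl m by exact: subsetIl.
pose g := (n %/ q1)%N; pose g0 := (n %/ q2)%N; pose g3 := (n %/ (8 * q2))%N.
pose h := (n %/ (2 * q)).+1.
have hg : (q1 * g <= n < q1 * g.+1)%N.
  by rewrite /g; clear -q10; have := ltn_ceil n q10; have := leq_divM n q1; nia.
have hg0 : (q2 * g0 <= n < q2 * g0.+1)%N.
  by rewrite /g0; clear -q20; have := ltn_ceil n q20; have := leq_divM n q2; nia.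
have q280 : (0 < 8 * q2)%N by rewrite muln_gt0.
have hg3 : (8 * q2 * g3 <= n < 8 * q2 * g3.+1)%N.
  by rewrite /g3; clear -q280; have := ltn_ceil n q280; have := leq_divM n (8 * q2)%N; nia.
have q202 : (0 < 2 * q)%N by rewrite muln_gt0.
have hh : (n < 2 * q * h <= n + 2 * q)%N.
  by rewrite /h; clear -q202; have := ltn_ceil n q202; have := leq_divM n (2 * q)%N; nia.
have h32 : (32 * h <= n)%N.
  clear -hh q0 hnq q20 q10; have : (2 * q <= n)%N by nia.
  by move=> ?; nia.
have q1n : (16 * q1 <= n)%N by clear -hnq q20 q0; nia.
have q2n : (16 * q2 <= n)%N by clear -hnq q10 q0; nia.
have g32 : (2 * n <= 32 * q2 * g3)%N by clear -hg3 q2n; nia.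
have da : d%:R / k%:R <= a%:R :> K.
  by rewrite ler_pdivrMr ?ltr0n // -natrM ler_nat mulnC.
pose b := edge_ratio K n d.
have bE : b = 2 * d%:R / n%:R by rewrite /b /edge_ratio natrM.
have e2 : 2 <= expR 1 :> K by apply: le_trans (expR_ge1Dx _); lra.
pose T0 E := [set u in cluster_of cl i | nbr E u :&: S' != finset.set0].
(* F2: S' has few neighbours in cluster i. F3: many pairs of a group have common
   neighbours. F4: many vertices of a group have more than a/2 neighbours
   inside the group. F5: the bets of the good pairs are all won. *)
have F2 : Pr K cl A (fun E => #|T0 E| <= g)%N <= expR (- n%:R).
  have sn := @small_nbhd K T I cl A n d hcard hsym hrow hn8 i m S' l g S8 sS' l0.
  apply: (le_trans sn); rewrite -/b -/a.
  have cs := @card_small_subsets K T (cluster_of cl i) g l l0.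
  apply: le_trans (ler_wpM2r (expR_ge0 _) cs) _; rewrite -expRD ler_expR hcard.
  have gl : expR l * g%:R <= n%:R.
    apply: le_trans (ler_wpM2r (ler0n K g) hq1) _; rewrite -natrM ler_nat.
    by case/andP: hg.
  have gl' : g%:R <= n%:R * expR (- l).
    by rewrite expRN ler_pdivlMr ?expR_gt0 // mulrC.
  have e1 : l * g%:R + n%:R * expR (- l) <= n%:R.
    apply: le_trans (_ : l * (n%:R * expR (- l)) + n%:R * expR (- l) <= _).
      by rewrite lerD2r ler_wpM2l.
    have -> : l * (n%:R * expR (- l)) + n%:R * expR (- l) = n%:R * ((1 + l) * expR (- l)) by ring.
    rewrite ler_piMr // expRN ler_pdivrMr ?expR_gt0 // mul1r; exact: expR_ge1Dx.
  have e3 : b * expR l * g%:R <= 2 * d%:R.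
    by rewrite bE -mulrA mulrAC ler_pdivrMr // ler_wpM2l // mulr_ge0.
  have e4 : d%:R * (l / (2 * k%:R)) <= l * (a%:R / 2).
    have -> : d%:R * (l / (2 * k%:R)) = l * ((d%:R / k%:R) / 2) by field; lra.
    by rewrite ler_wpM2l // ler_wpM2r.
  have e5 : #|S'|%:R * (b * expR l * g%:R - l * (a%:R / 2)) <= - (2 * n%:R).
    apply: le_trans (_ : #|S'|%:R * (2 * d%:R - d%:R * (l / (2 * k%:R))) <= _).
      by rewrite ler_wpM2l // lerB.
    have lk : 2 <= l / (2 * k%:R).
      by rewrite ler_pdivlMr ?mulr_gt0 ?(lt_le_trans ltr01 kK) //; lra.
    have := ler_wpM2r (_ : 0 <= l / (2 * k%:R) - 2) hS1.
    rewrite subr_ge0 => /(_ lk); rewrite mulrBr mulrAC hl natrM; lra.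
  by move: e1 e5; lra.
have F3 (ps : seq (T * T)) (R : {set T}) : (size ps <= h)%N -> uniq (entries ps) ->
    R \subset cluster_of cl m -> (forall u, u \in entries ps -> u \notin R) ->
    Pr K cl A (fun E => g3 <= count (common_nbr R E) ps)%N <= expR (- n%:R).
  move=> sps un sR eR; have s16 : (8 * (2 * size ps) <= n)%N by clear -sps h32; lia.
  have := @common_nbr_tail K T I cl A n d hcard hsym hrow hn8 ps R m l3 g3 un s16 sR eR (ler0n _ _).
  move/le_trans; apply; rewrite ler_expR.
  have hN : 4 * d%:R ^+ 2 * expR l3 <= n%:R by apply: le_trans hN1 _; rewrite ler_nat.
  have : 2 * n%:R <= l3 * g3%:R by rewrite /l3 -!natrM ler_nat.
  lra.
have F4 (L : {set T}) : (#|L| <= 2 * h)%N ->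
    Pr K cl A (fun E => g3 <= #|[set u in L | a < 2 * #|nbr E u :&: L|]|)%N <= expR (- n%:R).
  move=> cL; have L8 : (8 * #|L| <= n)%N by clear -cL h32; lia.
  pose D : K := d%:R / (8 * k%:R).
  have hLq : (q * #|L| <= 2 * n)%N by clear -cL hh hnq q20 q10; nia.
  have kn0 : k%:R != 0 :> K by rewrite gt_eqF // (lt_le_trans ltr01 kK).
  have bL : b * expR 1 * #|L|%:R <= D.
    have h1 : b * expR 1 * #|L|%:R <= 2 * d%:R / n%:R * (E1%:R * #|L|%:R).
      by rewrite bE -mulrA ler_wpM2l ?ler_wpM2r // divr_ge0 // mulr_ge0.
    apply: le_trans h1 _.
    have hLK : q%:R * #|L|%:R <= 2 * n%:R :> K by rewrite -!natrM ler_nat.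
    rewrite mulrAC ler_pdivrMr //.
    have E1K : 0 < E1%:R :> K by rewrite ltr0n.
    have qE : q%:R = 32 * k%:R * E1%:R :> K by rewrite /q !natrM.
    have eL : E1%:R * #|L|%:R <= n%:R / (16 * k%:R) :> K.
      rewrite ler_pdivlMr ?mulr_gt0 ?(lt_le_trans ltr01 kK) //.
      by move: hLK; rewrite qE; lra.
    apply: le_trans (ler_wpM2l _ eL) _; first by rewrite mulr_ge0.
    by rewrite le_eqVlt /D; apply/orP; left; apply/eqP; field.
  have aD : 2 * D <= 1 * (a%:R / 4).
    have -> : 2 * D = d%:R / k%:R / 4 by rewrite /D; field.
    by rewrite mul1r ler_wpM2r.
  have D0 : 0 <= D by rewrite divr_ge0 // mulr_ge0.
  have md := @many_dense K T I cl A n d hcard hsym hrow hn8 L L 1 g3 a L8 ler01.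
  apply: le_trans (md _) _; first by rewrite -/b; lra.
  rewrite -/b; apply: le_trans (_ : expR n%:R * expR (- (2 * n%:R)) <= _); last first.
    by rewrite -expRD ler_expR; lra.
  apply: ler_pM; rewrite ?exprn_ge0 ?expR_ge0 //.
    apply: le_trans (_ : expR 1 ^+ #|L| <= _).
      by rewrite lerXn2r ?nnegrE ?expR_ge0.
    rewrite -expRM_natl mulr1 ler_expR ler_nat; apply: leq_trans L8; exact: leq_pmull.
  rewrite ler_expR lerN2.
  have D32 : 32 * q2%:R <= D.
    rewrite ler_pdivlMr ?mulr_gt0 ?(lt_le_trans ltr01 kK) //.
    rewrite -!natrM ler_nat; apply: leq_trans hd; rewrite eq_leq //; ring.
  apply: le_trans (_ : g3%:R * D <= _); last by rewrite ler_wpM2l //; lra.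
  apply: le_trans (_ : g3%:R * (32 * q2%:R) <= _); last by rewrite ler_wpM2l.
  by rewrite [leRHS]mulrC -!natrM ler_nat.
pose N := (g0 - (g3 + g3 + 2 * #|S'|))%N.
have hN : (n <= 2 * q2 * N)%N by rewrite /N; clear -hg0 hg3 S16 q2n; nia.
have F5 : ((9 / 7) ^+ N)^-1 <= expR (- (n%:R / (9 * q2%:R))) :> K.
  rewrite -exprVn invf_div; apply: le_trans (_ : expR (- (2 / 9)) ^+ N <= _).
    rewrite lerXn2r ?nnegrE ?expR_ge0 //; apply: le_trans (expR_ge1Dx _); lra.
  rewrite -expRM_natl ler_expR mulrN lerN2 ler_pdivrMr ?mulr_gt0 //.
  have : n%:R <= 2 * q2%:R * N%:R :> K by rewrite -!natrM ler_nat.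
  lra.
(* S' is removed because it lies in cluster i when i = m; at most one vertex of
   the remaining set is left out by the pairing. *)
pose X0 := cluster_of cl i :\: S'.
pose P0 := (#|X0| %/ 2)%N.
have P02 : (2 * P0 <= #|X0|)%N by rewrite /P0 mulnC leq_divM.
have X0n : (#|X0| <= n)%N by rewrite -(hcard i) subset_leq_card // subsetDl.
have [ps0 [sps0 un0 eps0]] := exists_pairing P02.
pose ps (j : 'I_q) := take h (drop (j * h) ps0).
have sub j : subseq (ps j) ps0 by apply: subseq_trans (take_subseq _ _) (drop_subseq _ _).
have eX0 u : u \in entries ps0 -> u \in X0 by rewrite eps0 => /mem_take; rewrite mem_enum.
pose tch E (p : T * T) := (nbr E p.1 :&: S' != finset.set0) || (nbr E p.2 :&: S' != finset.set0).
have Fj j : Pr K cl A (fun E => exact_degrees cl i S c E && (g0 <= count (tch E) (ps j))%N)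
    <= 3 * expR (- (n%:R / (9 * q2%:R))).
  have unj := uniq_entries_sub (sub j) un0.
  have eXj u : u \in entries (ps j) -> u \in X0 by move=> /(mem_entries_sub (sub j))/eX0.
  have szj : (size (ps j) <= h)%N by rewrite size_take_min geq_minl.
  have eij u : u \in entries (ps j) -> u \in cluster_of cl i by move=> /eXj; rewrite inE => /andP[].
  have disj : [disjoint cluster_of cl m :&: S & [set u in entries (ps j)]].
    rewrite -setI_eq0 -subset0; apply/subsetP => u; rewrite in_setI [X in _ && X]in_set.
    by move=> /andP[uS /eXj]; rewrite in_setD uS.
  have mb := @mid_block K T I cl A hsym i m S c (ps j) g0 g3 g3 unj eij disj a0.
  apply: (le_trans mb); rewrite -/S' -/N -/a.
  have cLj : (#|[set u in entries (ps j)]| <= 2 * h)%N.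
    rewrite cardsE; apply: leq_trans (card_size _) _.
    by rewrite size_entries leq_mul2l szj orbT.
  have f3 := F3 (ps j) (cluster_of cl m :\: [set u in entries (ps j)]) szj unj (subsetDl _ _).
  have f4 := F4 _ cLj.
  have en : expR (- n%:R) <= expR (- (n%:R / (9 * q2%:R))) :> K.
    rewrite ler_expR lerN2 ler_pdivrMr ?mulr_gt0 // ler_peMr //.
    have : 1 <= q2%:R :> K by rewrite ler1n.
    lra.
  have {}f3 : Pr K cl A (fun E => g3 <= count (common_nbr (cluster_of cl m :\: [set u in entries (ps j)]) E) (ps j))%N <= expR (- n%:R).
    by apply: f3 => u ue; rewrite !inE ue.
  by move: f3 f4 F5 en; lra.
have psz : (size ps0 <= q * h)%N by rewrite sps0 /P0; clear -hh X0n; nia.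
have union E : E \in regular_graph_set cl A -> exact_degrees cl i S c E ->
    (#|T0 E| <= g)%N || [exists j : 'I_q, exact_degrees cl i S c E && (g0 <= count (tch E) (ps j))%N].
  move=> EO ->; rewrite -implyNb -ltnNge; apply/implyP => gT; apply/existsP.
  have hc := @card_entries_le T ps0 (fun u => nbr E u :&: S' != finset.set0).
  rewrite -/(tch E) in hc.
  have cX : (#|X0 :\: [set u in entries ps0]| <= 1)%N.
    have e : #|[set u in entries ps0]| = (2 * P0)%N.
      by rewrite cardsE (card_uniqP un0) size_entries sps0.
    rewrite cardsD (finset.setIidPr _) ?e; last by apply/subsetP => u; rewrite inE => /eX0.
    by rewrite /P0; clear; lia.
  have cT : (#|T0 E| <= #|S'| + (1 + #|[set u in entries ps0 | nbr E u :&: S' != finset.set0]|))%N.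
    apply: leq_trans (leq_add (leqnn _) (leq_add cX (leqnn _))).
    apply: leq_trans (leq_add (leqnn _) (leq_card_setU _ _)).
    apply: leq_trans (leq_card_setU _ _); apply/subset_leq_card/subsetP => u.
    rewrite /T0 in_set => /andP[ui hu]; rewrite in_setU; case: (boolP (u \in S')) => //= uS.
    have uX : u \in X0 by rewrite in_setD uS ui.
    by rewrite in_setU in_setD uX andbT !in_set hu andbT; case: (u \in entries ps0).
  have cnt : (q * g0 <= count (tch E) ps0)%N.
    have : (2 * q * g0 + #|S'| <= g)%N.
      rewrite -(leq_pmul2l q10); clear -hg hg0 S16 q1n q10 qn0.
      have : (q1 * (2 * q * g0) * 4 <= n)%N.
        by case/andP: hg0 => h0 _; apply: leq_trans h0; rewrite /q2 eq_leq //; ring.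
      have : (16 * (q1 * #|S'|) <= n)%N.
        apply: leq_trans S16; rewrite mulnA leq_mul2r leq_mul2l /=; apply/orP; right.
        by rewrite /q2 leq_pmull // muln_gt0.
      by nia.
    move: hc cT gT; clear; lia.
  have eq_count : (count (tch E) ps0 = \sum_(p <- ps0) tch E p)%N.
    by rewrite -sum1_count big_mkcond; apply: eq_bigr => p _; case: (tch E p).
  rewrite eq_count (sum_blocks _ psz) in cnt.
  have [j hj] := pigeonhole_sum qn0 cnt; exists j; rewrite /= (leq_trans hj) //.
  by rewrite -sum1_count [leqRHS]big_mkcond; apply: leq_sum => p _; case: (tch E p).
apply: le_trans (Pr_or K union) _.
have U : Pr K cl A (fun E => [exists j : 'I_q, exact_degrees cl i S c E && (g0 <= count (tch E) (ps j))%N])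
    <= \sum_(j < q) 3 * expR (- (n%:R / (9 * q2%:R))).
  apply: le_trans (ler_sum _ (fun j _ => Fj j)).
  by apply: Pr_union => E EO /existsP[j hj]; exists j.
rewrite sumr_const card_ord -[leRHS]mulr_natl in U.
have en : expR (- n%:R) <= expR (- (n%:R / (9 * q2%:R))) :> K.
  rewrite ler_expR lerN2 ler_pdivrMr ?mulr_gt0 // ler_peMr //.
  have : 1 <= q2%:R :> K by rewrite ler1n.
  lra.
apply: le_trans (lerD F2 U) _.
apply: le_trans (_ : (3 * q%:R + 1) * expR (- (n%:R / (9 * q2%:R))) <= _).
  by move: en; lra.
have -> : - (1 / (18 * q2%:R) * n%:R) = n%:R / (18 * q2%:R) + - (n%:R / (9 * q2%:R)) :> K.
  by field; rewrite gt_eqF.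
rewrite [leRHS]expRD; apply: ler_wpM2r; first exact: expR_ge0.
apply: le_trans (expR_ge1Dx _); rewrite addrC lerD2l ler_pdivlMr ?mulr_gt0 //.
have : 54 * q2%:R * q%:R <= n%:R :> K by rewrite -!natrM ler_nat.
lra.
Qed.

End MidRegime.

(** * The block model as a uniform graph *)

Section ModelGraphs.
Variables (R : realType) (k n : nat) (A : 'M[nat]_k).
Hypothesis hA : A^T = A.
Implicit Types (E : {set {set 'I_(k * n)}}) (C D : labelling k n) (F : block_family k n).

Let Asym i j : A i j = A j i. Proof. by rewrite -{1}hA mxE. Qed.

Lemma degree_inE (T : finType) (E : {set {set T}}) S v : degree_in E S v = #|nbr E v :&: S|.
Proof.
apply: eq_card => u; rewrite !inE /adj eq_sym finset.setUC.
by case: (u \in S); rewrite ?andbT ?andbF.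
Qed.

(** The compatibility of a partition amounts to a prescription of all degrees into
    its parts, in the form used for clusters; the two directions of each bipartite
    condition are exchanged by the symmetry of A. *)
Lemma compatibleP E D : reflect (forall v c, #|nbr E v :&: part D c| = A (D v) c) (compatible A E D).
Proof.
apply: (iffP andP) => [[/forallP h1 /forallP h2] v c|h].
  have [<-|nc] := eqVneq (D v) c.
    have /forallP/(_ v) := h1 (D v); rewrite inE eqxx /= degree_inE => /eqP ->.
    by [].
  have /forallP/(_ c) := h2 (D v); rewrite nc /= => /andP[/forallP/(_ v)].
  by rewrite inE eqxx /= degree_inE => /eqP.
split; first by apply/forallP => i; apply/forallP => v; apply/implyP; rewrite inE => /eqP <-; rewrite degree_inE h.
apply/forallP => i; apply/forallP => j; apply/implyP => nij; apply/andP; split.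
  by apply/forallP => v; apply/implyP; rewrite inE => /eqP <-; rewrite degree_inE h.
by apply/forallP => v; apply/implyP; rewrite inE => /eqP <-; rewrite degree_inE h Asym.
Qed.

Definition model_graphs C := regular_graph_set C (fun i j => A i j).

Lemma partE C c : cluster_of C c = part C c. Proof. by []. Qed.

Section GivenClusters.
Variable C : labelling k n.
Local Notation Omega := (model_graphs C).
Implicit Type p : block_index k.

Definition in_block p (e : {set 'I_(k * n)}) : bool :=
  [exists x, exists y, [&& x != y, e == [set x; y], C x == (val p).1 & C y == (val p).2]].

Lemma in_block_inj p q e : in_block p e -> in_block q e -> p = q.
Proof.
move=> /existsP[x /existsP[y /and4P[nxy /eqP-> /eqP x1 /eqP y2]]].
move=> /existsP[x' /existsP[y' /and4P[_ /eqP exy /eqP x1' /eqP y2']]].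
apply: val_inj; rewrite [val p]surjective_pairing [val q]surjective_pairing.
case: (set2_eq nxy exy) => -[ex ey]; subst x' y'.
  by rewrite -x1 -y2 -x1' -y2'.
have lp := valP p; have lq := valP q; rewrite -x1 -y2 -x1' -y2' in lp lq *.
have exy' : C x = C y by apply: ord_inj; apply/eqP; rewrite eqn_leq lp.
by rewrite exy'.
Qed.

(** The unordered pair of i and j, in increasing order; the default value of
    [insubd] is never reached. *)
Definition block_of (i j : 'I_k) : block_index k :=
  insubd (exist _ (i, i) (leqnn i)) (if (i <= j)%N then (i, j) else (j, i)).

Lemma block_ofE (i j : 'I_k) :
  (val (block_of i j) = (i, j)) \/ (val (block_of i j) = (j, i)).
Proof.
rewrite /block_of; have [h|h] := boolP (i <= j)%N.
  by rewrite val_insubd /= h; left.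
by rewrite -ltnNge in h; rewrite val_insubd /= (ltnW h); right.
Qed.

Lemma in_block_of (x y : 'I_(k * n)) : x != y -> in_block (block_of (C x) (C y)) [set x; y].
Proof.
move=> nxy; case: (block_ofE (C x) (C y)) => e; apply/existsP.
  by exists x; apply/existsP; exists y; rewrite nxy e !eqxx.
by exists y; apply/existsP; exists x; rewrite eq_sym nxy e !eqxx finset.setUC eqxx.
Qed.

Lemma block_ofC (i j : 'I_k) : block_of i j = block_of j i.
Proof.
apply: val_inj; have v1 := valP (block_of i j); have v2 := valP (block_of j i).
case: (block_ofE i j) => e1; case: (block_ofE j i) => e2; rewrite e1 e2 //; 
rewrite e1 /= in v1; rewrite e2 /= in v2.
  by have -> : i = j by apply: ord_inj; apply/eqP; rewrite eqn_leq v1 v2.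
by have -> : i = j by apply: ord_inj; apply/eqP; rewrite eqn_leq v1 v2.
Qed.

Definition restrict E : block_family k n := [ffun p => [set e in E | in_block p e]].

Definition valid F : bool :=
  [forall p, F p \in block_graphs A C (val p).1 (val p).2].

Lemma block_graph_in_block p (B : {set {set 'I_(k * n)}}) e :
  B \in block_graphs A C (val p).1 (val p).2 -> e \in B -> in_block p e.
Proof.
rewrite /block_graphs; case: eqP => [eij|/eqP nij]; rewrite inE => /andP[/forallP/(_ e)].
  move=> /implyP h _ eB; have /andP[/cards2P[x [y [nxy ->]]]] := h eB.
  rewrite finset.subUset !sub1set !inE => /andP[x1 y1].
  by apply/existsP; exists x; apply/existsP; exists y; rewrite nxy eqxx x1 -eij y1.
move=> /implyP h _ eB; have /existsP[x /andP[x1 /existsP[y /andP[y1 /eqP ->]]]] := h eB.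
rewrite !inE in x1 y1; apply/existsP; exists x; apply/existsP; exists y.
rewrite x1 y1 eqxx !andbT; apply: contraNneq nij => e'.
by rewrite -(eqP x1) -(eqP y1) e'.
Qed.

Lemma nbr_block p F v c : (forall q e, e \in F q -> in_block q e) ->
  p = block_of (C v) c -> nbr (sbm_graph F) v :&: part C c = nbr (F p) v :&: part C c.
Proof.
move=> hF ->; apply/setP => u; rewrite !inE; case: eqP => [<-|]; rewrite ?andbF ?andbT //.
rewrite /adj; case: (boolP (v != u)) => //= nvu; apply/idP/idP.
  move=> /bigcupP[q _ eq]; suff <- : q = block_of (C v) (C u) by [].
  by apply: in_block_inj (hF _ _ eq) _; apply: in_block_of.
by move=> h; apply/bigcupP; exists (block_of (C v) (C u)).
Qed.

Lemma block_graphs_degree p (B : {set {set 'I_(k * n)}}) :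
  (forall e, e \in B -> in_block p e) ->
  B \in block_graphs A C (val p).1 (val p).2 =
  [forall v, forall c, (block_of (C v) c == p) ==> (#|nbr B v :&: part C c| == A (C v) c)].
Proof.
move=> hB.
have ph : block_of (val p).1 (val p).2 = p.
  apply: val_inj; have vp := valP p; rewrite [RHS]surjective_pairing.
  case: (block_ofE (val p).1 (val p).2) => // e; have v1 := valP (block_of (val p).1 (val p).2).
  rewrite e /= in v1; rewrite e; have -> // : (val p).1 = (val p).2.
  by apply: ord_inj; apply/eqP; rewrite eqn_leq vp.
rewrite /block_graphs; case: eqP => [eij|/eqP nij]; rewrite inE.
  have -> /= : [forall e in B, (#|e| == 2%N) && (e \subset part C (val p).1)].
    apply/forallP => e; apply/implyP => /hB/existsP[x /existsP[y /and4P[nxy /eqP-> x1 y1]]].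
    by rewrite cards2 nxy finset.subUset !sub1set !inE x1 eij y1.
  apply/forallP/forallP => h v.
    apply/forallP => c; apply/implyP => /eqP e.
    have := block_ofE (C v) c; rewrite e [val p]surjective_pairing -eij.
    have := h v; rewrite inE degree_inE => hv.
    by case=> -[e1 e2]; rewrite -?e1 -?e2 eqxx /= in hv *; 
       rewrite ?e1 ?e2 in hv *.
  apply/implyP; rewrite inE degree_inE => /eqP e.
  have /forallP/(_ (val p).1) := h v; rewrite e.
  have ph1 : block_of (val p).1 (val p).1 = p by rewrite {2}eij.
  by rewrite ph1 eqxx.
have -> /= : [forall e in B, [exists u in part C (val p).1, [exists v in part C (val p).2, e == [set u; v]]]].
  apply/forallP => e; apply/implyP => /hB/existsP[x /existsP[y /and4P[nxy /eqP-> x1 y1]]].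
  by apply/existsP; exists x; rewrite inE x1 /=; apply/existsP; exists y; rewrite inE y1 eqxx.
apply/andP/forallP => [[/forallP h1 /forallP h2] v|h].
  apply/forallP => c; apply/implyP => /eqP e.
  have := block_ofE (C v) c; rewrite e [val p]surjective_pairing => -[] [e1 e2].
    by have := h1 v; rewrite inE degree_inE -e1 -e2 eqxx.
  by have := h2 v; rewrite inE degree_inE -e1 -e2 eqxx Asym.
split; apply/forallP => v; apply/implyP; rewrite inE degree_inE => /eqP e.
  by have /forallP/(_ (val p).2) := h v; rewrite e ph eqxx.
by have /forallP/(_ (val p).1) := h v; rewrite e block_ofC ph eqxx /= Asym.
Qed.

Lemma valid_in_block F q e : valid F -> e \in F q -> in_block q e.
Proof. by move=> /forallP/(_ q); apply: block_graph_in_block. Qed.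

Lemma valid_Omega F : valid F -> sbm_graph F \in Omega.
Proof.
move=> vF; apply/OmegaP; split.
  apply/forallP => e; apply/implyP => /bigcupP[q _ /(valid_in_block vF)].
  by move=> /existsP[x /existsP[y /and4P[nxy /eqP-> _ _]]]; rewrite cards2 nxy.
move=> v c; rewrite partE (nbr_block (fun q e => @valid_in_block F q e vF) erefl).
move: vF => /forallP/(_ (block_of (C v) c)) h.
have := h; rewrite block_graphs_degree; last by move=> e; apply: block_graph_in_block h.
by move=> /forallP/(_ v)/forallP/(_ c); rewrite eqxx /= => /eqP.
Qed.

Lemma restrictK E : simple E -> sbm_graph (restrict E) = E.
Proof.
move=> sE; apply/setP => e; apply/bigcupP/idP => [[p _]|eE].
  by rewrite ffunE inE => /andP[].
have [x [y [nxy ee _]]] := simple_edge sE eE.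
by exists (block_of (C x) (C y)) => //; rewrite ffunE inE eE /= ee in_block_of.
Qed.

Lemma sbm_graphK F : valid F -> restrict (sbm_graph F) = F.
Proof.
move=> vF; apply/ffunP => p; rewrite ffunE; apply/setP => e; rewrite inE.
apply/andP/idP => [[/bigcupP[q _ eq] eb]|eF].
  by rewrite -(in_block_inj (valid_in_block vF eq) eb).
by split; [apply/bigcupP; exists p | exact: valid_in_block eF].
Qed.

Lemma restrict_valid E : E \in Omega -> valid (restrict E).
Proof.
move=> EO; have /OmegaP[sE hE] := EO.
have hB q e : e \in restrict E q -> in_block q e by rewrite ffunE inE => /andP[].
apply/forallP => p; rewrite block_graphs_degree; last exact: hB.
apply/forallP => v; apply/forallP => c; apply/implyP => /eqP ep.
by rewrite -(nbr_block hB (esym ep)) restrictK // hE.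
Qed.

Lemma valid_sum (f : {set {set 'I_(k * n)}} -> R) :
  \sum_(F | valid F) f (sbm_graph F) = \sum_(E in Omega) f E.
Proof.
rewrite (reindex_onto restrict (@sbm_graph k n)); last by move=> F; apply: sbm_graphK.
apply: eq_big => [E|E].
  apply/andP/idP => [[/valid_Omega h /eqP e]|EO]; first by rewrite -e.
  by rewrite restrict_valid // restrictK ?eqxx //; case/OmegaP: EO.
by move=> /andP[_ /eqP ->].
Qed.

Lemma prod_valid F :
  \prod_(p : block_index k) (F p \in block_graphs A C (val p).1 (val p).2)%:R = (valid F)%:R :> R.
Proof.
case: (boolP (valid F)) => [/forallP vF|/forallPn[p hp]].
  by rewrite big1 // => p _; rewrite vF.
by rewrite (bigD1 p) //= (negbTE hp) mul0r.
Qed.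

(** A graph with the prescribed degrees is the same as an independent choice of an
    admissible graph in each block: [restrict] and [sbm_graph] are inverse
    bijections, and the product of uniform laws is uniform. *)
Lemma blocks_prob (Ev : pred {set {set 'I_(k * n)}}) :
  \sum_(F : block_family k n | Ev (sbm_graph F))
     \prod_(p : block_index k) uniform R (block_graphs A C (val p).1 (val p).2) (F p)
  = Pr R C (fun i j => A i j) Ev.
Proof.
have cO : #|Omega|%:R = \prod_(p : block_index k) #|block_graphs A C (val p).1 (val p).2|%:R :> R.
  rewrite (eq_bigr (fun p : block_index k => \sum_x (x \in block_graphs A C (val p).1 (val p).2)%:R)); last first.
    by move=> p _; rewrite -sum1_card natr_sum big_mkcond; apply: eq_bigr => x _; case: (x \in _).
  rewrite bigA_distr_bigA /=.
  have -> : #|Omega|%:R = \sum_(F | valid F) (1 : R).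
    by rewrite (valid_sum (fun=> 1)) sumr_const.
  rewrite big_mkcond; apply: eq_bigr => F _; rewrite prod_valid.
  by case: (valid F).
have pE F : \prod_(p : block_index k) uniform R (block_graphs A C (val p).1 (val p).2) (F p) =
    (valid F)%:R / #|Omega|%:R.
  by rewrite /uniform big_split /= prod_valid prodfV cO.
under eq_bigr do rewrite pE.
rewrite -mulr_suml /Pr /Ex; congr (_ / _).
rewrite -valid_sum big_mkcond [RHS]big_mkcond; apply: eq_bigr => F _.
by case: (valid F); case: (Ev _).
Qed.

End GivenClusters.
End ModelGraphs.

Section ModelNonempty.
Variables (k n : nat) (A : 'M[nat]_k).
Hypothesis hA : A^T = A.
Let Asym i j : A i j = A j i. Proof. by rewrite -{1}hA mxE. Qed.

(** The graphs on the abstract vertex sets given by the definition of the model are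
    transported to the clusters by numbering the vertices of each cluster. *)
Lemma model_graphs_neq0 (C : labelling k n) : model_defined A n ->
  C \in equipartitions k n -> model_graphs A C != finset.set0.
Proof.
move=> /andP[/forallP hR /forallP hB]; rewrite inE => /forallP hC.
have cC c : #|part C c| = n by apply/eqP/hC.
have mv v : v \in part C (C v) by rewrite inE.
have gP v : (index v (enum (part C (C v))) < n)%N by have := mv v; rewrite -mem_enum -index_mem -cardE cC.
pose g v := Ordinal (gP v).
have ginj c : {in part C c &, injective g}.
  move=> u v; rewrite !inE => /eqP uc /eqP vc /(congr1 val) /= e.
  rewrite -(@nth_index _ u u (enum (part C (C u)))); last by rewrite mem_enum.
  by rewrite e uc -vc nth_index // mem_enum.
have gT c : g @: part C c = [set: 'I_n].
  apply/eqP; rewrite eqEcard finset.subsetT /= cardsT card_ord card_in_imset ?cC //.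
have gcard c (P : pred 'I_n) : #|[set u in part C c | P (g u)]| = #|[set w | P w]|.
  rewrite -(@card_in_imset _ _ g (mem [set u in part C c | P (g u)])).
    apply: eq_card => w; rewrite inE; apply/imsetP/idP => [[u]|Pw].
      by rewrite inE => /andP[_ h] ->.
    have : w \in g @: part C c by rewrite gT inE.
    by move=> /imsetP[u uc e]; exists u => //; rewrite inE uc -e.
  by move=> u v; rewrite !inE => /andP[uc _] /andP[vc _]; apply: (ginj c); rewrite inE.
have [Rg hRg] : exists Rg : 'I_k -> {set {set 'I_n}}, forall i, Rg i \in regular_graphs n (A i i).
  by exists (fun i => xchoose (elimT (set0Pn _) (hR i))) => i; exact: xchooseP.
have [Bg hBg] : exists Bg : 'I_k * 'I_k -> {set {set ('I_n + 'I_n)%type}},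
    forall p, p.1 != p.2 -> Bg p \in bipartite_regular_graphs n (A p.1 p.2).
  have hB' (p : 'I_k * 'I_k) : exists B : {set {set ('I_n + 'I_n)%type}},
      (p.1 != p.2) ==> (B \in bipartite_regular_graphs n (A p.1 p.2)).
    case: p => i j /=; have [->|nij] := eqVneq i j; first by exists finset.set0.
    have /forallP/(_ j) := hB i; rewrite nij /= => /set0Pn[B hBB]; by exists B.
  by exists (fun p => xchoose (hB' p)) => p np; have /implyP := xchooseP (hB' p); apply.
pose r (x y : 'I_(k * n)) := if C x == C y then adj (Rg (C x)) (g x) (g y)
  else if (C x < C y)%N then adj (Bg (C x, C y)) (inl (g x)) (inr (g y))
  else adj (Bg (C y, C x)) (inl (g y)) (inr (g x)).
have rsym : symmetric r.
  move=> x y; rewrite /r eq_sym; case: eqP => [->|nC]; first by rewrite adjC.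
  have : C x != C y :> nat by apply/eqP => /ord_inj/esym.
  by case: ltngtP.
apply/set0Pn; exists (graph_of r); apply/OmegaP; split; first exact: simple_graph_of.
move=> v c; rewrite partE.
have [vc|nvc] := eqVneq (C v) c.
  have := hRg c; rewrite inE => /andP[_ /forallP/(_ (g v))].
  rewrite in_setT /= degree_inE finset.setIT vc => /eqP <-.
  rewrite -(gcard c (fun w => adj (Rg c) (g v) w)); apply: eq_card => u.
  rewrite !inE adj_graph_of // /r vc andbC; case: eqP => [uc|//] /=.
  rewrite uc eqxx; case: eqP => [->|]; rewrite ?adjxx //.
have cnt (B : {set {set ('I_n + 'I_n)%type}}) (w : 'I_n + 'I_n) (s : 'I_n -> ('I_n + 'I_n)%type) :
    injective s -> #|[set u in part C c | adj B w (s (g u))]| = #|nbr B w :&: [set s x | x : 'I_n]|.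
  move=> sinj; rewrite (gcard c (fun x => adj B w (s x))) -(card_imset _ sinj).
  apply: eq_card => y; rewrite !inE; apply/imsetP/andP => [[x]|[h /imsetP[x _ e]]].
    by rewrite inE => h ->; split=> //; apply/imsetP; exists x.
  by exists x => //; rewrite inE -e.
have il : [set inl x | x : 'I_n] = [set x : 'I_n + 'I_n | if x is inl _ then true else false].
  apply/setP => -[x|x]; rewrite inE; first by apply/imsetP; exists x.
  by apply/negbTE/imsetP => -[].
have ir : [set inr x | x : 'I_n] = [set x : 'I_n + 'I_n | if x is inr _ then true else false].
  apply/setP => -[x|x]; rewrite inE; last by apply/imsetP; exists x.
  by apply/negbTE/imsetP => -[].
have vne u : C u = c -> v != u by move=> uc; apply: contraNneq nvc => ->; rewrite uc.
have neq : C v != c :> nat by apply: contraNneq nvc => /ord_inj ->.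
case: (ltnP (C v) c) => lt.
  have := hBg (C v, c) nvc; rewrite inE => /andP[_ /andP[/forallP/(_ (inl (g v))) + _]].
  rewrite inE /= degree_inE -ir => /eqP <-; rewrite -cnt; last by move=> ? ? [].
  apply: eq_card => u; rewrite !inE adj_graph_of // /r andbC; case: eqP => [uc|//] /=.
  by rewrite uc vne // (negbTE nvc) lt.
have ncv : c != C v by rewrite eq_sym.
have := hBg (c, C v) ncv; rewrite inE => /andP[_ /andP[_ /forallP/(_ (inr (g v)))]].
rewrite inE /= degree_inE -il Asym => /eqP <-; rewrite -cnt; last by move=> ? ? [].
apply: eq_card => u; rewrite !inE adj_graph_of // /r andbC; case: eqP => [uc|//] /=.
by rewrite uc vne // (negbTE nvc) ltnNge lt /= adjC.
Qed.

(** The vertices are indexed by pairs (i, j) through the bijection used to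
    vectorise matrices. *)
Lemma equipartitions_neq0 : equipartitions k n != finset.set0.
Proof.
have [gi h1' h2'] := curry_mxvec_bij k n.
have h1 p : gi (uncurry (@mxvec_index k n) p) = p by exact: h1'.
have h2 v : uncurry (@mxvec_index k n) (gi v) = v by exact: h2'.
pose D : labelling k n := [ffun v => (gi v).1].
apply/set0Pn; exists D; rewrite inE; apply/forallP => c.
have -> : part D c = [set mxvec_index c j | j : 'I_n].
  apply/setP => v; rewrite inE ffunE; apply/eqP/imsetP => [<-|[j _ ->]].
    exists (gi v).2 => //; rewrite -{1}(h2 v); by case: (gi v).
  by rewrite -/(uncurry (@mxvec_index k n) (c, j)) h1.
rewrite card_imset ?card_ord // => j j' /(congr1 gi).
by rewrite -!/(uncurry (@mxvec_index k n) (c, _)) !h1 => -[].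
Qed.

End ModelNonempty.

(** * From given clusters to the model *)

Section ModelProbability.
Variables (R : realType) (k n : nat) (A : 'M[nat]_k).
Hypotheses (hA : A^T = A) (hdef : model_defined A n).
Variable Ev : labelling k n -> {set {set 'I_(k * n)}} -> bool.
Local Notation PrC C := (Pr R C (fun i j => A i j)).

Lemma sbm_probE : sbm_prob R A Ev =
  \sum_(C : labelling k n) uniform R (equipartitions k n) C * PrC C (Ev C).
Proof.
apply: eq_bigr => C _; rewrite -blocks_prob // mulr_sumr.
by apply: eq_bigr => F _.
Qed.

Lemma Pr_compl (T I : finType) (cl : T -> I) (B : I -> I -> nat) (P : pred {set {set T}}) :
  regular_graph_set cl B != finset.set0 ->
  Pr R cl B P = 1 - Pr R cl B (fun E => ~~ P E).
Proof.
move=> O0; have c0 : #|regular_graph_set cl B|%:R != 0 :> R by rewrite pnatr_eq0 cards_eq0.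
apply/eqP; rewrite eq_sym subr_eq eq_sym /Pr /Ex -mulrDl -big_split /=; apply/eqP.
rewrite (eq_bigr (fun=> 1)); last by move=> E _; case: (P E); rewrite ?addr0 ?add0r.
by rewrite sumr_const divff.
Qed.

Lemma sum_uniform (T : finType) (S : {set T}) : S != finset.set0 -> \sum_x uniform R S x = 1.
Proof.
move=> S0; rewrite /uniform -mulr_suml (eq_bigr (fun x => if x \in S then 1 else 0)).
  by rewrite -big_mkcond /= sumr_const divff // pnatr_eq0 cards_eq0.
by move=> x _; case: (x \in S).
Qed.

Lemma sbm_prob_le1 : sbm_prob R A Ev <= 1.
Proof.
rewrite sbm_probE -(sum_uniform (equipartitions_neq0 k n)); apply: ler_sum => C _.
rewrite ler_piMr ?divr_ge0 //.
apply: Ex_le => //; rewrite mul1r -sumr_const; apply: ler_sum => E _; by case: (Ev C E).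
Qed.

Lemma sbm_prob_ge (eps : R) :
  (forall C, C \in equipartitions k n -> PrC C (fun E => ~~ Ev C E) <= eps) ->
  1 - eps <= sbm_prob R A Ev.
Proof.
move=> h; rewrite sbm_probE.
apply: le_trans (_ : \sum_(C : labelling k n) uniform R (equipartitions k n) C * (1 - eps) <= _).
  by rewrite -mulr_suml sum_uniform ?equipartitions_neq0 // mul1r.
apply: ler_sum => C _; have [CE|CE] := boolP (C \in equipartitions k n); last first.
  by rewrite /uniform (negbTE CE) !mul0r.
apply: ler_wpM2l; first by rewrite divr_ge0.
rewrite Pr_compl; last exact: model_graphs_neq0.
by rewrite lerD2l lerN2 h.
Qed.

End ModelProbability.

(** * Partitions compared with the clusters *)

Section Misplaced.
Variables (k n : nat) (A : 'M[nat]_k) (d : nat).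
Hypotheses (hA : A^T = A) (hrow : forall i, (\sum_(j < k) A i j)%N = d).
Implicit Types (C D : labelling k n) (E : {set {set 'I_(k * n)}}) (pi : {ffun 'I_k -> 'I_k}).
Let Asym i j : A i j = A j i. Proof. by rewrite -{1}hA mxE. Qed.

Definition misplaced pi C D : {set 'I_(k * n)} := [set v | D v != pi (C v)].

(** Since S and its neighbours number less than n, every cluster has a vertex w
    outside S with no neighbour in S; its degrees are those of C and, up to pi,
    those of D, so pi preserves A. If a vertex w outside S had x as its only
    neighbour in S, the part of D that contains x would contain, besides x, exactly
    the neighbours of w in the cluster that pi sends to that part: one too many. *)
Lemma misplaced_no_unique_nbr pi C D E : injective pi ->
  C \in equipartitions k n -> E \in model_graphs A C -> compatible A E D ->
  (d.+1 * #|misplaced pi C D| < n)%N -> no_unique_nbr (misplaced pi C D) E.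
Proof.
move=> pinj; rewrite inE => /forallP hC EO /(compatibleP hA) hD hs.
set S := misplaced pi C D in hs *.
have [_ hE] := OmegaP _ _ _ EO.
have good v : v \notin S -> D v = pi (C v) by rewrite inE negbK => /eqP.
have aut i m : A i m = A (pi i) (pi m).
  pose Bd := S :|: \bigcup_(u in S) nbr E u.
  have cBd : (#|Bd| < n)%N.
    apply: leq_ltn_trans hs; apply: leq_trans (leq_card_setU _ _) _.
    rewrite mulSn leq_add2l; apply: leq_trans (_ : \sum_(u in S) #|nbr E u| <= _)%N.
      elim/big_rec2: _ => [|u X x _ IH]; first by rewrite cards0.
      by apply: leq_trans (leq_card_setU _ _) _; rewrite leq_add2l.
    rewrite (mulnC d) -sum_nat_const; apply: leq_sum => u _.
    by rewrite (total_degree (cl := C) (A := fun i j => A i j) hrow).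
  have /card_gt0P[w] : (0 < #|part C i :\: Bd|)%N.
    have h := cardsID Bd (part C i); rewrite (eqP (hC i)) in h.
    have h' : (#|part C i :&: Bd| <= #|Bd|)%N by rewrite subset_leq_card // subsetIr.
    by clear -h h' cBd; lia.
  rewrite in_setD in_setU negb_or => /andP[/andP[wS wN] wi].
  have nw u : u \in nbr E w -> u \notin S.
    move=> uw; apply: contraNN wN => uS; apply/bigcupP; exists u => //.
    by rewrite inE adjC; rewrite inE in uw.
  have cw : C w = i by move: wi; rewrite inE => /eqP.
  rewrite -cw -(good w wS) -hD -(hE w m) partE; apply: eq_card => u; rewrite !inE.
  case: (boolP (adj E w u)) => //= awu.
  have uS : u \notin S by apply: nw; rewrite inE.
  by rewrite (good u uS) (inj_eq pinj).
apply/forallP => w; apply/implyP => wS; apply/negP => /cards1P[x hx].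
have : x \in nbr E w :&: S by rewrite hx inE.
rewrite in_setI => /andP[xw xS].
have other u : u \in nbr E w -> u != x -> D u = pi (C u).
  move=> uw ux; apply: good; apply: contraNN ux => uS.
  have : u \in nbr E w :&: S by rewrite in_setI uw.
  by rewrite hx inE.
pose m := invF pinj (D x).
have pm : pi m = D x by rewrite f_invF.
have xm : C x != m by move: xS; rewrite inE -pm (inj_eq pinj) eq_sym.
have e : A (C w) m = A (D w) (D x) by rewrite aut (good w wS) pm.
have : #|nbr E w :&: part D (D x)| = (#|nbr E w :&: part C m|).+1.
  rewrite (cardsD1 x) in_setI xw inE eqxx /= add1n; congr _.+1; apply: eq_card => u.
  rewrite !inE; case: (boolP (adj E w u)) => [awu|]; last by rewrite andbF.
  case: (eqVneq u x) => [->|ux] /=; first by rewrite (negbTE xm).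
  by rewrite other ?inE // -pm (inj_eq pinj).
rewrite hD -partE (hE w m) -e => h; exact: (n_Sn _ h).
Qed.

Lemma misplaced_set0 pi C D : injective pi -> misplaced pi C D = finset.set0 ->
  [set part D i | i : 'I_k] = [set part C i | i : 'I_k].
Proof.
move=> pinj h0.
have e m : part D (pi m) = part C m.
  apply/setP => v; have : v \notin misplaced pi C D by rewrite h0 inE.
  by rewrite !inE negbK => /eqP ->; rewrite (inj_eq pinj).
apply/setP => X; apply/imsetP/imsetP => -[i _ ->].
  by exists (invF pinj i) => //; rewrite -e f_invF.
by exists (pi i) => //; rewrite e.
Qed.

Variable R : realType.

(** If no part splits a cluster in two large portions, each cluster has all but
    eta n of its vertices in one part, because its n vertices cannot be spread
    over k parts with less than eta n in each. Two clusters cannot choose the same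
    part, which has only n vertices. *)
Lemma near_or_far (eta : R) C D : (0 < n)%N -> C \in equipartitions k n -> D \in equipartitions k n ->
  2 * eta <= 1 -> k%:R * eta <= 1 ->
  (exists m l, eta * n%:R <= #|part C m :&: part D l|%:R /\ eta * n%:R <= #|part C m :\: part D l|%:R)
  \/ exists2 pi : {ffun 'I_k -> 'I_k}, injective pi &
     forall m, #|part C m :\: part D (pi m)|%:R < eta * n%:R.
Proof.
move=> n0 hC hD e2 ek; have nK : 0 < n%:R :> R by rewrite ltr0n.
have cC m : #|part C m| = n by move: hC; rewrite inE => /forallP/(_ m)/eqP.
have cD m : #|part D m| = n by move: hD; rewrite inE => /forallP/(_ m)/eqP.
case: (boolP [exists m, exists l, (eta * n%:R <= #|part C m :&: part D l|%:R) &&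
  (eta * n%:R <= #|part C m :\: part D l|%:R)]) => [/existsP[m /existsP[l /andP[h1 h2]]]|].
  by left; exists m, l.
move=> /existsPn hno; right.
have ex m : exists l, #|part C m :\: part D l|%:R < eta * n%:R.
  apply/existsP; apply: contraT => /existsPn hl.
  have lt l : #|part C m :&: part D l|%:R < eta * n%:R.
    have /existsPn/(_ l) := hno m; rewrite negb_and -!ltNge.
    by rewrite (negbTE (hl l)) orbF.
  have sum : (n = \sum_(l < k) #|part C m :&: part D l|)%N.
    rewrite -[LHS](cC m) -sum1_card (partition_big D predT) //=; apply: eq_bigr => l _.
    by rewrite -sum1_card; apply: eq_bigl => v; rewrite !inE.
  have k0 : (0 < k)%N by apply: leq_ltn_trans (ltn_ord m).
  have : (n%:R : R) < n%:R.
    rewrite {1}sum natr_sum; apply: lt_le_trans (_ : \sum_(l < k) eta * n%:R <= _).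
      apply: ltr_sum => //; apply/hasP; exists m; rewrite ?mem_index_enum //.
    by rewrite sumr_const card_ord -[_ *+ k]mulr_natl mulrA ler_piMl // ltW.
  by rewrite ltxx.
pose pi : {ffun 'I_k -> 'I_k} := [ffun m => xchoose (ex m)].
have hpi m : #|part C m :\: part D (pi m)|%:R < eta * n%:R.
  by rewrite ffunE; exact: (xchooseP (ex m)).
exists pi => // m m' e; apply/eqP; apply: contraT => nm.
have h1 := cardsID (part D (pi m)) (part C m); have h2 := cardsID (part D (pi m)) (part C m').
rewrite !cC in h1 h2.
have h3 : (#|part C m :&: part D (pi m)| + #|part C m' :&: part D (pi m)| <= n)%N.
  apply: (@leq_trans #|part D (pi m)|); last by rewrite cD.
  rewrite -cardsUI [X in (_ + X)%N](_ : _ = 0)%N ?addn0.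
    by apply: subset_leq_card; rewrite finset.subUset !subsetIr.
  apply/eqP; rewrite cards_eq0 -subset0; apply/subsetP => v; rewrite !inE.
  by move=> /andP[/andP[/eqP -> _] /andP[/eqP ee _]]; rewrite ee eqxx in nm.
have h4 := hpi m; have h5 := hpi m'; rewrite -e in h5.
have : (n <= #|part C m :\: part D (pi m)| + #|part C m' :\: part D (pi m)|)%N by clear -h1 h2 h3; lia.
rewrite -(ler_nat R) natrD => h6.
have : 2 * eta * n%:R <= 1 * n%:R by rewrite ler_wpM2r // ltW.
by clear -h4 h5 h6; lra.
Qed.

(** The misplaced vertices are classified by their cluster and their part. *)
Lemma misplaced_pigeonhole pi C D : (0 < #|misplaced pi C D|)%N ->
  exists m l, l != pi m /\ (#|misplaced pi C D| <= k * k * #|part C m :&: part D l|)%N.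
Proof.
set S := misplaced _ _ _ => S0.
pose x (p : 'I_k * 'I_k) := #|[set v in S | (C v, D v) == p]|.
have sum : #|S| = (\sum_p x p)%N.
  rewrite -sum1_card (partition_big (fun v => (C v, D v)) predT) //=.
  by apply: eq_bigr => p _; rewrite /x -sum1_card; apply: eq_bigl => v; rewrite !inE.
have /existsP[[m l] hp] : [exists p, (#|S| <= k * k * x p)%N].
  apply: contraT => /existsPn h.
  have : (\sum_(p : 'I_k * 'I_k) (k * k * x p).+1 <= \sum_(p : 'I_k * 'I_k) #|S|)%N.
    by apply: leq_sum => p _; rewrite ltnNge.
  rewrite sum_nat_const card_prod card_ord; under eq_bigr do rewrite -add1n.
  rewrite big_split /= -big_distrr /= -sum sum_nat_const card_prod card_ord muln1 => h'.
  have /card_gt0P[v _] := S0.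
  have k0 : (0 < k)%N by apply: leq_ltn_trans (ltn_ord (C v)).
  by move: h'; rewrite -[leqRHS]add0n leq_add2r leqNgt muln_gt0 k0.
exists m, l; split; last first.
  apply: leq_trans hp _; rewrite leq_mul2l; apply/orP; right.
  by apply/subset_leq_card/subsetP => v; rewrite !inE xpair_eqE => /andP[_].
have /card_gt0P[v] : (0 < x (m, l))%N.
  by rewrite lt0n; apply: contraTneq hp => ->; rewrite muln0 -ltnNge.
by rewrite !inE xpair_eqE => /andP[+ /andP[/eqP <- /eqP <-]].
Qed.

Lemma card_misplaced_sum pi C D :
  #|misplaced pi C D| = (\sum_(m < k) #|part C m :\: part D (pi m)|)%N.
Proof.
rewrite -sum1_card (partition_big C predT) //=; apply: eq_bigr => m _.
rewrite -sum1_card; apply: eq_bigl => v; rewrite !inE andbC.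
by case: eqP => [->|]; rewrite ?andbF ?andbT.
Qed.

(** Exponential weighting: a labelling with at most s misplaced vertices has weight
    at least e^(-ls), and the weights e^(-l|misplaced|) have a sum which factors
    over the vertices, each factor being at most 1 + k e^(-l). *)
Lemma count_near pi C (s l : R) : 0 <= l ->
  #|[set D : labelling k n | #|misplaced pi C D|%:R <= s]|%:R
    <= expR (l * s + (k * n)%:R * (k%:R * expR (- l))).
Proof.
move=> l0; rewrite expRD -ler_pdivrMl ?expR_gt0 // -expRN.
pose w (v : 'I_(k * n)) (j : 'I_k) : R := if j == pi (C v) then 1 else expR (- l).
apply: le_trans (_ : \prod_v \sum_j w v j <= _); last first.
  apply: le_trans (_ : \prod_(v : 'I_(k * n)) expR (k%:R * expR (- l)) <= _); last first.
    by rewrite prodr_const card_ord -expRM_natl.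
  apply: ler_prod => v _; apply/andP; split.
    by apply: sumr_ge0 => j _; rewrite /w; case: ifP => // _; rewrite expR_ge0.
  apply: le_trans (expR_ge1Dx _); rewrite (bigD1 (pi (C v))) //= {1}/w eqxx lerD2l.
  apply: le_trans (_ : \sum_(j : 'I_k) expR (- l) <= _); last first.
    by rewrite sumr_const card_ord -[leLHS]mulr_natl.
  rewrite [leRHS](bigD1 (pi (C v))) //= ler_wpDl ?expR_ge0 //; apply: ler_sum => j nj.
  by rewrite /w (negbTE nj).
rewrite bigA_distr_bigA /= -sum1_card natr_sum mulr_sumr big_mkcond /=.
apply: ler_sum => D _; rewrite inE.
have e : \prod_v w v (D v) = expR (- (l * #|misplaced pi C D|%:R)).
  rewrite -sum1_card natr_sum mulr_sumr -sumrN expR_sum [RHS]big_mkcond /=; apply: eq_bigr => v _.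
  by rewrite inE /w mulr1; case: eqP.
rewrite e; case: ifP => h; last exact: expR_ge0.
by rewrite mulr1 ler_expR lerN2 ler_wpM2l.
Qed.

End Misplaced.

(** * Uniqueness of the clusters *)

Section BadEvent.
Variables (R : realType) (k : nat).
Hypothesis k2 : (2 <= k)%N.

Lemma compatible_exact (n : nat) (A : 'M[nat]_k) (hA : A^T = A) (C D : labelling k n) (i l : 'I_k) :
  Pr R C (fun i j => A i j) (fun E => compatible A E D) <=
  Pr R C (fun i j => A i j) (exact_degrees C i (part D l) (fun u => A (D u) l)).
Proof.
apply: Pr_le => E _ /(compatibleP hA) h; apply/forallP => u; apply/implyP => _.
by rewrite h.
Qed.

(** Union bound over the three kinds of competing partitions. The far ones number at
    most k^(kn) <= e^(k^2 n), whence the rate B = k^2 + 1. For the near ones, l and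
    eta are chosen so that [count_near] yields at most e^(kap n / 2) for each
    permutation. *)
Lemma not_unique_prob : exists M : nat, forall (d : nat) (A : 'M[nat]_k),
  A^T = A -> (forall i j, (M <= A i j)%N) -> (forall i, (\sum_(j < k) A i j)%N = d) ->
  exists (Cst : R) (n0 : nat), forall (n : nat) (C : labelling k n), (n0 <= n)%N ->
    C \in equipartitions k n ->
    Pr R C (fun i j => A i j) (fun E => ~~ clusters_unique A C E) <= Cst / n%:R.
Proof.
have k0 : (0 < k)%N := ltnW k2.
have kK : 2 <= k%:R :> R by rewrite ler_nat.
have kpos : 0 < k%:R :> R by rewrite ltr0n.
(* The threshold between the two near cases is d|S| = c1 n; when d|S| exceeds it,
   some misplaced portion has d times its size at least lam n. *)
pose c1 : R := expR (- (40 * k%:R)).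
have c10 : 0 < c1 by exact: expR_gt0.
pose lam : R := c1 / (k%:R * k%:R).
have lam0 : 0 < lam by rewrite divr_gt0 ?mulr_gt0.
have [kap [eta1 [kap0 eta10 [M1 hmid]]]] := mid_prob k0 lam0.
pose l : R := 4 * (k%:R * k%:R) / kap.
have l0 : 0 < l by rewrite divr_gt0 ?mulr_gt0.
pose eta : R := Num.min eta1 (Num.min (kap / (4 * l * k%:R)) (1 / (2 * k%:R))).
have eta0 : 0 < eta.
  have h1 : 0 < kap / (4 * l * k%:R) by apply: divr_gt0 => //; do 2!apply: mulr_gt0 => //.
  have h2 : 0 < 1 / (2 * k%:R) :> R by apply: divr_gt0 => //; apply: mulr_gt0.
  by rewrite !lt_min eta10 h1 h2.
have etaE1 : eta <= eta1 by rewrite ge_min lexx.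
have etaE2 : eta <= kap / (4 * l * k%:R) by rewrite !ge_min lexx orbT.
have etaE3 : eta <= 1 / (2 * k%:R) by rewrite !ge_min lexx !orbT.
have keta : k%:R * eta <= 1 / 2.
  apply: le_trans (ler_wpM2l (ltW kpos) etaE3) _.
  by rewrite le_eqVlt; apply/orP; left; apply/eqP; field; rewrite gt_eqF.
have keta1 : k%:R * eta <= 1 by clear -keta; lra.
have eta2 : 2 * eta <= 1.
  by apply: le_trans keta1; rewrite ler_wpM2r // ltW.
pose B : R := k%:R * k%:R + 1.
have B0 : 0 <= B by rewrite addr_ge0 // mulr_ge0.
have [M2 hfar] := far_prob eta0 B0.
exists (8 + M1 + M2)%N => d A hA hM hrow.
have Asym i j : A i j = A j i by rewrite -{1}hA mxE.
have dM : (8 + M1 + M2 <= d)%N.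
  pose i0 := Ordinal k0; rewrite -(hrow i0) (bigD1 i0) //=.
  exact: leq_trans (hM i0 i0) (leq_addr _ _).
have d8 : (8 <= d)%N by clear -dM; lia.
have M1d : (M1 <= d)%N by clear -dM; lia.
have [n1 hmid'] := hmid d M1d; have [n2 hfar'] := hfar d.
exists (2 * d%:R + 1 + (k ^ k)%:R * (2 / kap)), (8 * d.+1 + n1 + n2)%N => n C hn CE.
have hn8 : (8 * d.+1 <= n)%N by clear -hn; lia.
have hn1 : (n1 <= n)%N by clear -hn; lia.
have hn2 : (n2 <= n)%N by clear -hn; lia.
have n0 : (0 < n)%N by clear -hn8; lia.
have nK : 0 < n%:R :> R by rewrite ltr0n.
have cC c : #|cluster_of C c| = n by move: CE; rewrite inE => /forallP/(_ c)/eqP.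
pose PrC := Pr R C (fun i j => A i j).
pose small E := [exists S : {set 'I_(k * n)}, [&& S != finset.set0,
  (d * #|S|)%:R <= expR (- (40 * #|'I_k|%:R)) * n%:R :> R & no_unique_nbr S E]].
pose isfar (D : labelling k n) := [exists m, exists l, (eta * n%:R <= #|part C m :&: part D l|%:R) &&
   (eta * n%:R <= #|part C m :\: part D l|%:R)].
pose isnear (p : {ffun 'I_k -> 'I_k} * labelling k n) :=
  (#|misplaced p.1 C p.2|%:R <= k%:R * eta * n%:R) &&
  [exists m, exists l, (lam * n%:R <= (d * #|part C m :&: part p.2 l|)%:R) &&
     (#|part C m :&: part p.2 l|%:R <= eta * n%:R)].
pose Efar E := [exists D, isfar D && compatible A E D].
pose Enear E := [exists p, isnear p && compatible A E p.2].
have Psmall : PrC small <= 2 * d%:R / n%:R.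
  by apply: small_regime => //; rewrite card_ord.
have decomp E : E \in model_graphs A C -> ~~ clusters_unique A C E ->
    small E || (Efar E || Enear E).
  move=> EO /forallPn[D]; rewrite !negb_imply => /and3P[DE cD neq].
  case: (near_or_far n0 CE DE eta2 keta1) => [[m [l' [h1 h2]]]|[pi pinj hpi]].
    apply/orP; right; apply/orP; left; apply/existsP; exists D; rewrite cD andbT.
    by apply/existsP; exists m; apply/existsP; exists l'; rewrite h1 h2.
  have mis0 : misplaced pi C D != finset.set0.
    by apply: contraNneq neq => e; rewrite (misplaced_set0 pinj e).
  have [hs|hs] := boolP ((d * #|misplaced pi C D|)%:R <= c1 * n%:R :> R).
    apply/orP; left; apply/existsP; exists (misplaced pi C D).
    rewrite mis0 card_ord hs /=; apply: (@misplaced_no_unique_nbr k n A d hA hrow) => //.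
    rewrite -(ltr_nat R); apply: le_lt_trans (_ : (2 * (d * #|misplaced pi C D|))%:R < _).
      by rewrite ler_nat mulnA leq_mul2r mul2n -addnn -addn1 leq_add2l (leq_trans _ d8) ?orbT.
    rewrite natrM; apply: le_lt_trans (ler_wpM2l (ler0n R 2) hs) _.
    rewrite mulrA gtr_pMl // /c1 expRN ltr_pdivrMr ?expR_gt0 // mul1r.
    by apply: lt_le_trans (expR_ge1Dx _); clear -kK; lra.
  apply/orP; right; apply/orP; right; apply/existsP; exists (pi, D); rewrite cD andbT.
  rewrite -ltNge in hs.
  have mis1 : (0 < #|misplaced pi C D|)%N by rewrite card_gt0.
  apply/andP; split.
    rewrite /= card_misplaced_sum natr_sum; apply: le_trans (_ : \sum_(m < k) eta * n%:R <= _).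
      by apply: ler_sum => m _; exact: ltW.
    by rewrite sumr_const card_ord -[leLHS]mulr_natl mulrA.
  have [m [l' [nl hl]]] := misplaced_pigeonhole mis1.
  apply/existsP; exists m; apply/existsP; exists l'; apply/andP; split.
    rewrite /lam mulrAC ler_pdivrMr ?mulr_gt0 //; apply: le_trans (ltW hs) _.
    by rewrite -!natrM ler_nat -mulnA leq_mul2l [leqRHS]mulnC hl orbT.
  apply: le_trans (ltW (hpi m)); rewrite ler_nat; apply/subset_leq_card/subsetP => v.
  by rewrite !inE => /andP[-> /eqP ->]; rewrite nl.
have Pfar : PrC Efar <= 1 / n%:R.
  apply: le_trans (_ : \sum_(D | isfar D) expR (- (B * n%:R)) <= _).
    apply: le_trans (_ : \sum_(D | isfar D) PrC (fun E => compatible A E D) <= _).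
      by apply: Pr_union => E EO /existsP[D /andP[h1 h2]]; exists D.
    apply: ler_sum => D /existsP[m /existsP[l' /andP[h1 h2]]].
    have [i im] : exists i, i != m.
      have c2 : (1 < #|'I_k|)%N by rewrite card_ord.
      have /card_gt0P[i] : (0 < #|[set~ m]|)%N by rewrite cardsC1 card_ord; clear -k2; lia.
      by rewrite !inE => ?; exists i.
    apply: le_trans (compatible_exact hA C D i l') _.
    apply: (hfar' _ _ C (fun i j => A i j) n cC Asym hrow hn2 i m (part D l') _ im) => //.
    exact: leq_trans (leq_addl _ _) (hM i m).
  apply: le_trans (_ : (k ^ (k * n))%:R * expR (- (B * n%:R)) <= _).
    rewrite sumr_const -[leLHS]mulr_natl ler_wpM2r ?expR_ge0 // ler_nat.
    by apply: leq_trans (max_card _) _; rewrite card_ffun !card_ord.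
  apply: le_trans (_ : expR (k%:R * k%:R * n%:R) * expR (- (B * n%:R)) <= _).
    rewrite ler_wpM2r ?expR_ge0 // natrX.
    have -> : k%:R * k%:R * n%:R = (k * n)%:R * k%:R :> R by rewrite natrM; ring.
    rewrite expRM_natl lerXn2r ?nnegrE ?expR_ge0 ?ler0n //.
    by apply: le_trans (expR_ge1Dx _); rewrite lerDr.
  rewrite -expRD (_ : _ + _ = - n%:R); last by rewrite /B; ring.
  rewrite expRN div1r lef_pV2 ?posrE ?expR_gt0 //.
  by apply: le_trans (expR_ge1Dx _); rewrite lerDr.
have Pnear : PrC Enear <= (k ^ k)%:R * (2 / kap) / n%:R.
  apply: le_trans (_ : \sum_(p | isnear p) expR (- (kap * n%:R)) <= _).
    apply: le_trans (_ : \sum_(p | isnear p) PrC (fun E => compatible A E p.2) <= _).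
      by apply: Pr_union => E EO /existsP[p /andP[h1 h2]]; exists p.
    apply: ler_sum => -[pi D] /andP[_ /existsP[m /existsP[l' /andP[h1 h2]]]] /=.
    (* The k entries of column m sum to d. *)
    have [i im] : exists i, (d <= k * A i m)%N.
      apply/existsP; apply: contraT => /existsPn hno.
      have : (\sum_(i < k) (k * A i m).+1 <= \sum_(i < k) d)%N.
        by apply: leq_sum => i _; rewrite ltnNge.
      rewrite sum_nat_const card_ord; under eq_bigr do rewrite -add1n Asym.
      rewrite big_split /= -big_distrr /= hrow sum_nat_const card_ord muln1.
      by rewrite -[leqRHS]add0n leq_add2r leqNgt k0.
    apply: le_trans (compatible_exact hA C D i l') _.
    apply: (hmid' _ _ C (fun i j => A i j) n cC Asym hrow hn1 i m (part D l') _ im) => //.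
    by apply: le_trans h2 _; rewrite ler_wpM2r // ltW.
  rewrite sumr_const -[leLHS]mulr_natl.
  apply: le_trans (_ : (k ^ k)%:R * expR (kap / 2 * n%:R) * expR (- (kap * n%:R)) <= _).
    rewrite ler_wpM2r ?expR_ge0 //.
    apply: le_trans (_ : \sum_(pi : {ffun 'I_k -> 'I_k})
        #|[set D : labelling k n | #|misplaced pi C D|%:R <= k%:R * eta * n%:R]|%:R <= _).
      rewrite -natr_sum ler_nat -sum1_card.
      under [leqRHS]eq_bigr do rewrite -sum1_card.
      rewrite pair_big_dep /= [leqRHS](bigID isnear) /=; apply: leq_trans (leq_addr _ _).
      rewrite eq_leq //; apply: eq_bigl => -[pi D]; rewrite unfold_in inE /=.
      by rewrite /isnear /=; case: (_ <= _).
    apply: le_trans (_ : \sum_(pi : {ffun 'I_k -> 'I_k}) expR (kap / 2 * n%:R) <= _); last first.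
      by rewrite sumr_const card_ffun !card_ord -[leLHS]mulr_natl.
    apply: ler_sum => pi _; apply: le_trans (count_near pi C _ (ltW l0)) _.
    rewrite ler_expR.
    have h1 : l * (k%:R * eta) <= kap / 4.
      apply: le_trans (_ : l * (k%:R * (kap / (4 * l * k%:R))) <= _).
        by rewrite ler_wpM2l ?(ltW l0) // ler_wpM2l.
      by rewrite le_eqVlt; apply/orP; left; apply/eqP; field; rewrite !gt_eqF.
    have h2 : k%:R * k%:R * expR (- l) <= kap / 4.
      rewrite expRN ler_pdivrMr ?expR_gt0 //.
      have e : k%:R * k%:R = kap / 4 * l by rewrite /l; field; rewrite gt_eqF.
      rewrite e ler_wpM2l ?divr_ge0 ?(ltW kap0) //.
      by apply: le_trans (expR_ge1Dx _); rewrite lerDr.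
    have -> : l * (k%:R * eta * n%:R) + (k * n)%:R * (k%:R * expR (- l)) =
       (l * (k%:R * eta) + k%:R * k%:R * expR (- l)) * n%:R by rewrite natrM; ring.
    rewrite ler_wpM2r //; clear -h1 h2; lra.
  rewrite -mulrA -expRD -[leRHS]mulrA ler_wpM2l //.
  have -> : kap / 2 * n%:R + - (kap * n%:R) = - (kap / 2 * n%:R) by field.
  have -> : 2 / kap / n%:R = (kap / 2 * n%:R)^-1 by field; rewrite !gt_eqF.
  rewrite expRN lef_pV2 ?posrE ?expR_gt0 ?mulr_gt0 ?divr_gt0 //.
  by apply: le_trans (expR_ge1Dx _); rewrite lerDr.
have h1 : PrC (fun E => ~~ clusters_unique A C E) <= PrC small + PrC (fun E => Efar E || Enear E).
  exact: Pr_or.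
have h2 : PrC (fun E => Efar E || Enear E) <= PrC Efar + PrC Enear by exact: Pr_or.
rewrite mulrDl mulrDl -/PrC -addrA; apply: (le_trans h1); apply: lerD => //.
by apply: (le_trans h2); apply: lerD.
Qed.

End BadEvent.

Theorem theorem3p1 (R : realType) (k : nat) (hk : (3 <= k)%N)
    (C : R) (hC : 0 < C) (delta epsilon : 'I_k -> 'I_k -> R)
    (hdelta : forall i j, 0 < delta i j < 1 / 4)
    (hepsilon : forall i j, 0 < epsilon i j < 1 / 4) :
  exists M : nat, forall (d : nat) (A : 'M[nat]_k),
    (0 < d)%N ->
    A^T = A ->
    (forall i j, (0 < A i j)%N) ->
    (forall i j, (M <= A i j)%N) ->
    (forall i, (\sum_(j < k) A i j)%N = d) ->
    (forall i, C * (A i i)%:R > (max_inter_degree A i)%:R) ->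
    (~ (forall i j, A i i = A j j) ->
      (forall i j, (A i i < A j j)%N ->
        (A i i)%:R >= (1 / 2 + 2 * delta i j) * (A j j)%:R) /\
      (forall i j, (A i i > A j j)%N ->
        (max_inter_degree A j > A i i - A j j)%N ->
        (1 / 2 - 2 * epsilon i j) * (A i i)%:R
          >= (max_inter_degree A j)%:R)) ->
    sbm_aas R A (fun n => @clusters_unique k n A).
Proof.
have [M hM] := not_unique_prob R (ltnW hk).
exists M => d A _ hA _ hMA hrow _ _.
have [Cst [n0 hn0]] := hM d A hA hMA hrow.
rewrite /sbm_aas; apply/cvgrPdist_le => eps eps0; rewrite near_withinE.
have [N hN] := exists_nat_ge (Cst / eps).
exists (n0 + N + 1)%N => // n /= hn hdef.
have n0' : (0 < n)%N by clear -hn; lia.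
have nN : (N <= n)%N by clear -hn; lia.
have nn0 : (n0 <= n)%N by clear -hn; lia.
have nK : 0 < n%:R :> R by rewrite ltr0n.
rewrite ger0_norm ?subr_ge0 ?sbm_prob_le1 // lerBlDr -lerBlDl.
apply: sbm_prob_ge => // D DE; apply: le_trans (hn0 n D nn0 DE) _.
rewrite ler_pdivrMr // mulrC -ler_pdivrMr //; apply: le_trans hN _.
by rewrite ler_nat.
Qed.
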